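(* Let $\nu>0$ and let $G(\nu)$ have the centered Gamma distribution with parameter $\nu$. Then there exist two constants $0<C_1<C_2$ (possibly depending on $\nu$) such that for every random variable $F$ in the second Wiener chaos associated with $X$ (i.e. $F=I_2(f)$ for some $f\in\mathfrak{H}^{\odot 2}$) with $\mathbb{E}[F^2]=2\nu$, $$C_1\,\mathbf{M}(F)\le d_2(F,G(\nu))\le C_2\,\mathbf{M}(F),$$ where $$\mathbf{M}(F)=\max\big\{|\kappa_4(F)-\kappa_4(G(\nu))|,\ |\kappa_3(F)-\kappa_3(G(\nu))|\big\}.$$
   Context: $\mathfrak{H}$ is a real separable Hilbert space and $X=\{X(h):h\in\mathfrak{H}\}$ is an isonormal Gaussian process over $\mathfrak{H}$, i.e. a centered jointly Gaussian family with $\mathbb{E}[X(g)X(h)]=\langle g,h\rangle_{\mathfrak{H}}$, on a probability space $(\Omega,\mathscr{F},P)$ with $\mathscr{F}$ generated by $X$. For $f\in\mathfrak{H}^{\odot q}$ (the symmetric $q$-th tensor power), $I_q(f)$ denotes the $q$-th multiple Wiener-Itô integral with $\mathbb{E}[I_q(f)^2]=q!\,\|f\|^2_{\mathfrak{H}^{\otimes q}}$; the $q$-th Wiener chaos is $\{I_q(f): f\in\mathfrak{H}^{\odot q}\}$. Centered Gamma distribution: $G(\nu)=2\widehat{G}(\nu/2)-\nu$ in law, where $\widehat{G}(\nu/2)$ has density $x^{\nu/2-1}e^{-x}\Gamma(\nu/2)^{-1}\mathbf{1}_{(0,\infty)}(x)$. Cumulants: $\kappa_r(F)=\frac{1}{i^r}\frac{d^r}{dt^r}\log\mathbb{E}[e^{itF}]\big|_{t=0}$.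 Distance: $d_2(X,Y)=\sup_{h\in\mathcal{H}_2}|\mathbb{E}[h(X)]-\mathbb{E}[h(Y)]|$, where $\mathcal{H}_2$ is the set of $h\in C^1(\mathbb{R})$ such that $h'$ is Lipschitz, $\|h'\|_\infty\le1$ and $\|h''\|_\infty\le 1$; here $\|h''\|_\infty$ denotes the smallest Lipschitz constant of $h'$. *)

(* Defs.v *)
From HB Require Import structures.
From mathcomp Require Import all_boot all_order all_algebra.
From mathcomp Require Import complex.
From mathcomp Require Import all_classical all_reals all_analysis measurable_realfun.

Set Implicit Arguments.
Unset Strict Implicit.
Unset Printing Implicit Defensive.

Import Order.TTheory GRing.Theory Num.Theory.
Import numFieldNormedType.Exports.

Local Open Scope classical_set_scope.
Local Open Scope ring_scope.

Section hilbert.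
Context {R : realType} {H : completeNormedModType R}.

(* With [H] complete, this makes [H] a real Hilbert space. *)
Definition is_inner_product (dot : {dot H for idfun}) :=
  forall x : H, dot x x = `|x| ^+ 2.

Definition separable (T : topologicalType) :=
  exists2 D : set T, countable D & dense D.

Variable dot : {dot H for idfun}.

(* The tensor square of H is realised as the space of Hilbert-Schmidt bilinear
   forms on H, with g (x) h corresponding to (x, y) |-> <g, x> <h, y>.  For
   every orthonormal basis (e_i) the squared tensor norm of f is
   \sum_(i, j) (f e_i e_j) ^+ 2, which is the supremum below. *)
Definition hs_sqnorm (f : H -> H -> R) : \bar R :=
  ereal_sup [set (\sum_(x <- e) \sum_(y <- e) f x y ^+ 2)%:E
            | e in [set e : seq H | orthonormal dot e]].

Definition sym_tensor2 (f : {symmetric H}) := (hs_sqnorm f < +oo)%E.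

(* [s] stands for the tensor \sum_((a, h) <- s) a (h (x) h). *)
Definition elem_tensor (s : seq (R * H)) (x y : H) : R :=
  \sum_(p <- s) p.1 * (dot p.2 x * dot p.2 y).

Definition unit_vectors (s : seq (R * H)) :=
  forall p, p \in s -> `|p.2| = 1.

End hilbert.

Section isonormal.
Context {R : realType} d {T : measurableType d} (P : probability T R).
Context {H : completeNormedModType R} (dot : {dot H for idfun}).

(* [normal_prob m 0] is not a Dirac mass, so degenerate laws are separate. *)
Definition gaussian (Y : T -> R) :=
  (exists m s : R, 0 < s /\
     forall B, measurable B -> pushforward P Y B = normal_prob m s B) \/
  (exists m : R, forall B, measurable B -> pushforward P Y B = \d_m B).

Definition isonormal (X : H -> {RV P >-> R}) :=
  [/\ forall s : seq (R * H), gaussian (fun w => \sum_(p <- s) p.1 * X p.2 w),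
      forall h, 'E_P[X h]%E = 0%E,
      forall g h, 'E_P[X g \* X h]%E = (dot g h)%:E
    & @measurable d T =
      <<s [set A | exists h B, measurable B /\ A = X h @^-1` B] >>].

Definition hermite2 (x : R) : R := x ^+ 2 - 1.

Definition elem_I2 (X : H -> {RV P >-> R}) (s : seq (R * H)) (w : T) : R :=
  \sum_(p <- s) p.1 * hermite2 (X p.2 w).

(* F = I_2(f) almost surely: I_2 is the continuous linear extension to all
   symmetric tensors, with values in L^2(P), of h (x) h |-> hermite2 (X h),
   |h| = 1; it satisfies E[I_2(f) ^+ 2] = 2 |f| ^+ 2. *)
Definition is_I2 (X : H -> {RV P >-> R}) (f : H -> H -> R)
    (F : {RV P >-> R}) :=
  exists s : nat -> seq (R * H),
    [/\ forall n, unit_vectors (s n),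
        hs_sqnorm dot (fun x y => f x y - elem_tensor dot (s n) x y)
          @[n --> \oo] --> 0%E
      & 'E_P[fun w => ((F w - elem_I2 X (s n) w) ^+ 2)%R]%E @[n --> \oo] --> 0%E].

Definition wiener_chaos2 (X : H -> {RV P >-> R}) (F : {RV P >-> R}) :=
  exists2 f : {symmetric H}, sym_tensor2 dot f & is_I2 X f F.

End isonormal.

Section gamma.
Context {R : realType}.
Notation mu := lebesgue_measure.

Definition Gamma (a : R) : R :=
  \int[mu]_(x in `]0, +oo[) (x `^ (a - 1) * expR (- x)).

Definition gamma_pdf (a : R) : R -> R :=
  (fun x => x `^ (a - 1) * expR (- x) / Gamma a) \_ `]0, +oo[.

Lemma gamma_pdf_ge0 a x : 0 <= gamma_pdf a x.
Proof.
apply: restrict_ge0 => {}x _; rewrite divr_ge0 ?mulr_ge0 ?powR_ge0 ?expR_ge0//.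
apply: fine_ge0; apply: integral_ge0 => y _.
by rewrite lee_fin mulr_ge0 ?powR_ge0 ?expR_ge0.
Qed.

Lemma measurable_gamma_pdf a : measurable_fun [set: R] (gamma_pdf a).
Proof.
apply/measurable_restrict => //; apply: measurable_funTS.
apply: measurable_funM => //; apply: measurable_funM.
  exact: measurable_powR.
by apply: measurableT_comp => //; exact: measurable_expR.
Qed.

Definition gamma_prob (a : R) : set _ -> \bar R :=
  fun V => (\int[mu]_(x in V) (gamma_pdf a x)%:E)%E.

Variable a : R.

Let gamma0 : gamma_prob a set0 = 0%E.
Proof. by rewrite /gamma_prob integral_set0. Qed.

Let gamma_ge0 A : (0 <= gamma_prob a A)%E.
Proof. by apply: integral_ge0 => x _; rewrite lee_fin gamma_pdf_ge0. Qed.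

Let gamma_sigma_additive : semi_sigma_additive (gamma_prob a).
Proof.
move=> /= F mF tF mUF; rewrite /gamma_prob; apply: cvg_toP.
  apply: ereal_nondecreasing_is_cvgn => m n mn.
  apply: lee_sum_nneg_natr => // k _ _; apply: integral_ge0 => /= x Fkx.
  by rewrite lee_fin gamma_pdf_ge0.
rewrite ge0_integral_bigcup//=.
- apply/measurable_funTS/measurableT_comp => //.
  exact: measurable_gamma_pdf.
- by move=> x _; rewrite lee_fin gamma_pdf_ge0.
Qed.

HB.instance Definition _ := isMeasure.Build _ _ _
  (gamma_prob a) gamma0 gamma_ge0 gamma_sigma_additive.

End gamma.

Section centered_gamma.
Context {R : realType} (nu : R).

Let affine (x : R) : R := 2 * x - nu.

Definition centered_gamma : set R -> \bar R :=
  pushforward (gamma_prob (nu / 2)) affine.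

Let measurable_affine : measurable_fun [set: R] affine.
Proof. by apply: measurable_funB => //; exact: measurable_funM. Qed.

Let centered_gamma0 : centered_gamma set0 = 0%E.
Proof. by rewrite /centered_gamma /pushforward preimage_set0 measure0. Qed.

Let centered_gamma_ge0 A : (0 <= centered_gamma A)%E.
Proof. exact: measure_ge0. Qed.

Let centered_gamma_sigma_additive : semi_sigma_additive centered_gamma.
Proof.
move=> F mF tF mUF; rewrite /centered_gamma /pushforward preimage_bigcup.
apply: measure_semi_sigma_additive.
- by move=> n; rewrite -[X in measurable X]setTI; exact: measurable_affine.
- apply/trivIsetP => /= i j _ _ ij; rewrite -preimage_setI.
  by move/trivIsetP : tF => /(_ _ _ _ _ ij) ->//; rewrite preimage_set0.
- by rewrite -preimage_bigcup -[X in measurable X]setTI; exact: measurable_affine.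
Qed.

HB.instance Definition _ := isMeasure.Build _ _ _ centered_gamma
  centered_gamma0 centered_gamma_ge0 centered_gamma_sigma_additive.

End centered_gamma.

Section cumulants.
Context {R : realType}.

(* Principal argument: arg(x + iy) = 2 arctan(y / (|z| + x)) off the half-line
   of nonpositive reals, where the denominator vanishes. *)
Definition Carg (z : R[i]) : R :=
  let: Complex x y := z in
  let r := Normc.normc z in
  if r + x == 0 then pi else 2 * atan (y / (r + x)).

Definition Cln (z : R[i]) : R[i] :=
  Complex (ln (Normc.normc z)) (Carg z).

Definition Cderive1n (n : nat) (f : R -> R[i]) (t : R) : R[i] :=
  Complex (derive1n n (fun s => complex.Re (f s)) t)
          (derive1n n (fun s => complex.Im (f s)) t).

Definition char_fun (mu : {measure set R -> \bar R}) (t : R) : R[i] :=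
  Complex (\int[mu]_x cos (t * x)) (\int[mu]_x sin (t * x)).

Definition cumulant (r : nat) (mu : {measure set R -> \bar R}) : R[i] :=
  (Complex 0 1 ^+ r)^-1 * Cderive1n r (fun t => Cln (char_fun mu t)) 0.

Definition cumulant_dist (r : nat) (mu1 mu2 : {measure set R -> \bar R}) : R :=
  Normc.normc (cumulant r mu1 - cumulant r mu2).

Definition Mdist (mu1 mu2 : {measure set R -> \bar R}) : R :=
  Num.max (cumulant_dist 4 mu1 mu2) (cumulant_dist 3 mu1 mu2).

End cumulants.

Section d2.
Context {R : realType}.

(* The last clause says that the smallest Lipschitz constant of h' is <= 1. *)
Definition H2 : set (R -> R) :=
  [set h : R -> R | [/\ forall x : R, derivable h x 1,
               continuous h^`()%classic,
               forall x, `|h^`()%classic x| <= 1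
             & 1.-lipschitz h^`()%classic ]].

Definition d2 (mu1 mu2 : {measure set R -> \bar R}) : \bar R :=
  ereal_sup [set `| \int[mu1]_x h x - \int[mu2]_x h x |%:E | h in H2].

End d2.

(* Main.v *)
Require Import Defs.
From HB Require Import structures.
From mathcomp Require Import all_boot all_order all_algebra.
From mathcomp Require Import ring lra.
From mathcomp Require Import all_classical all_reals all_analysis measurable_realfun.
Set Implicit Arguments.
Unset Strict Implicit.
Unset Printing Implicit Defensive.
Import Order.TTheory GRing.Theory Num.Theory.
Import numFieldNormedType.Exports.
Local Open Scope classical_set_scope.
Local Open Scope ring_scope.

(** For |s| small the resolvent A_s = (1 - 2 s D)^-1 is the averaging operator
    k |-> E k(. + 2 s Z), Z exponential.  A centered Gamma variable G satisfies
    E[G k(G)] = nu E[(A_1 k - k)(G)], and a sum F = sum_j alpha_j (N_j^2 - 1) of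
    squares of independent normal variables satisfies
    E[F k(F)] = sum_j alpha_j E[(A_(alpha_j) k - k)(F)].  Everything about the two
    laws is read off these two identities, which are instances of [gamma_stein]
    for a list of weights and scales; the power sums p_r of the scales enter
    through p_2 = nu, a_3 = p_3 - nu and a_4 = p_4 - nu.

    Upper bound ([gamma_stein_upper_bound]).  The equation of G is solved for a
    test function h by iterating a contraction ([stein_solution]); putting the
    solution in the identity of F leaves sum_j alpha_j (A_(alpha_j) - 1), whose
    expansion around alpha_j = 1 has a linear part with coefficient p_3 - p_2
    and a remainder controlled by sum_j alpha_j^2 (alpha_j - 1)^2
    = a_4 - 2 a_3 (when p_2 = nu).

    Cumulants ([stein_char_fun], [limit_cumulants]).  Tested against cos and sin
    the identity is a linear differential equation for the characteristic
    function, which is therefore exp(rho + i theta) with explicit rho and theta;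
    their derivatives at 0 give kappa_3 = 8 p_3 and kappa_4 = 48 p_4.

    Lower bound ([log_char_lower], [d2_lower]).  The functions cos(t x)/t and
    sin(t x)/t are admissible, so the distance controls the difference of the
    characteristic functions at one fixed small t.  With w(s) = 1/(1 - 2 i s),
    the derivative of the difference of the logarithms is
    - 2 t sum_j alpha_j^2 (w(alpha_j t) - w(t)), and
    w(a t) - w(t) = 2 i t (a - 1) w(t)^2 - 4 t^2 (a - 1)^2 w(t)^2 w(a t).
    Thus a_3 is the leading term of the argument, of order t^3, and a_4 the
    leading term of the modulus, of order t^4; the remainder is one order
    smaller, so a small t separates them.

    It remains to approximate the chaos.  A finite sum of a (X(h)^2 - 1) is
    brought to the form sum_j alpha_j (N_j^2 - 1) by orthonormalising the vectors
    h and diagonalising a symmetric matrix ([elem_I2_diag]); the identity for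
    such sums follows from Fourier uniqueness ([char_unique],
    [gaussian_quadratic_stein]).  The approximation holds in mean square
    ([chaos_approximation]), which carries over the test functions, and the
    logarithms of the characteristic functions converge with all their
    derivatives, their second and higher derivatives being uniformly bounded
    ([derive_limit]). *)

(** * Integrals of real functions *)

Section toolkit.
Context d (T : measurableType d) (R : realType) (m : {measure set T -> \bar R}).
Implicit Types f g : T -> R.

Lemma bounded_integrable f (M : R) : (m setT < +oo)%E ->
  measurable_fun setT f -> (forall x, `|f x| <= M) ->
  m.-integrable setT (EFin \o f).
Proof.
move=> mT mf fM; apply: measurable_bounded_integrable => //.
by exists M; split; [exact: num_real|move=> y My x _; exact: le_trans (fM x) (ltW My)].
Qed.

Lemma le_integrable_abs f g : measurable_fun setT f ->
  m.-integrable setT (EFin \o g) -> (forall x, `|f x| <= g x) ->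
  m.-integrable setT (EFin \o f).
Proof.
move=> mf ig fg; apply: (le_integrable measurableT _ _ ig).
  exact/measurable_EFinP.
move=> x _ /=; rewrite lee_fin (le_trans (fg x))// ler_norm//.
Qed.

Lemma Rdominated_cvg (f_ : nat -> T -> R) f g :
  (forall n, measurable_fun setT (f_ n)) ->
  (forall x, f_ n x @[n --> \oo] --> f x) ->
  m.-integrable setT (EFin \o g) ->
  (forall n x, `|f_ n x| <= g x) ->
  m.-integrable setT (EFin \o f) /\
  \int[m]_x f_ n x @[n --> \oo] --> \int[m]_x f x.
Proof.
move=> mf ff ig fg.
have mlim : measurable_fun setT f.
  by apply: (measurable_fun_cvg mf) => x _; exact: ff.
have [] := @dominated_convergence _ _ _ m _ measurableT
  (fun n x => (f_ n x)%:E) (EFin \o f) (EFin \o g).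
- by move=> n; exact/measurable_EFinP/mf.
- exact/measurable_EFinP.
- by apply: aeW => x _; apply: cvg_EFin; [exact: nearW|exact: ff].
- exact: ig.
- by apply: aeW => x n _; rewrite /= lee_fin.
move=> intf _ c; split => //.
apply: fine_cvg; rewrite fineK; last exact: integrable_fin_num.
exact: c.
Qed.

Lemma integrable_addR f g : m.-integrable setT (EFin \o f) ->
  m.-integrable setT (EFin \o g) ->
  m.-integrable setT (EFin \o (fun x => f x + g x)).
Proof. by move=> i1 i2; have := integrableD measurableT i1 i2. Qed.

Lemma Rintegral_sum (I : Type) (s : seq I) (f : I -> T -> R) :
  (forall i, m.-integrable setT (EFin \o f i)) ->
  m.-integrable setT (EFin \o (fun x => \sum_(i <- s) f i x)) /\
  \int[m]_x (\sum_(i <- s) f i x) = \sum_(i <- s) \int[m]_x f i x.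
Proof.
move=> intf; elim: s => [|i s [IH1 IH2]].
  split.
    apply: (eq_integrable _ (cst 0%E)) => //.
      by move=> x _; rewrite /= big_nil.
    exact: integrable0.
  rewrite big_nil; under eq_Rintegral do rewrite big_nil.
  by rewrite /Rintegral integral0.
split.
  rewrite (_ : (fun x => _) = (fun x => f i x + \sum_(j <- s) f j x)).
    exact: integrable_addR.
  by apply/funext => x; rewrite big_cons.
under eq_Rintegral do rewrite big_cons.
by rewrite RintegralD// IH2 big_cons.
Qed.

Lemma integrable_subR f g : m.-integrable setT (EFin \o f) ->
  m.-integrable setT (EFin \o g) ->
  m.-integrable setT (EFin \o (fun x => f x - g x)).
Proof. by move=> i1 i2; have := integrableB measurableT i1 i2. Qed.

Lemma integrable_scaleR (c : R) f : m.-integrable setT (EFin \o f) ->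
  m.-integrable setT (EFin \o (fun x => c * f x)).
Proof. by move=> i1; have := integrableZl measurableT c i1. Qed.

Lemma integrable_cstR (c : R) : (m setT < +oo)%E ->
  m.-integrable setT (EFin \o (fun=> c)).
Proof. by move=> mT; apply: (@bounded_integrable _ `|c|). Qed.

Lemma Rintegral_bound f (M : R) : m setT = 1%E ->
  measurable_fun setT f -> (forall x, `|f x| <= M) -> `|\int[m]_x f x| <= M.
Proof.
move=> mT mf fM.
have mT' : (m setT < +oo)%E by rewrite mT ltry.
apply: (le_trans (le_normr_Rintegral measurableT (bounded_integrable mT' mf fM))).
have -> : M = \int[m]_x (cst M x) by rewrite Rintegral_cst// mT mulr1.
apply: le_Rintegral => //.
- apply: (@bounded_integrable _ M) => //; first exact: measurableT_comp.
  by move=> x; rewrite normr_id.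
- exact: integrable_cstR.
Qed.

(** The density of a measure can be moved into the integrand. *)
Section density.
Variables (nu : {measure set T -> \bar R}) (p : T -> R).
Hypotheses (mp : measurable_fun setT p) (p0 : forall x, 0 <= p x).
Hypothesis nuE : forall V, measurable V -> (nu V = \int[m]_(x in V) (p x)%:E)%E.
Import HBNNSimple.

Lemma ge0_integral_density f : measurable_fun setT f -> (forall x, 0 <= f x) ->
  (\int[nu]_x (f x)%:E = \int[m]_x (f x * p x)%:E)%E.
Proof.
move=> mf f0.
have mEf : measurable_fun setT (EFin \o f) by exact/measurable_EFinP.
pose f_ := nnsfun_approx measurableT mEf.
transitivity (limn (fun n => \int[nu]_x (f_ n x)%:E)%E).
  rewrite -monotone_convergence//.
  - apply: eq_integral => y _; apply/esym/cvg_lim => //.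
    by apply: cvg_nnsfun_approx=> // x _; rewrite lee_fin.
  - by move=> n; exact/measurable_EFinP/measurable_funP.
  - by move=> n y _; rewrite lee_fin.
  - by move=> y _ a b ab; rewrite lee_fin; exact/lefP/nd_nnsfun_approx.
have Hn n : (\int[nu]_x (f_ n x)%:E = \int[m]_x (f_ n x * p x)%:E)%E.
  transitivity (\sum_(k \in range (f_ n))
      \int[m]_x (k * \1_(f_ n @^-1` [set k]) x * p x)%:E)%E; last first.
    rewrite -ge0_integral_fsum//.
    - by apply: eq_integral => x _; rewrite fsumEFin// fimfunE mulr_fsuml.
    - move=> r; apply/measurable_EFinP/measurable_funM => //.
      exact: measurable_funM.
    - move=> r x _; have := nnfun_muleindic_ge0 (f_ n) r x.
      by rewrite -EFinM !lee_fin => h; rewrite mulr_ge0.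
  under eq_integral do rewrite fimfunE -fsumEFin//.
  rewrite ge0_integral_fsum//; last 2 first.
  - by move=> y; exact/measurable_EFinP/measurable_funM.
  - by move=> y x _; rewrite nnfun_muleindic_ge0.
  apply: eq_fsbigr => r _; rewrite integralZl_indic_nnsfun// integral_indic//= setIT.
  have [r0|r0] := ltP r 0.
    rewrite preimage_nnfun0// measure0 mule0.
    by under eq_integral do rewrite indic0 mulr0 mul0r; rewrite integral0.
  rewrite nuE//.
  under [RHS]eq_integral do rewrite -mulrA EFinM.
  rewrite ge0_integralZl//; last 2 first.
  - by apply/measurable_EFinP/measurable_funM.
  - by move=> x _; rewrite lee_fin mulr_ge0.
  congr (_ * _)%E; rewrite integral_mkcond; apply: eq_integral => x _.
  by rewrite patchE indicE; case: (x \in _); rewrite ?mul1r ?mul0r.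
under eq_fun do rewrite Hn.
rewrite -monotone_convergence//.
- apply: eq_integral => y _; apply/cvg_lim => //.
  under eq_fun do rewrite EFinM; rewrite EFinM; apply: cvgeZr => //.
  by apply: cvg_nnsfun_approx=> // x _; rewrite lee_fin.
- move=> n; apply/measurable_EFinP/measurable_funM => //.
- by move=> n y _; rewrite lee_fin mulr_ge0.
- move=> y _ a b ab; rewrite lee_fin ler_wpM2r//.
  exact/lefP/nd_nnsfun_approx.
Qed.

Lemma integrable_density f : measurable_fun setT f ->
  nu.-integrable setT (EFin \o f) <-> m.-integrable setT (EFin \o (fun x => f x * p x)).
Proof.
move=> mf.
have E : (\int[nu]_x `|(f x)%:E| = \int[m]_x `|(f x * p x)%:E|)%E.
  rewrite (eq_integral (fun x => (`|f x|)%:E))//.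
  rewrite ge0_integral_density//; last exact: measurableT_comp.
  by apply: eq_integral => x _; rewrite /= normrM (ger0_norm (p0 x)).
have mfp : measurable_fun setT (fun x => f x * p x) by exact: measurable_funM.
split => /integrableP[m1 h]; apply/integrableP; split.
- exact/measurable_EFinP.
- by rewrite -E.
- exact/measurable_EFinP.
- by rewrite E.
Qed.

Lemma Rintegral_density f : measurable_fun setT f ->
  m.-integrable setT (EFin \o (fun x => f x * p x)) ->
  \int[nu]_x f x = \int[m]_x (f x * p x).
Proof.
move=> mf /(integrable_density mf) intf.
have mfp : measurable_fun setT (fun x => f x * p x) by exact: measurable_funM.
pose f1 := fun x => Num.max (f x) 0; pose f2 := fun x => Num.max (- f x) 0.
have f12 x : f x = f1 x - f2 x.
  rewrite /f1 /f2; case: (leP (f x) 0) => h.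
    by rewrite (max_l (y := 0)) ?oppr_ge0// sub0r opprK.
  by rewrite max_r ?oppr_le0 ?subr0// ltW.
have m1 : measurable_fun setT f1 by apply: measurable_maxr.
have m2 : measurable_fun setT f2.
  by apply: measurable_maxr => //; exact: measurableT_comp.
have absf x : `|f1 x| <= `|f x| /\ `|f2 x| <= `|f x|.
  rewrite /f1 /f2; case: (leP (f x) 0) => h.
    rewrite (max_l (y := 0)) ?oppr_ge0// normr0 normrN; split => //.
  by rewrite max_r ?oppr_le0 ?normr0// ltW.
have iabs : nu.-integrable setT (EFin \o (fun x => `|f x|)).
  by have := integrable_norm intf.
have i1 : nu.-integrable setT (EFin \o f1).
  by apply: (le_integrable measurableT _ _ intf);
    [exact/measurable_EFinP|move=> x _; rewrite /= lee_fin; exact: (absf x).1].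
have i2 : nu.-integrable setT (EFin \o f2).
  by apply: (le_integrable measurableT _ _ intf);
    [exact/measurable_EFinP|move=> x _; rewrite /= lee_fin; exact: (absf x).2].
under eq_Rintegral do rewrite f12.
rewrite RintegralB//.
under [RHS]eq_Rintegral do rewrite f12 mulrBl.
rewrite RintegralB//; [|exact/integrable_density|exact/integrable_density].
rewrite /Rintegral !ge0_integral_density//; first by move=> x; rewrite /f2 le_max lexx orbT.
by move=> x; rewrite /f1 le_max lexx orbT.
Qed.

End density.
End toolkit.
Section ftc.
Context (R : realType).
Notation mu := (@lebesgue_measure R).
Implicit Types f F : R -> R.

Lemma is_derive_continuous f df : (forall x : R, is_derive x 1 f (df x)) -> continuous f.
Proof.
by move=> h x; apply/differentiable_continuous/derivable1_diffP; have [] := h x.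
Qed.

Lemma continuous_integrable_itv f (a b : R) : continuous f ->
  mu.-integrable `[a, b] (EFin \o f).
Proof.
move=> cf; apply: continuous_compact_integrable; first exact: segment_compact.
exact: continuous_subspaceT.
Qed.

Lemma FTC_itv f F (a b : R) : a <= b -> continuous f ->
  (forall x : R, is_derive x 1 F (f x)) -> \int[mu]_(x in `[a, b]) f x = F b - F a.
Proof.
rewrite le_eqVlt => /predU1P[<- _ _|ab cf dF].
  by rewrite set_itv1 Rintegral_set1 subrr.
have cF := is_derive_continuous dF.
rewrite /Rintegral (@continuous_FTC2 _ f F)//.
- exact: continuous_subspaceT.
- split.
  + by move=> x _; have [] := dF x.
  + exact/cvg_at_right_filter/cF.
  + exact/cvg_at_left_filter/cF.
- by move=> x _; rewrite derive1E; have [_ ->] := dF x.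
Qed.

Lemma FTC_0y f F (l : R) : continuous f ->
  mu.-integrable `[0, +oo[ (EFin \o f) ->
  (forall x : R, is_derive x 1 F (f x)) ->
  F n%:R @[n --> \oo] --> l ->
  \int[mu]_(x in `[0, +oo[) f x = l - F 0.
Proof.
move=> cf intf dF Fl.
have mf : measurable_fun setT f by exact: continuous_measurable_fun.
have intf' : mu.-integrable setT (EFin \o (f \_ `[0, +oo[)).
  by rewrite -restrict_EFin; apply/integrable_restrict => //; rewrite setTI.
have [||||_] := @Rdominated_cvg _ _ _ mu (fun n => f \_ `[0, n%:R]) (f \_ `[0, +oo[)
  (fun x => `|(f \_ `[0, +oo[) x|).
- move=> n; apply/measurable_restrict => //; exact: measurable_funS mf.
- move=> x; rewrite !patchE.
  case: ifPn => [|].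
    rewrite inE/= in_itv/= andbT => x0.
    apply: cvg_near_cst; near=> n; rewrite patchE ifT// inE/= in_itv/= x0/=.
    near: n; exact: nbhs_infty_ger.
  rewrite notin_setE/= in_itv/= andbT => x0.
  apply: cvg_near_cst; apply: nearW => n; rewrite patchE ifF//.
  by apply/negbTE; rewrite notin_setE/= in_itv/= => /andP[].
- by have := integrable_norm intf'.
- move=> n x; rewrite !patchE; case: ifPn => [|_]; last by rewrite normr0.
  by rewrite inE/= in_itv/= => /andP[x0 _]; rewrite ifT// inE/= in_itv/= x0.

have -> : (fun n : nat => \int[mu]_x (f \_ `[0, n%:R]) x) = fun n => F n%:R - F 0.
  by apply/funext => n; rewrite -Rintegral_mkcond (@FTC_itv f F).
rewrite -Rintegral_mkcond => H.
have U : F n%:R - F 0 @[n --> \oo] --> l - F 0.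
  by apply: cvgB => //; exact: cvg_cst.
exact: (cvg_unique _ H U).
Unshelve. all: by end_near. Qed.

Lemma FTC_T f F (l l' : R) : continuous f ->
  mu.-integrable setT (EFin \o f) ->
  (forall x : R, is_derive x 1 F (f x)) ->
  F n%:R @[n --> \oo] --> l -> F (- n%:R) @[n --> \oo] --> l' ->
  \int[mu]_x f x = l - l'.
Proof.
move=> cf intf dF Fl Fl'.
have mf : measurable_fun setT f by exact: continuous_measurable_fun.
have [||||_] := @Rdominated_cvg _ _ _ mu (fun n => f \_ `[- n%:R, n%:R]) f
  (fun x => `|f x|).
- move=> n; apply/measurable_restrict => //; exact: measurable_funS mf.
- move=> x; apply: cvg_near_cst; near=> n; rewrite patchE ifT// inE/= in_itv/= -ler_norml.
  near: n; exact: nbhs_infty_ger.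
- by have := integrable_norm intf.
- move=> n x; rewrite !patchE; case: ifPn => [_|_]; rewrite ?normr0//.

have -> : (fun n : nat => \int[mu]_x (f \_ `[- n%:R, n%:R]) x) =
    fun n => F n%:R - F (- n%:R).
  apply/funext => n; rewrite -Rintegral_mkcond (@FTC_itv f F)//.
  by rewrite (@le_trans _ _ 0) ?oppr_le0 ?ler0n.
move=> H.
have U : F n%:R - F (- n%:R) @[n --> \oo] --> l - l'.
  by apply: cvgB.
exact: (cvg_unique _ H U).
Unshelve. all: by end_near. Qed.

(** A function whose derivative is at most eps off one point moves by at most
    eps times the distance. *)
Lemma MVT_abs f (df : R -> R) (a b eps : R) : a <= b ->
  (forall x, x \in `]a, b[ -> is_derive x 1 f (df x)) ->
  {within `[a, b], continuous f} ->
  (forall x, x \in `]a, b[ -> `|df x| <= eps) ->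
  `|f b - f a| <= eps * (b - a).
Proof.
rewrite le_eqVlt => /predU1P[<- _ _ _|ab dfE cf dfe].
  by rewrite !subrr normr0 mulr0.
have [c cab ->] := MVT ab dfE cf.
by rewrite normrM (gtr0_norm (x := b - a)) ?subr_gt0// ler_wpM2r ?dfe// subr_ge0 ltW.
Qed.

Lemma cvgn_expN : expR (- n%:R) @[n --> \oo] --> (0 : R).
Proof.
apply: (@cvg_comp _ _ _ (fun n : nat => n%:R : R) (fun x : R => expR (- x)) _ (pinfty_nbhs R)).
  exact: cvgr_idn.
exact: cvgr_expR.
Qed.

End ftc.

(** * Exponential averages *)

Section calculus.
Context (R : realType).
Notation mu := (@lebesgue_measure R).
Implicit Types f g : R -> R.

#[export] Instance is_derive_expRc g (x dg : R) :
  is_derive x 1 g dg -> is_derive x 1 (fun y => expR (g y)) (expR (g x) * dg).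
Proof. by move=> h; apply: (@is_derive1_comp _ expR g). Qed.

#[export] Instance is_derive_cosc g (x dg : R) :
  is_derive x 1 g dg -> is_derive x 1 (fun y => cos (g y)) (- sin (g x) * dg).
Proof. by move=> h; apply: (@is_derive1_comp _ cos g). Qed.

#[export] Instance is_derive_sinc g (x dg : R) :
  is_derive x 1 g dg -> is_derive x 1 (fun y => sin (g y)) (cos (g x) * dg).
Proof. by move=> h; apply: (@is_derive1_comp _ sin g). Qed.

Lemma is_derive_atanc g (x dg : R) :
  is_derive x 1 g dg ->
  is_derive x 1 (fun y => atan (g y)) ((1 + g x ^+ 2)^-1 * dg).
Proof. by move=> h; apply: (@is_derive1_comp _ atan g). Qed.

Lemma is_derive_lnc g (x dg : R) : 0 < g x ->
  is_derive x 1 g dg -> is_derive x 1 (fun y => ln (g y)) ((g x)^-1 * dg).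
Proof. by move=> g0 h; apply: (@is_derive1_comp _ (@ln R) g); exact: is_derive1_ln. Qed.

Lemma is_derive_affinec f (a b x df : R) :
  is_derive (a + b * x) 1 f df -> is_derive x 1 (fun y => f (a + b * y)) (b * df).
Proof.
move=> h; have h2 : is_derive x 1 (fun y : R => a + b * y) b.
  by apply: is_derive_eq; rewrite /GRing.scale/=; ring.
rewrite [b * df]mulrC; exact: (@is_derive1_comp _ f (fun y => a + b * y) x df b h h2).
Qed.

Lemma primitive_exists f : continuous f ->
  exists F : R -> R, forall x : R, is_derive x 1 F (f x).
Proof.
move=> cf.
pose I (a x : R) := \int[mu]_(t in `[a, x]) f t - \int[mu]_(t in `[a, 0]) f t.
have Ia (a a' x : R) : a <= a' -> a' <= x -> a' <= 0 -> I a x = I a' x.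
  move=> aa' a'x a'0; rewrite /I.
  have E y : a' <= y -> \int[mu]_(t in `[a, y]) f t =
      \int[mu]_(t in `[a, a']) f t + \int[mu]_(t in `[a', y]) f t.
    move=> a'y; have := @Rintegral_itvB R f (BLeft a) (BRight y) a'.
    rewrite !bnd_simp => /(_ (continuous_integrable_itv a y cf) aa' a'y).
    rewrite Rintegral_itv_obnd_cbnd; first by move=> <-; ring.
    by apply: integrableS (continuous_integrable_itv a' y cf) => //; exact: subset_itv_oc_cc.
  by rewrite (E x)// (E 0)//; ring.
exists (fun x => I (- (`|x| + 1)) x) => x.
apply: (@near_eq_is_derive _ _ _ (I (- (`|x| + 2)))).
  near=> y; apply/Ia.
  - rewrite lerN2.
    have : `|y - x| < 1 by near: y; exists 1 => //= z; rewrite distrC.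
    have := ler_normD (y - x) x; rewrite subrK; lra.
  - by have := ler_norm (- y); rewrite normrN; lra.
  - by rewrite oppr_le0 addr_ge0.
have ax : - (`|x| + 2) < x by have := ler_norm (- x); rewrite normrN; lra.
have xu : x < x + 1 by rewrite ltrDl.
have [] := @continuous_FTC1_closed _ f (- (`|x| + 2)) x (x + 1) xu _ ax.
- exact: continuous_integrable_itv.
- exact: cf.
move=> d1 d2.
have h : is_derive x 1 (fun y => \int[mu]_(t in `[- (`|x| + 2), y]) f t) (f x).
  by apply: DeriveDef; [exact: d1|rewrite -derive1E; exact: d2].
by rewrite /I; apply: is_derive_eq; rewrite subr0.
Unshelve. all: by end_near. Qed.

End calculus.

Section expo.
Context (R : realType).
Notation mu := (@lebesgue_measure R).
Implicit Types f g : R -> R.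

Definition expo : probability (measurableTypeR R) R :=
  exponential_distribution.exponential_distribution_exponential_prob__canonical__probability_measure_Probability
    (@ltr01 R).

Lemma expoT : expo setT = 1%E. Proof. exact: probability_setT. Qed.

Lemma expo_fin : (expo setT < +oo)%E. Proof. by rewrite expoT ltry. Qed.

Lemma expo_pdfE f : (fun x => f x * exponential_pdf 1 x) =
  (fun x => expR (- x) * f x) \_ `[0, +oo[.
Proof.
apply/funext => x; rewrite patchE /exponential_pdf patchE.
by case: ifPn => _; rewrite ?mulr0// mul1r mulN1r mulrC.
Qed.

Lemma integrable_expo f : measurable_fun setT f ->
  expo.-integrable setT (EFin \o f) <->
  mu.-integrable `[0, +oo[ (EFin \o (fun x => expR (- x) * f x)).
Proof.
move=> mf.
have := @integrable_density _ (measurableTypeR R) R mu expo (exponential_pdf 1)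
  (measurable_exponential_pdf 1) (@exponential_pdf_ge0 _ 1 ler01) (fun _ _ => erefl) f mf.
rewrite expo_pdfE => ->.
rewrite -restrict_EFin; split => h.
  by have /integrable_restrict := h; rewrite setTI; apply.
by apply/integrable_restrict => //; rewrite setTI.
Qed.

Lemma Rintegral_expo f : measurable_fun setT f ->
  expo.-integrable setT (EFin \o f) ->
  \int[expo]_x f x = \int[mu]_(x in `[0, +oo[) (expR (- x) * f x).
Proof.
move=> mf intf.
rewrite (@Rintegral_density _ (measurableTypeR R) R mu expo (exponential_pdf 1)
  (measurable_exponential_pdf 1) (@exponential_pdf_ge0 _ 1 ler01) (fun _ _ => erefl) f mf).
  by rewrite expo_pdfE -Rintegral_mkcond.
apply/(@integrable_density _ (measurableTypeR R) R mu expo (exponential_pdf 1)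
  (measurable_exponential_pdf 1) (@exponential_pdf_ge0 _ 1 ler01) (fun _ _ => erefl) f mf) => //.
Qed.

Lemma expo_FTC f df : (forall x : R, is_derive x 1 f (df x)) -> continuous df ->
  expo.-integrable setT (EFin \o (fun x => f x - df x)) ->
  expR (- n%:R) * f n%:R @[n --> \oo] --> (0 : R) ->
  \int[expo]_x (f x - df x) = f 0.
Proof.
move=> dfE cdf intf f0.
have cf := is_derive_continuous dfE.
have cfd : continuous (fun x => f x - df x).
  by move=> x; apply: cvgB; [exact: cf|exact: cdf].
have mfd := continuous_measurable_fun cfd.
have dE (x : R) : is_derive x 1 (fun x => - (expR (- x) * f x)) (expR (- x) * (f x - df x)).
  by have := dfE x; move=> ?; apply: is_derive_eq; rewrite /GRing.scale/=; ring.
have ce : continuous (fun x => expR (- x) * (f x - df x)).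
  move=> x; apply: cvgM; last exact: cfd.
  by apply: continuous_comp; [exact: opp_continuous|exact: continuous_expR].
have := FTC_0y ce _ dE.
rewrite Rintegral_expo// => /(_ 0) ->.
- by rewrite oppr0 expR0 mul1r sub0r opprK.
- exact/integrable_expo.
- by rewrite -oppr0; apply: cvgN.
Qed.

Lemma expo_integrable_id : expo.-integrable setT (EFin \o (fun x : R => x)).
Proof.
apply/integrable_expo; first exact: measurable_id.
have h2 : (0 : R) < 2^-1 by rewrite invr_gt0.
have i2 := integrable_exponential_pdf h2.
have i3 := integrable_scaleR 4 i2.
have : mu.-integrable `[0, +oo[ (EFin \o (fun x => 4 * exponential_pdf 2^-1 x)).
  exact: (integrableS _ _ _ i3).
apply: le_integrable => //.
  apply/measurable_EFinP; apply: measurable_funTS; apply: measurable_funM => //.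
  by apply: measurableT_comp => //; exact: measurable_expR.
move=> x; rewrite /= in_itv/= andbT => x0; rewrite lee_fin.
rewrite exponential_pdfE// ger0_norm ?mulr_ge0 ?expR_ge0//.
apply: le_trans (ler_norm _).
have -> : - x = - (2^-1) * x + - (2^-1) * x by field.
rewrite expRD; set e := expR _.
have e0 : 0 < e by exact: expR_gt0.
have ex : e * x <= 2.
  have := expR_ge1Dx (2^-1 * x).
  rewrite -[2^-1 * x]opprK expRN -mulNr -/e => h.
  have : 2^-1 * x * e <= 1.
    rewrite -ler_pdivlMr// mul1r; lra.
  lra.
nra.
Qed.

Lemma expN_lin_cvg (u : nat -> R) (C : R) : (forall n, `|u n| <= C * (n%:R + 1)) ->
  expR (- n%:R) * u n @[n --> \oo] --> (0 : R).
Proof.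
move=> uC; apply/norm_cvg0P.
have C0 : 0 <= C by have := le_trans (normr_ge0 _) (uC 0%N); rewrite add0r mulr1.
apply: (@squeeze_cvgr _ _ _ _ (cst 0) (fun n => (4 * C) * n.+1%:R^-1)).
- apply: nearW => n; rewrite normr_ge0/= normrM ger0_norm ?expR_ge0//.
  have n0 : (0 : R) <= n%:R by exact: ler0n.
  have h : 1 + n%:R ^+ 2 / 2 <= expR n%:R :> R by exact: (@expR_ge1Dxn R n%:R 1 n0).
  have e0 : 0 < expR (n%:R : R) by exact: expR_gt0.
  rewrite expRN ler_pdivlMr ?ltr0n// -mulrA mulrC ler_pdivrMr//.
  have := uC n; have -> : (n.+1%:R : R) = n%:R + 1 by rewrite -natr1.
  have := normr_ge0 (u n).
  move: (`|u n|) (n%:R : R) (expR _) n0 h e0 => v x e x0 h e0 v0 vC.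
  apply: (@le_trans _ _ (C * (x + 1) * (x + 1))); first by rewrite ler_wpM2r// addr_ge0.
  rewrite -mulrA [4 * C]mulrC -mulrA ler_wpM2l//.
  have -> : (x + 1) * (x + 1) = 2 * x ^+ 2 + 2 - (x - 1) ^+ 2 by ring.
  have := sqr_ge0 (x - 1); lra.
- exact: cvg_cst.
- rewrite -[X in _ --> X](mulr0 (4 * C)); apply: cvgMr; exact: cvg_harmonic.
Qed.

Lemma expo_mean : \int[expo]_x x = 1.
Proof.
have : \int[expo]_x ((x + 1) - 1) = (0 : R) + 1.
  apply: (@expo_FTC (fun x => x + 1) (cst 1)).
  - by move=> x; apply: is_derive_eq; rewrite addr0.
  - exact: cst_continuous.
  - by under eq_fun do rewrite addrK; exact: expo_integrable_id.
  - by apply: (@expN_lin_cvg _ 1) => n; rewrite mul1r ger0_norm// addr_ge0.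
by rewrite add0r; under eq_Rintegral do rewrite addrK.
Qed.

Lemma expo_mean_abs : \int[expo]_x `|x| = 1.
Proof.
rewrite Rintegral_expo; last 2 first.
- exact: normr_measurable.
- by have := integrable_norm expo_integrable_id.
rewrite -expo_mean Rintegral_expo; last 2 first.
- exact: measurable_id.
- exact: expo_integrable_id.
apply: eq_Rintegral => x; rewrite inE/= in_itv/= andbT => x0.
by rewrite ger0_norm.
Qed.



Definition bcont f := continuous f /\ exists M : R, forall x : R, `|f x| <= M.
Definition lip (L : R) f := forall x y, `|f x - f y| <= L * `|x - y|.

Lemma lip_continuous L f : 0 <= L -> lip L f -> continuous f.
Proof.
move=> L0 Lf x; apply/cvgrPdist_le => /= e e0; near=> y.
apply: le_trans (Lf x y) _.
have : `|x - y| <= e / (L + 1).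
  by near: y; exists (e / (L + 1)) => /=; [rewrite divr_gt0// ltr_wpDl|move=> z /= /ltW].
rewrite ler_pdivlMr ?ltr_wpDl// => h; apply: le_trans h; rewrite mulrC ler_wpM2l// lerDl//.
Unshelve. all: by end_near. Qed.

Lemma bcont_measurable f : bcont f -> measurable_fun setT f.
Proof. by case=> cf _; exact: continuous_measurable_fun. Qed.

Lemma bcontD f g : bcont f -> bcont g -> bcont (fun x => f x + g x).
Proof.
move=> [cf [M fM]] [cg [N gN]]; split; first by move=> x; apply: cvgD; [exact: cf|exact: cg].
by exists (M + N) => x; rewrite (le_trans (ler_normD _ _))// lerD.
Qed.

Lemma bcontZ c f : bcont f -> bcont (fun x => c * f x).
Proof.
move=> [cf [M fM]]; split; first by move=> x; apply: cvgMr; exact: cf.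
by exists (`|c| * M) => x; rewrite normrM ler_wpM2l.
Qed.

Lemma bcontB f g : bcont f -> bcont g -> bcont (fun x => f x - g x).
Proof.
move=> bf bg; have := bcontD bf (bcontZ (-1) bg).
by under eq_fun do rewrite mulN1r.
Qed.

Lemma bcont_cos t : bcont (fun x => cos (t * x)).
Proof.
split; last by exists 1 => x; exact: cos_max.
move=> x; apply: (@cvg_comp _ _ _ ( *%R t) (@cos R)); last exact: continuous_cos.
by apply: cvgMr; exact: cvg_id.
Qed.

Lemma bcont_sin t : bcont (fun x => sin (t * x)).
Proof.
split; last by exists 1 => x; exact: sin_max.
move=> x; apply: (@cvg_comp _ _ _ ( *%R t) (@sin R)); last exact: continuous_sin.
by apply: cvgMr; exact: cvg_id.
Qed.

Lemma affine_continuous (a b : R) : continuous (fun z => a + b * z).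
Proof. by move=> z; apply: cvgD; [exact: cvg_cst|apply: cvgMr; exact: cvg_id]. Qed.

Lemma bcont_affine f a b : bcont f -> bcont (fun z => f (a + b * z)).
Proof.
move=> [cf [M fM]]; split; last by exists M => x.
move=> z; apply: (@cvg_comp _ _ _ (fun z => a + b * z) f); last exact: cf.
exact: affine_continuous.
Qed.

Lemma expo_cst (c : R) : expo.-integrable setT (EFin \o (fun _ : R => c)).
Proof. exact: (@integrable_cstR _ (measurableTypeR R) R expo c expo_fin). Qed.

Lemma bcont_expo f : bcont f -> expo.-integrable setT (EFin \o f).
Proof.
move=> bf; case: (bf) => _ [M fM]; exact: (@bounded_integrable _ (measurableTypeR R) R expo f M expo_fin (bcont_measurable bf) fM).
Qed.

Lemma expo_int_cst (c : R) : \int[expo]_(_ in setT) c = c.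
Proof.
have := @Rintegral_cst _ (measurableTypeR R) R expo setT measurableT c => ->.
by rewrite -[RHS]mulr1; congr (_ * _); exact: (congr1 fine expoT).
Qed.

Lemma expo_bound f M : measurable_fun setT f -> (forall x, `|f x| <= M) ->
  `|\int[expo]_x f x| <= M.
Proof. exact: (@Rintegral_bound _ (measurableTypeR R) R expo f M expoT). Qed.

Definition expavg s f x := \int[expo]_z f (x + 2 * s * z).

Section expavg.
Variables (s : R) (f : R -> R).
Hypothesis bf : bcont f.

Lemma expavg_bound M : (forall x, `|f x| <= M) -> forall x, `|expavg s f x| <= M.
Proof.
move=> fM x; rewrite /expavg; apply: expo_bound => //.
exact: bcont_measurable (bcont_affine _ _ bf).
Qed.

Lemma expavgD g x : bcont g ->
  expavg s (fun y => f y + g y) x = expavg s f x + expavg s g x.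
Proof. by move=> bg; rewrite /expavg RintegralD//; apply/bcont_expo/bcont_affine. Qed.

Lemma expavgB g x : bcont g ->
  expavg s (fun y => f y - g y) x = expavg s f x - expavg s g x.
Proof. by move=> bg; rewrite /expavg RintegralB//; apply/bcont_expo/bcont_affine. Qed.

Lemma expavgZ c x : expavg s (fun y => c * f y) x = c * expavg s f x.
Proof. by rewrite /expavg RintegralZl//; apply/bcont_expo/bcont_affine. Qed.

Lemma expavg_lip L : lip L f -> lip L (expavg s f).
Proof.
move=> Lf x y; rewrite /expavg -RintegralB//; try exact/bcont_expo/bcont_affine.
apply: expo_bound => //.
  by apply: measurable_funB; exact: bcont_measurable (bcont_affine _ _ bf).
by move=> z; apply: le_trans (Lf _ _) _; rewrite opprD addrACA subrr addr0.
Qed.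

Lemma expavg_dist L x : lip L f -> `|expavg s f x - f x| <= 2 * `|s| * L.
Proof.
move=> Lf.
have E : f x = \int[expo]_z f x.
  by rewrite expo_int_cst.
have i1 := bcont_expo (bcont_affine x (2 * s) bf).
have i2 : expo.-integrable setT (EFin \o (fun _ : R => f x)).
  exact: expo_cst.
rewrite [X in _ - X]E /expavg -RintegralB//.
apply: le_trans (le_normr_Rintegral measurableT _) _; first exact: integrable_subR.
have <- : \int[expo]_z ((2 * `|s| * L) * `|z|) = 2 * `|s| * L.
  rewrite RintegralZl ?expo_mean_abs ?mulr1//.
  by have := integrable_norm expo_integrable_id.
apply: le_Rintegral => //.
- by have := integrable_norm (integrable_subR i1 i2).
- by apply: integrable_scaleR; have := integrable_norm expo_integrable_id.
- move=> z _; apply: le_trans (Lf _ _) _.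
  by rewrite addrAC subrr add0r !normrM ger0_norm// [leRHS]mulrAC [L * _]mulrC.
Qed.

Lemma expavg_bcont : bcont (expavg s f).
Proof.
split; last by case: bf => _ [M fM]; exists M; exact: expavg_bound.
move=> x; case: (bf) => cf [M fM].
have := @continuity_under_integral R _ _ expo (fun x z => f (x + 2 * s * z)) setT
  measurableT (x - 1) (x + 1) _ _ (cst M) _ _ x; apply.
- by move=> y _; exact/bcont_expo/bcont_affine.
- apply: aeW => z _ y _; apply: (@cvg_comp _ _ _ (fun y => y + 2 * s * z) f); last exact: cf.
  by apply: cvgD; [exact: cvg_id|exact: cvg_cst].
- exact: expo_cst.
- by move=> y _; apply: aeW => z _; exact: fM.
- by rewrite inE/= in_itv/= ltrBlDr ltrDl ltr01.
Qed.

End expavg.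

(** [expavg s] inverts the operator phi |-> phi - 2 s phi' on bounded functions. *)
Lemma expavg_inv s f df (x : R) : bcont f -> bcont df -> (forall x : R, is_derive x 1 f (df x)) ->
  expavg s (fun y => f y - (2 * s) * df y) x = f x.
Proof.
move=> bf bdf dfE.
have dE (z : R) : is_derive z 1 (fun z => f (x + 2 * s * z)) (2 * s * df (x + 2 * s * z)).
  exact: is_derive_affinec.
have b2 := bcontZ (2 * s) (bcont_affine x (2 * s) bdf).
rewrite /expavg (expo_FTC dE).
- by rewrite mulr0 addr0.
- by case: b2.
- by apply: bcont_expo; apply: bcontB => //; exact: bcont_affine.
- case: bf => _ [M fM].
  have M0 : 0 <= M by exact: le_trans (fM 0).
  apply: (@expN_lin_cvg _ M) => n; apply: le_trans (fM _) _.
  by rewrite ler_peMr// lerDr.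
Qed.

Lemma expavg_cos s t x : let b := 2 * s * t in
  expavg s (fun y => cos (t * y)) x =
  (1 + b ^+ 2)^-1 * cos (t * x) - b * (1 + b ^+ 2)^-1 * sin (t * x).
Proof.
move=> b; have b0 : 1 + b ^+ 2 != 0 by rewrite lt0r_neq0// ltr_wpDr// sqr_ge0.
set P := (1 + b ^+ 2)^-1.
pose f := fun y => P * cos (t * y) - b * P * sin (t * y).
pose df := fun y => (- t * P) * sin (t * y) - t * b * P * cos (t * y).
have dE (y : R) : is_derive y 1 f (df y).
  by apply: is_derive_eq; rewrite /df /GRing.scale/=; ring.
rewrite -[RHS]/(f x) -(expavg_inv s x _ _ dE).
- congr (expavg _ _ _); apply/funext => y; rewrite /f /df.
  have PE : P * (1 + b ^+ 2) = 1 by rewrite /P mulVf.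
  by rewrite -[LHS]mul1r -[X in X * _]PE /b; ring.
- by apply: bcontB; apply: bcontZ; [exact: bcont_cos|exact: bcont_sin].
- by apply: bcontB; apply: bcontZ; [exact: bcont_sin|exact: bcont_cos].
Qed.

Lemma expavg_sin s t x : let b := 2 * s * t in
  expavg s (fun y => sin (t * y)) x =
  (1 + b ^+ 2)^-1 * sin (t * x) + b * (1 + b ^+ 2)^-1 * cos (t * x).
Proof.
move=> b; have b0 : 1 + b ^+ 2 != 0 by rewrite lt0r_neq0// ltr_wpDr// sqr_ge0.
set P := (1 + b ^+ 2)^-1.
pose f := fun y => P * sin (t * y) + b * P * cos (t * y).
pose df := fun y => (t * P) * cos (t * y) + (- (t * b * P)) * sin (t * y).
have dE (y : R) : is_derive y 1 f (df y).
  by apply: is_derive_eq; rewrite /df /GRing.scale/=; ring.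
rewrite -[RHS]/(f x) -(expavg_inv s x _ _ dE).
- congr (expavg _ _ _); apply/funext => y; rewrite /f /df.
  have PE : P * (1 + b ^+ 2) = 1 by rewrite /P mulVf.
  by rewrite -[LHS]mul1r -[X in X * _]PE /b; ring.
- by apply: bcontD; apply: bcontZ; [exact: bcont_sin|exact: bcont_cos].
- by apply: bcontD; apply: bcontZ; [exact: bcont_cos|exact: bcont_sin].
Qed.

End expo.
Lemma is_derive_integral (R : realType) d (T : measurableType d)
    (m : {measure set T -> \bar R}) (f df : R -> T -> R) (G : T -> R) (x : R) :
  (forall x, m.-integrable setT (EFin \o f x)) ->
  (forall (x : R) y, is_derive x 1 (f ^~ y) (df x y)) ->
  m.-integrable setT (EFin \o G) ->
  (forall x y, `|df x y| <= G y) ->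
  is_derive x 1 (fun x => \int[m]_y f x y) (\int[m]_y df x y).
Proof.
move=> intf dE intG dG.
have Ix : [set` `](x - 1), (x + 1)[] x by rewrite /= in_itv/= ltrBlDr ltrDl ltr01.
have dfE a b : partial1of2 f a b = df a b.
  by rewrite partial1of2E; have [_ ->] := dE a b.
have G0 y : 0 <= G y by exact: le_trans (dG 0 y).
have h1 : forall a b, [set` `](x - 1), (x + 1)[] a -> setT b -> derivable (f ^~ b) a 1.
  by move=> a b _ _; have [] := dE a b.
have h2 : forall a b, [set` `](x - 1), (x + 1)[] a -> setT b -> `|partial1of2 f a b| <= G b.
  by move=> a b _ _; rewrite dfE.
apply: DeriveDef.
  exact: (@derivable_under_integral R _ T m f setT measurableT x _ _ Ix
    (fun x _ => intf x) h1 G G0 intG h2).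
rewrite -derive1E.
rewrite (@differentiation_under_integral R _ T m f setT measurableT x _ _ Ix
    (fun x _ => intf x) h1 G G0 intG h2).
by apply: eq_Rintegral => y _; rewrite dfE.
Qed.

Section stein_equation.
Context (R : realType).
Notation mu := (@lebesgue_measure R).
Implicit Types f g : R -> R.

Lemma expavg_derive f (x : R) : bcont f ->
  is_derive x 1 (expavg 1 f) ((expavg 1 f x - f x) / 2).
Proof.
move=> bf; have [F dF] := primitive_exists (proj1 bf).
have cF := is_derive_continuous dF.
case: (bf) => _ [M fM].
have FM (a b : R) : `|F b - F a| <= M * `|b - a|.
  wlog ab : a b / a <= b.
    by move=> w; case: (leP a b) => [|/ltW] ab; [|rewrite distrC (distrC b)]; exact: w.
  rewrite (ger0_norm (x := b - a)) ?subr_ge0//.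
  apply: (MVT_abs ab (fun z _ => dF z) _ (fun z _ => fM z)).
  exact: continuous_subspaceT.
have mFa (y : R) : measurable_fun setT (fun z : R => F (y + 2 * z)).
  apply: continuous_measurable_fun => z; apply: (@cvg_comp _ _ _ (fun z : R => y + 2 * z) F); last exact: cF.
  exact: affine_continuous.
have iF (y : R) : (expo R).-integrable setT (EFin \o (fun z : R => F (y + 2 * z))).
  apply: (@le_integrable_abs _ (measurableTypeR R) R (expo R) _ (fun z : R => `|F y| + (2 * M) * `|z|)).
  - exact: mFa.
  - have h := integrable_norm (@expo_integrable_id R).
    exact: (integrable_addR (expo_cst `|F y|) (integrable_scaleR (2 * M) h)).
  - move=> z; have := FM y (y + 2 * z); rewrite addrAC subrr add0r normrM.
    have := ler_normD (F (y + 2 * z) - F y) (F y); rewrite subrK (ger0_norm (x := 2))//; lra.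
have E (y : R) : expavg 1 f y = 2^-1 * (\int[expo R]_z F (y + 2 * z) - F y).
  have dE (z : R) : is_derive z 1 (fun z : R => F (y + 2 * z)) (2 * f (y + 2 * z)).
    exact: is_derive_affinec.
  have b2 := bcontZ 2 (bcont_affine y 2 bf).
  have ifB := bcont_expo b2.
  have := expo_FTC dE (proj1 b2) (integrable_subR (iF y) ifB).
  rewrite RintegralB// RintegralZl//; last exact/bcont_expo/bcont_affine.
  rewrite mulr0 addr0 => H; rewrite -H; last first.
    apply: (@expN_lin_cvg _ _ (`|F y| + 2 * M)) => n.
    have := FM y (y + 2 * n%:R); rewrite addrAC subrr add0r (ger0_norm (x := 2 * n%:R)) ?mulr_ge0//.
    have := ler_normD (F (y + 2 * n%:R) - F y) (F y); rewrite subrK.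
    have n0 : (0 : R) <= n%:R by exact: ler0n.
    have M0 : 0 <= M by exact: le_trans (fM 0).
    have := mulr_ge0 (normr_ge0 (F y)) n0; have := normr_ge0 (F y).
    have := mulr_ge0 M0 n0; lra.
  by rewrite /expavg mulr1; field.
have dI : is_derive x 1 (fun y : R => \int[expo R]_z F (y + 2 * z)) (expavg 1 f x).
  rewrite /expavg mulr1.
  apply: (@is_derive_integral R _ (measurableTypeR R) (expo R)
     (fun y z : R => F (y + 2 * z)) (fun y z : R => f (y + 2 * z)) (cst M)).
  - exact: iF.
  - move=> y z; have := dF (y + 2 * z).
    under eq_fun do rewrite addrC.
    move=> h; have := @is_derive_affinec _ F (2 * z) 1 y (f (y + 2 * z)).
    rewrite !mul1r addrC => /(_ h); under eq_fun do rewrite mul1r; exact.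
  - exact: expo_cst.
  - by move=> y z; exact: fM.
rewrite (_ : expavg 1 f = fun y : R => 2^-1 * (\int[expo R]_z F (y + 2 * z) - F y)).
  have h := is_deriveZ 2^-1 (is_deriveB dI (dF x)).
  by apply: (is_derive_eq h); rewrite /GRing.scale/= E mulrC.
by apply/funext => y; exact: E.
Qed.

(** Resolvent identity for (1 - 2 s D)^-1, in a form which needs no derivative of f. *)
Lemma expavg_resolvent s f (x : R) : bcont f ->
  expavg s f x - expavg 1 f x =
  (s - 1) * expavg s (fun y => expavg 1 f y - f y) x.
Proof.
move=> bf; have bB := expavg_bcont 1 bf; have bg := bcontB bB bf.
have bd : bcont (fun y => (expavg 1 f y - f y) / 2).
  by have := bcontZ 2^-1 bg; under eq_fun do rewrite mulrC.
have := expavg_inv s x bB bd (fun y => expavg_derive y bf).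
have -> : (fun y => expavg 1 f y - 2 * s * ((expavg 1 f y - f y) / 2)) =
   (fun y => f y + (1 - s) * (expavg 1 f y - f y)).
  by apply/funext => y; field.
rewrite expavgD//; last exact: bcontZ.
by rewrite expavgZ// => <-; ring.
Qed.

Section second_order.
Variables (f : R -> R).
Hypotheses (bf : bcont f) (Lf : lip 2^-1 f).
Let g := fun y => expavg 1 f y - f y.
Let g' := fun y => expavg 1 g y - g y.

(** Second-order expansion of s (A_s - 1) f around s = 1: the linear term in s - 1 is
    explicit, the remainder is quadratic in s - 1 and still carries the factor s^2. *)
Lemma expavg_second_order s x :
  `|s * (expavg s f x - f x) - s ^+ 2 * g x - s ^+ 2 * (s - 1) * g' x| <=
  4 * (s ^+ 2 * (s - 1) ^+ 2).
Proof.
have bg : bcont g by apply: bcontB => //; exact: expavg_bcont.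
have bg' : bcont g' by apply: bcontB => //; exact: expavg_bcont.
have lipB (L : R) (k : R -> R) : bcont k -> lip L k -> lip (L + L) (fun y => expavg 1 k y - k y).
  move=> bk Lk a b; rewrite mulrDl.
  have -> : expavg 1 k a - k a - (expavg 1 k b - k b) =
    (expavg 1 k a - expavg 1 k b) - (k a - k b) by ring.
  by rewrite (le_trans (ler_normB _ _))// lerD// expavg_lip.
have Lg' : lip 2 g'.
  have := lipB _ _ bg (lipB _ _ bf Lf).
  by rewrite (_ : _ + _ = 2); [exact|field].
have := expavg_dist s bg' x Lg'.
have E1 := expavg_resolvent s x bf; have E2 := expavg_resolvent s x bg.
rewrite -/g -/g' in E1 E2.
have -> : s * (expavg s f x - f x) - s ^+ 2 * g x - s ^+ 2 * (s - 1) * g' x =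
   s * (s - 1) ^+ 2 * (expavg s g' x - g' x).
  have -> : expavg s f x = (s - 1) * expavg s g x + expavg 1 f x by rewrite -E1 subrK.
  have -> : expavg s g x = (s - 1) * expavg s g' x + expavg 1 g x by rewrite -E2 subrK.
  by rewrite /g' /g; ring.
rewrite normrM => h; apply: (@le_trans _ _ (`|s * (s - 1) ^+ 2| * (2 * `|s| * 2))).
  by rewrite ler_wpM2l.
rewrite normrM (ger0_norm (sqr_ge0 _)) -(real_normK (num_real s)).
by rewrite le_eqVlt; apply/orP; left; apply/eqP; ring.
Qed.

Lemma expavg_sub1_bound x : `|g x| <= 1.
Proof.
have := expavg_dist 1 bf x Lf.
by rewrite normr1 mulr1 mulfV.
Qed.

Lemma expavg_sub1_sq_bound x : `|g' x| <= 2.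
Proof.
rewrite (le_trans (ler_normB _ _))//.
have bg : bcont g by apply: bcontB => //; exact: expavg_bcont.
have := expavg_bound 1 bg expavg_sub1_bound x.
by have := expavg_sub1_bound x; lra.
Qed.

End second_order.
End stein_equation.


(** * Solution of the Stein equation *)

#[export] Instance is_derive_expr (R : realType) (k : nat) (x : R) :
  is_derive x 1 (fun s : R => s ^+ k) (k%:R * x ^+ k.-1).
Proof.
case: k => [|k]; first by rewrite mul0r; exact: is_derive_cst.
elim: k => [|k IH] /=.
  by under eq_fun do rewrite expr1; rewrite expr0 mulr1; exact: is_derive_id.
under eq_fun do rewrite exprS.
have h := is_deriveM (is_derive_id x 1) IH.
by apply: (is_derive_eq h); rewrite /GRing.scale/= mulr1 [in RHS]mulrSr mulrDl mul1r exprS; ring.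
Qed.

Section shrink.
Context (R : realType).
Notation mu := (@lebesgue_measure R).
Implicit Types w : R -> R.
Variable m : nat.

Definition shrink w (y : R) : R := \int[mu]_(s in `[0, 1]) (s ^+ m * w (s * y)).

Lemma exprn_continuous k : continuous (fun s : R => s ^+ k).
Proof. by move=> x; exact: exprn_continuous. Qed.

Lemma mulr_continuousr (y : R) : continuous (fun s : R => s * y).
Proof. by move=> x; apply: cvgMl; exact: cvg_id. Qed.

Lemma shrink_integrand_continuous w (y : R) : continuous w ->
  continuous (fun s : R => s ^+ m * w (s * y)).
Proof.
move=> cw x; apply: cvgM; first exact: exprn_continuous.
apply: (@cvg_comp _ _ _ (fun s : R => s * y) w); [exact: mulr_continuousr|exact: cw].
Qed.

Lemma int01_pow k : \int[mu]_(s in `[0, 1]) (s ^+ k) = k.+1%:R^-1 :> R.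
Proof.
have dE (x : R) : is_derive x 1 (fun s : R => k.+1%:R^-1 * s ^+ k.+1) (x ^+ k).
  apply: is_derive_eq; rewrite /GRing.scale/=.
  by rewrite mulrA mulVf ?mul1r// pnatr_eq0.
by rewrite (FTC_itv ler01 (@exprn_continuous k) dE) expr1n expr0n/= mulr0 subr0 mulr1.
Qed.

Lemma int01_bound w k (C : R) : continuous w ->
  (forall s, 0 <= s <= 1 -> `|w s| <= C * s ^+ k) ->
  `|\int[mu]_(s in `[0, 1]) w s| <= C / k.+1%:R.
Proof.
move=> cw wC; have iw := continuous_integrable_itv 0 1 cw.
apply: (le_trans (le_normr_Rintegral _ iw)) => //.
have ip := continuous_integrable_itv 0 1 (@exprn_continuous k).
rewrite -int01_pow -RintegralZl//; apply: le_Rintegral => //.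
- apply: continuous_integrable_itv => x; apply: cvg_norm; exact: cw.
- by apply: continuous_integrable_itv => x; apply: cvgMr; exact: exprn_continuous.
Qed.

Lemma shrink_bound w C : continuous w -> (forall y, `|w y| <= C) ->
  forall y, `|shrink w y| <= C / m.+1%:R.
Proof.
move=> cw wC y; apply: int01_bound; first exact: shrink_integrand_continuous.
move=> s /andP[s0 _]; rewrite normrM ger0_norm ?exprn_ge0// mulrC.
by rewrite ler_wpM2r// exprn_ge0.
Qed.

Lemma shrinkB w1 w2 y : continuous w1 -> continuous w2 ->
  shrink w1 y - shrink w2 y = shrink (fun y => w1 y - w2 y) y.
Proof.
move=> c1 c2; have i w := fun c => continuous_integrable_itv 0 1 (@shrink_integrand_continuous w y c).
rewrite /shrink -RintegralB//; [|exact: i|exact: i].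
by apply: eq_Rintegral => s _; rewrite mulrBr.
Qed.

Lemma shrink_lip w L : continuous w -> lip L w -> lip (L / m.+2%:R) (shrink w).
Proof.
move=> cw Lw x y.
have c1 := @shrink_integrand_continuous w x cw; have c2 := @shrink_integrand_continuous w y cw.
have i1 := continuous_integrable_itv 0 1 c1; have i2 := continuous_integrable_itv 0 1 c2.
rewrite /shrink -RintegralB// mulrAC; apply: int01_bound.
  by move=> s; apply: cvgB; [exact: c1|exact: c2].
move=> s /andP[s0 _]; rewrite -mulrBr normrM ger0_norm ?exprn_ge0//.
have := Lw (s * x) (s * y); rewrite -mulrBr normrM (ger0_norm s0) => h.
rewrite exprSr mulrC [leRHS]mulrA mulrAC -mulrA [leRHS]mulrA ler_wpM2r ?exprn_ge0//.
by rewrite (le_trans h)// [s * _]mulrC mulrA.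
Qed.

Lemma shrink_derive w (y : R) : continuous w -> y != 0 ->
  is_derive y 1 (shrink w) ((w y - m.+1%:R * shrink w y) / y).
Proof.
move=> cw y0.
have cp : continuous (fun s : R => s ^+ m * w s).
  by move=> x; apply: cvgM; [exact: exprn_continuous|exact: cw].
have [J dJ] := primitive_exists cp.
have JE (z : R) : z ^+ m.+1 * shrink w z = J z - J 0.
  have dE (s : R) : is_derive s 1 (fun s : R => J (s * z)) (z ^+ m.+1 * (s ^+ m * w (s * z))).
    have := dJ (s * z); rewrite -[X in is_derive X]add0r (mulrC s z) => h.
    have := is_derive_affinec h.
    have -> : (fun s : R => J (0 + z * s)) = (fun s : R => J (s * z)).
      by apply/funext => u; rewrite add0r mulrC.
    move=> h2; apply: (is_derive_eq h2).
    by rewrite exprMn exprS; ring.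
  have c : continuous (fun s : R => z ^+ m.+1 * (s ^+ m * w (s * z))).
    by move=> s; apply: cvgMr; exact: (@shrink_integrand_continuous w z cw).
  have := FTC_itv ler01 c dE; rewrite mul1r mul0r => <-.
  rewrite RintegralZl//.
  exact: (continuous_integrable_itv 0 1 (@shrink_integrand_continuous w z cw)).
apply: (@near_eq_is_derive _ _ _ (fun z : R => (J z - J 0) * (z ^+ m.+1)^-1)).
  near=> z; rewrite -JE mulrC mulKf// expf_neq0//.
  by near: z; exact: (cvgr_neq0 y (@cvg_id _ (nbhs y)) y0).
have yn0 : y ^+ m.+1 != 0 by rewrite expf_neq0.
have h1 := dJ y.
have h2 := @is_deriveV _ (fun s : R => s ^+ m.+1) y _ 1 yn0 (is_derive_expr m.+1 y).
have h3 := is_deriveM (is_deriveB (dJ y) (is_derive_cst (J 0) y 1)) h2.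
apply: (is_derive_eq h3); rewrite /GRing.scale/= !fctE -JE subr0 !exprS.
by field; rewrite y0 expf_neq0.
Unshelve. all: by end_near. Qed.
End shrink.
Section stein_solution.
Context (R : realType).
Variables (a : R) (h dh : R -> R).
Hypotheses (a0 : 0 < a) (dhE : forall x : R, is_derive x 1 h (dh x)).
Hypotheses (dh1 : forall x, `|dh x| <= 1) (Ldh : lip 1 dh).

Let m : nat := Num.bound a.
Let am : a <= m%:R. Proof. by exact: ltW (archi_boundP (ltW a0)). Qed.

Let step f := shrink m (fun y => a * expavg 1 f y + (m%:R - a) * f y - dh y).

Let good (f : R -> R) := [/\ bcont f, forall y, `|f y| <= 1 & lip 2^-1 f].

Let step_arg_bcont f : bcont f ->
  bcont (fun y => a * expavg 1 f y + (m%:R - a) * f y - dh y).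
Proof.
move=> bf; apply: bcontB; last by split; [exact: (lip_continuous ler01 Ldh)|exists 1].
by apply: bcontD; apply: bcontZ => //; exact: expavg_bcont.
Qed.

Let step_good f : good f -> good (step f).
Proof.
case=> bf f1 Lf; have bw := step_arg_bcont bf.
have sL : lip 2^-1 (step f).
  have -> : 2^-1 = ((m.+2%:R) / 2) / m.+2%:R :> R.
    by rewrite mulrAC mulfV ?mul1r// pnatr_eq0.
  apply: shrink_lip; first by case: bw.
  move=> x y; have L1 := expavg_lip 1 bf Lf x y; have L2 := Lf x y; have L3 := Ldh x y.
  rewrite mul1r in L3.
  have -> : a * expavg 1 f x + (m%:R - a) * f x - dh x -
     (a * expavg 1 f y + (m%:R - a) * f y - dh y) =
     a * (expavg 1 f x - expavg 1 f y) + (m%:R - a) * (f x - f y) - (dh x - dh y) by ring.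
  apply: le_trans (ler_normB _ _) _; apply: le_trans (lerD (ler_normD _ _) L3) _.
  rewrite !normrM (gtr0_norm a0) (ger0_norm (x := m%:R - a)) ?subr_ge0//.
  have := ler_wpM2l (ltW a0) L1.
  have : 0 <= m%:R - a by rewrite subr_ge0.
  move=> ma; have := ler_wpM2l ma L2.
  have -> : m.+2%:R = m%:R + 2 :> R by rewrite -addn2 natrD.
  lra.
have sb y : `|step f y| <= 1.
  have -> : 1 = m.+1%:R / m.+1%:R :> R by rewrite mulfV// pnatr_eq0.
  apply: shrink_bound; first by case: bw.
  move=> z; apply: le_trans (ler_normB _ _) _; apply: le_trans (lerD (ler_normD _ _) (dh1 z)) _.
  rewrite !normrM (gtr0_norm a0) (ger0_norm (x := m%:R - a)) ?subr_ge0//.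
  have := ler_wpM2l (ltW a0) (expavg_bound 1 bf f1 z).
  have : 0 <= m%:R - a by rewrite subr_ge0.
  move=> ma; have := ler_wpM2l ma (f1 z).
  rewrite -natr1; lra.
split => //; split; last by exists 1.
by apply: (lip_continuous _ sL).
Qed.

Let step_contract f g C : bcont f -> bcont g ->
  (forall y, `|f y - g y| <= C) ->
  forall y, `|step f y - step g y| <= (m%:R / m.+1%:R) * C.
Proof.
move=> bf bg fgC y; have b1 := step_arg_bcont bf; have b2 := step_arg_bcont bg.
rewrite /step shrinkB; [|by case: b1|by case: b2].
rewrite mulrAC; apply: shrink_bound.
  by case: (bcontB b1 b2).
move=> z.
have -> : a * expavg 1 f z + (m%:R - a) * f z - dh z -
     (a * expavg 1 g z + (m%:R - a) * g z - dh z) =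
     a * (expavg 1 f z - expavg 1 g z) + (m%:R - a) * (f z - g z) by ring.
rewrite -expavgB//; apply: le_trans (ler_normD _ _) _.
rewrite !normrM (gtr0_norm a0) (ger0_norm (x := m%:R - a)) ?subr_ge0//.
have := ler_wpM2l (ltW a0) (expavg_bound 1 (bcontB bf bg) fgC z).
have : 0 <= m%:R - a by rewrite subr_ge0.
move=> ma; have := ler_wpM2l ma (fgC z); lra.
Qed.

Let iter_f n : R -> R := iter n step (cst 0).

Let iter_good n : good (iter_f n).
Proof.
elim: n => [|n IH]; last exact: step_good.
split => /=.
- by split; [exact: cst_continuous|exists 0 => x; rewrite normr0].
- by move=> y; rewrite normr0.
- by move=> x y; rewrite subrr normr0 mulr_ge0// invr_ge0.
Qed.

Let iter_dist n y : `|iter_f n.+1 y - iter_f n y| <= (m%:R / m.+1%:R) ^+ n.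
Proof.
elim: n y => [|n IH] y.
  by rewrite expr0 [X in _ - X]/= subr0; case: (iter_good 1).
rewrite exprS; apply: step_contract => //; [by case: (iter_good n.+1)|by case: (iter_good n)].
Qed.

Let stein_fun (f : R -> R) (y : R) := - (y * f y) + 2 * a * expavg 1 f y - h y.

Let stein_fun_continuous f : bcont f -> continuous (stein_fun f).
Proof.
move=> bf y; apply: cvgB; last exact: (is_derive_continuous dhE).
apply: cvgD; last by apply: cvgMr; case: (expavg_bcont 1 bf) => + _; exact.
by apply: cvgN; apply: cvgM; [exact: cvg_id|case: bf => + _; exact].
Qed.

Let stein_fun_derive n (y : R) : y != 0 ->
  is_derive y 1 (stein_fun (iter_f n.+1))
    (a * (expavg 1 (iter_f n.+1) y - expavg 1 (iter_f n) y) +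
     (m%:R - a) * (iter_f n.+1 y - iter_f n y)).
Proof.
move=> y0; have [bn _ _] := iter_good n; have [bn1 _ _] := iter_good n.+1.
have [cw _] := step_arg_bcont bn.
have d1 := @shrink_derive _ m _ y cw y0; rewrite -/(step _) -[step _]/(iter_f n.+1) in d1.
have d2 := expavg_derive y bn1.
have d3 := is_deriveM (is_derive_id y 1) d1.
have d4 := is_deriveB (is_deriveD (is_deriveN d3) (is_deriveZ (2 * a) d2)) (dhE y).
apply: (is_derive_eq d4); rewrite /GRing.scale/= -natr1.
by field.
Qed.

(** Fixed point of f = R(a B f + (m - a) f - h'), with R the inverse of multiplication
    by y followed by differentiation, up to the integer m: shifting by m makes the
    right-hand side a contraction in the uniform norm, which is why the limit is only
    taken approximately, up to eps. *)
Lemma stein_solution eps : 0 < eps -> exists f : R -> R, [/\ bcont f, lip 2^-1 f &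
  forall y, `|(- (y * f y) + 2 * a * expavg 1 f y - h y) - (2 * a * expavg 1 f 0 - h 0)|
    <= eps * `|y|].
Proof.
move=> eps0.
have [n hn] : exists n, m%:R * (m%:R / m.+1%:R) ^+ n <= eps :> R.
  have rho1 : `|m%:R / m.+1%:R : R| < 1.
    by rewrite ger0_norm ?divr_ge0// ltr_pdivrMr ?ltr0n// mul1r ltr_nat.
  have c : m%:R * (m%:R / m.+1%:R) ^+ n @[n --> \oo] --> (0 : R).
    by rewrite -(mulr0 m%:R); apply: cvgMr; exact: cvg_expr.
  near \oo => N; exists N; apply: le_trans (ler_norm _) _.
  by near: N; exact: cvgr0_norm_le.
exists (iter_f n.+1); have [bn _ _] := iter_good n; have [bn1 _ Ln1] := iter_good n.+1.
split => //.
have bd y : `|a * (expavg 1 (iter_f n.+1) y - expavg 1 (iter_f n) y) +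
     (m%:R - a) * (iter_f n.+1 y - iter_f n y)| <= eps.
  rewrite -expavgB//; apply: le_trans (ler_normD _ _) (le_trans _ hn).
  rewrite !normrM (gtr0_norm a0) (ger0_norm (x := m%:R - a)) ?subr_ge0//.
  have := ler_wpM2l (ltW a0) (expavg_bound 1 (bcontB bn1 bn) (iter_dist n) y).
  have : 0 <= m%:R - a by rewrite subr_ge0.
  move=> ma; have := ler_wpM2l ma (iter_dist n y); lra.
move=> y.
have -> : 2 * a * expavg 1 (iter_f n.+1) 0 - h 0 = stein_fun (iter_f n.+1) 0.
  by rewrite /stein_fun mul0r oppr0 add0r.
rewrite -/(stein_fun _ y).
have cs := stein_fun_continuous bn1.
have [y0|y0] := leP 0 y.
  rewrite (ger0_norm y0) -[X in eps * X]subr0.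
  apply: (MVT_abs y0 _ _ (fun z _ => bd z)) => [z|]; last exact: continuous_subspaceT.
  by rewrite in_itv/= => /andP[z0 _]; apply: stein_fun_derive; rewrite gt_eqF.
rewrite (ltr0_norm y0) distrC -[X in eps * X]sub0r.
apply: (MVT_abs (ltW y0) _ _ (fun z _ => bd z)) => [z|]; last exact: continuous_subspaceT.
by rewrite in_itv/= => /andP[_ z0]; apply: stein_fun_derive; rewrite lt_eqF.
Unshelve. all: by end_near. Qed.

End stein_solution.

(** The identity which both a combination of centered Gamma variables and its
    limits satisfy: it is the derivative at 0 of the logarithm of
    E e^(i t Y) = \prod_(c, s) (e^(- i s t) (1 - 2 i s t)^(-1/2))^c, tested
    against k instead of e^(i t Y). *)
Definition gamma_stein (R : realType) d (T : measurableType d)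
    (P : {measure set T -> \bar R}) (Y : T -> R) (l : seq (R * R)) :=
  forall k, bcont k -> \int[P]_x (Y x * k (Y x)) =
    \sum_(p <- l) p.1 * p.2 * \int[P]_x (expavg p.2 k (Y x) - k (Y x)).

Definition psum (R : realType) (r : nat) (l : seq (R * R)) : R :=
  \sum_(p <- l) p.1 * p.2 ^+ r.

Definition pdev (R : realType) (l : seq (R * R)) : R :=
  psum 4 l - 2 * psum 3 l + psum 2 l.

Lemma pdevE (R : realType) (l : seq (R * R)) :
  pdev l = \sum_(p <- l) p.1 * (p.2 ^+ 2 * (p.2 - 1) ^+ 2).
Proof.
rewrite /pdev /psum mulr_sumr -sumrB -big_split; apply: eq_bigr => p _ /=; ring.
Qed.

Section stein_bound.
Context (R : realType) d (T : measurableType d) (P : {measure set T -> \bar R}).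
Variables (Y : T -> R) (l : seq (R * R)) (nu : R).
Hypotheses (PT : P setT = 1%E) (mY : measurable_fun setT Y).
Hypotheses (iY : P.-integrable setT (EFin \o Y)).
Hypotheses (l0 : forall p, p \in l -> 0 <= p.1) (Yl : gamma_stein P Y l).
Let Pfin : (P setT < +oo)%E. Proof. by rewrite PT ltry. Qed.

Lemma bcont_comp_integrable k : bcont k -> P.-integrable setT (EFin \o (fun x => k (Y x))).
Proof.
move=> bk; case: (bk) => _ [M kM]; apply: (bounded_integrable (M := M)) => //.
by apply: measurableT_comp => //; exact: bcont_measurable.
Qed.

Lemma mul_bcont_comp_integrable k : bcont k ->
  P.-integrable setT (EFin \o (fun x => Y x * k (Y x))).
Proof.
move=> bk; case: (bk) => _ [M kM].
apply: (@le_integrable_abs _ _ _ P _ (fun x => M * `|Y x|)).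
- apply: measurable_funM => //; apply: measurableT_comp => //; exact: bcont_measurable.
- by apply: integrable_scaleR; have := integrable_norm iY.
- by move=> x; rewrite normrM mulrC ler_wpM2r.
Qed.

Lemma lip_comp_integrable h : lip 1 h -> P.-integrable setT (EFin \o (fun x => h (Y x))).
Proof.
move=> Lh; apply: (@le_integrable_abs _ _ _ P _ (fun x => `|h 0| + `|Y x|)).
- apply: measurableT_comp => //; apply: continuous_measurable_fun.
  exact: (lip_continuous ler01 Lh).
- apply: integrable_addR; first exact: integrable_cstR.
  by have := integrable_norm iY.
- move=> x; have := Lh (Y x) 0; rewrite subr0 mul1r.
  by have := ler_normD (h (Y x) - h 0) (h 0); rewrite subrK; lra.
Qed.

Lemma stein_test_bound f h eps : bcont f -> lip 2^-1 f -> lip 1 h ->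
  let S := fun x => - ((x + nu) * f x) + nu * expavg 1 f x - h x in
  (forall x, `|S x - S (- nu)| <= eps * `|x + nu|) ->
  `|\int[P]_x h (Y x) + S (- nu)| <=
  eps * \int[P]_x `|Y x + nu| + (`|psum 2 l - nu| + 2 * `|psum 3 l - psum 2 l| + 4 * pdev l).
Proof.
move=> bf Lf Lh S Sb.
have bB := expavg_bcont 1 bf.
pose g := fun y => expavg 1 f y - f y.
pose g' := fun y => expavg 1 g y - g y.
have bg : bcont g by exact: bcontB.
have bg' : bcont g' by apply: bcontB => //; exact: expavg_bcont.
have ih := lip_comp_integrable Lh.
pose Q := fun x => nu * g x - \sum_(p <- l) p.1 * p.2 * (expavg p.2 f x - f x).
have bA s : bcont (fun x => expavg s f x - f x) by apply: bcontB => //; exact: expavg_bcont.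
have iA s := bcont_comp_integrable (bA s).
have [is1 Es] := @Rintegral_sum _ _ _ P _ l
  (fun (p : R * R) x => p.1 * p.2 * (expavg p.2 f (Y x) - f (Y x)))
  (fun p => integrable_scaleR (p.1 * p.2) (iA p.2)).
have iQ : P.-integrable setT (EFin \o (fun x => Q (Y x))).
  by apply: integrable_subR => //; apply: integrable_scaleR; exact: bcont_comp_integrable.
have iYf := mul_bcont_comp_integrable bf.
have EQ : \int[P]_x Q (Y x) = \int[P]_x (nu * g (Y x) - Y x * f (Y x)).
  rewrite /Q RintegralB//; last by apply: integrable_scaleR; exact: bcont_comp_integrable.
  rewrite RintegralB//; last by apply: integrable_scaleR; exact: bcont_comp_integrable.
  rewrite (Yl bf) Es; congr (_ - _); apply: eq_bigr => p _.
  by rewrite RintegralZl.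
have Qb x : `|Q x| <= `|psum 2 l - nu| + 2 * `|psum 3 l - psum 2 l| + 4 * pdev l.
  have -> : Q x = - ((psum 2 l - nu) * g x) - (psum 3 l - psum 2 l) * g' x -
     \sum_(p <- l) p.1 * (p.2 * (expavg p.2 f x - f x) - p.2 ^+ 2 * g x
         - p.2 ^+ 2 * (p.2 - 1) * g' x).
    rewrite /Q /psum.
    transitivity (nu * g x - \sum_(p <- l) (p.1 * p.2 ^+ 2 * g x +
      (p.1 * p.2 ^+ 3 * g' x - p.1 * p.2 ^+ 2 * g' x + p.1 * (p.2 * (expavg p.2 f x - f x) - p.2 ^+ 2 * g x
         - p.2 ^+ 2 * (p.2 - 1) * g' x)))).
      congr (_ - _); apply: eq_bigr => p _; ring.
    rewrite big_split big_split sumrB/= -!mulr_suml; ring.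
  apply: le_trans (ler_normB _ _) _; apply: lerD.
    apply: le_trans (ler_normB _ _) _; rewrite normrN !normrM; apply: lerD.
      by rewrite ler_piMr// (expavg_sub1_bound bf Lf).
    by rewrite mulrC ler_wpM2r// (expavg_sub1_sq_bound bf Lf).
  rewrite pdevE mulr_sumr; apply: le_trans (ler_norm_sum _ _ _) _.
  rewrite big_seq [leRHS]big_seq; apply: ler_sum => p /l0 p0.
  rewrite normrM (ger0_norm p0) mulrCA ler_wpM2l//.
  exact: (expavg_second_order bf Lf).
have iabs : P.-integrable setT (EFin \o (fun x => `|Y x + nu|)).
  have := integrable_norm (integrable_addR iY (integrable_cstR nu Pfin)).
  by [].
pose V := fun x => nu * g (Y x) - Y x * f (Y x).
have iV : P.-integrable setT (EFin \o V).
  by apply: integrable_subR => //; apply: integrable_scaleR; exact: bcont_comp_integrable.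
have ihS : P.-integrable setT (EFin \o (fun x => h (Y x) + S (- nu))).
  by apply: integrable_addR => //; exact: integrable_cstR.
have DE x : S (Y x) - S (- nu) = V x - (h (Y x) + S (- nu)).
  by rewrite /V /g {1}/S; ring.
have E : \int[P]_x h (Y x) + S (- nu) =
    \int[P]_x Q (Y x) - \int[P]_x (S (Y x) - S (- nu)).
  under [X in _ = _ - X]eq_Rintegral do rewrite DE.
  have EQV : \int[P]_x Q (Y x) = \int[P]_x V x := EQ.
  have H2 : \int[P]_x (h (Y x) + S (- nu)) = \int[P]_x h (Y x) + S (- nu).
    by rewrite RintegralD ?Rintegral_cst ?PT ?mulr1//; exact: integrable_cstR.
  have H3 := RintegralB measurableT iV ihS.
  by rewrite EQV H3 H2; ring.
have iD : P.-integrable setT (EFin \o (fun x => S (Y x) - S (- nu))).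
  rewrite (_ : (fun x => _) = (fun x => V x - (h (Y x) + S (- nu)))).
    exact: integrable_subR.
  by apply/funext => x; exact: DE.
rewrite E addrC; apply: le_trans (ler_normD _ _) _; apply: lerD.
  rewrite normrN; apply: le_trans (le_normr_Rintegral measurableT iD) _.
  rewrite -RintegralZl//; apply: le_Rintegral => //.
  - by have := integrable_norm iD.
  - exact: integrable_scaleR.
have mQ : measurable_fun setT (fun x => Q (Y x)).
  by case/integrableP: iQ => /measurable_EFinP.
exact: (Rintegral_bound PT mQ (fun x => Qb (Y x))).
Qed.

End stein_bound.

(** The two gamma-Stein identities are compared through one solution of the Stein
    equation, so only the defect of the parameters of [Y] survives. *)
Theorem gamma_stein_upper_bound (R : realType) d1 (T1 : measurableType d1)
    (P1 : {measure set T1 -> \bar R}) (Y : T1 -> R) (l : seq (R * R))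
    d2 (T2 : measurableType d2) (P2 : {measure set T2 -> \bar R}) (G : T2 -> R) (nu : R) h :
  P1 setT = 1%E -> measurable_fun setT Y -> P1.-integrable setT (EFin \o Y) ->
  P2 setT = 1%E -> measurable_fun setT G -> P2.-integrable setT (EFin \o G) ->
  (forall p, p \in l -> 0 <= p.1) -> 0 < nu ->
  gamma_stein P1 Y l -> gamma_stein P2 G [:: (nu, 1)] -> H2 h ->
  `|\int[P1]_x h (Y x) - \int[P2]_x h (G x)| <=
  `|psum 2 l - nu| + 2 * `|psum 3 l - psum 2 l| + 4 * pdev l.
Proof.
move=> P1T mY iY P2T mG iG l0 nu0 Yl Gl [dh ch h1 Lh'].
have dE (x : R) : is_derive x 1 h (h^`()%classic x).
  by apply: DeriveDef; [exact: dh|rewrite derive1E].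
have lipdh : lip 1 h^`()%classic.
  by move=> x y; have := Lh' (x, y); apply.
have Lh : lip 1 h.
  move=> x y; wlog xy : x y / x <= y.
    by move=> w; case: (leP x y) => [|/ltW] xy; [|rewrite distrC (distrC x)]; exact: w.
  rewrite distrC (distrC x) (ger0_norm (x := y - x)) ?subr_ge0//.
  apply: (MVT_abs xy (fun z _ => dE z) _ (fun z _ => h1 z)).
  exact/continuous_subspaceT/(is_derive_continuous dE).
set K := (X in _ <= X).
pose e1 := \int[P1]_x `|Y x + nu|; pose e2 := \int[P2]_x `|G x + nu|.
have e10 : 0 <= e1 by exact: Rintegral_ge0.
have e20 : 0 <= e2 by exact: Rintegral_ge0.
apply/ler_addgt0Pr => e e0.
have ep : 0 < e / (e1 + e2 + 1) by rewrite divr_gt0// ltr_wpDl// addr_ge0.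
pose hs := fun y => h (y - nu).
have dhs (y : R) : is_derive y 1 hs (h^`()%classic (y - nu)).
  have := dE (- nu + 1 * y) => /is_derive_affinec.
  have -> : (fun z : R => h (- nu + 1 * z)) = hs.
    by apply/funext => z; rewrite mul1r addrC.
  by rewrite !mul1r [- nu + y]addrC.
have Ldhs : lip 1 (fun y => h^`()%classic (y - nu)).
  by move=> x y; have := lipdh (x - nu) (y - nu); rewrite opprB addrA subrK.
have [f0 [bf0 Lf0 Sf0]] := @stein_solution R (nu / 2) hs _ (divr_gt0 nu0 (ltr0n _ 2)) dhs
   (fun y => h1 (y - nu)) Ldhs _ ep.
pose f := fun x => f0 (x + nu).
have bf : bcont f.
  by have := bcont_affine nu 1 bf0; under eq_fun do rewrite mul1r addrC.
have Lf : lip 2^-1 f.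
  by move=> x y; have := Lf0 (x + nu) (y + nu); rewrite opprD addrACA subrr addr0.
have Sb x : `|- ((x + nu) * f x) + nu * expavg 1 f x - h x -
   (- ((- nu + nu) * f (- nu)) + nu * expavg 1 f (- nu) - h (- nu))| <=
   (e / (e1 + e2 + 1)) * `|x + nu|.
  have E z : expavg 1 f z = expavg 1 f0 (z + nu).
    by apply: eq_Rintegral => u _; rewrite /f addrAC.
  rewrite !E addNr mul0r oppr0 add0r.
  have := Sf0 (x + nu); rewrite /hs addrK add0r.
  by have -> : 2 * (nu / 2) = nu by field.
have b1 := stein_test_bound P1T mY iY l0 Yl bf Lf Lh Sb.
have q0 : forall p : R * R, p \in [:: (nu, 1)] -> 0 <= p.1.
  by move=> p; rewrite inE => /eqP -> /=; exact: ltW.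
have b2 := stein_test_bound P2T mG iG q0 Gl bf Lf Lh Sb.
have p1 r : psum r [:: (nu, 1)] = nu by rewrite /psum big_seq1 expr1n mulr1.
rewrite /pdev !p1 !subrr normr0 in b2.
have k0 : nu - 2 * nu + nu = 0 by ring.
rewrite k0 !mulr0 !addr0 -/e2 in b2; rewrite -/e1 -/K in b1.
set S0 := _ - h (- nu) in b1 b2.
have -> : \int[P1]_x h (Y x) - \int[P2]_x h (G x) =
  (\int[P1]_x h (Y x) + S0) - (\int[P2]_x h (G x) + S0) by ring.
apply: le_trans (ler_normB _ _) _; apply: le_trans (lerD b1 b2) _.
have : (e / (e1 + e2 + 1)) * (e1 + e2) <= e.
  rewrite mulrAC ler_pdivrMr ?ltr_wpDl ?addr_ge0//; apply: ler_wpM2l; first exact: ltW.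
  by rewrite lerDl.
by rewrite mulrDr; lra.
Qed.

(** * Characteristic functions from the Stein identity *)

Section resolvent_powers.
Context (R : realType).
Implicit Types (s t : R) (k : nat).

(** Real and imaginary part of (1 - 2 i s)^-k. *)
Fixpoint respow k s : R * R :=
  if k is k'.+1 then
    let: (u, v) := respow k' s in
    ((u - v * (2 * s)) / (1 + (2 * s) ^+ 2), (u * (2 * s) + v) / (1 + (2 * s) ^+ 2))
  else (1, 0).

Definition respR k s := (respow k s).1.
Definition respI k s := (respow k s).2.

Lemma resp_den_gt0 s : 0 < 1 + (2 * s) ^+ 2.
Proof. by rewrite ltr_wpDr// sqr_ge0. Qed.

Lemma resp_den_neq0 s : 1 + (2 * s) ^+ 2 != 0.
Proof. by rewrite gt_eqF// resp_den_gt0. Qed.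

Lemma respRS k s : respR k.+1 s = (respR k s - respI k s * (2 * s)) / (1 + (2 * s) ^+ 2).
Proof. by rewrite /respR /respI /=; case: (respow k s). Qed.

Lemma respIS k s : respI k.+1 s = (respR k s * (2 * s) + respI k s) / (1 + (2 * s) ^+ 2).
Proof. by rewrite /respR /respI /=; case: (respow k s). Qed.

Lemma resp1 s : respR 1 s = (1 + (2 * s) ^+ 2)^-1 /\ respI 1 s = 2 * s / (1 + (2 * s) ^+ 2).
Proof. by rewrite /respR /respI /= mul0r subr0 !mul1r addr0. Qed.

Lemma resp0 k : respR k 0 = 1 /\ respI k 0 = 0.
Proof.
elim: k => [//|k [IH1 IH2]]; rewrite respRS respIS IH1 IH2 !mulr0 expr0n/= !addr0 !subr0.
by rewrite !divr1 ?mul0r.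
Qed.

Lemma resp_sqnorm k s : respR k s ^+ 2 + respI k s ^+ 2 <= 1.
Proof.
elim: k => [|k IH]; first by rewrite /respR /respI /= expr1n expr0n addr0.
have d0 := resp_den_gt0 s.
have -> : respR k.+1 s ^+ 2 + respI k.+1 s ^+ 2 =
    (respR k s ^+ 2 + respI k s ^+ 2) / (1 + (2 * s) ^+ 2).
  by rewrite respRS respIS; field; rewrite ?resp_den_neq0.
rewrite ler_pdivrMr// mul1r (le_trans IH)// lerDl sqr_ge0//.
Qed.

Lemma respR_le1 k s : `|respR k s| <= 1.
Proof.
rewrite -[leRHS]normr1 -ler_sqr ?nnegrE// !real_normK ?num_real// expr1n -[leLHS]addr0; apply: le_trans (resp_sqnorm k s).
by rewrite lerD2l sqr_ge0.
Qed.

Lemma respI_le1 k s : `|respI k s| <= 1.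
Proof.
rewrite -[leRHS]normr1 -ler_sqr ?nnegrE// !real_normK ?num_real// expr1n -[leLHS]add0r; apply: le_trans (resp_sqnorm k s).
by rewrite lerD2r sqr_ge0.
Qed.

Lemma resp_derive k s :
  is_derive s 1 (respR k) (- (2 * k%:R) * respI k.+1 s) /\
  is_derive s 1 (respI k) ((2 * k%:R) * respR k.+1 s).
Proof.
elim: k => [|k [IH1 IH2]].
  rewrite mulr0 oppr0 !mul0r; split.
    by rewrite (_ : respR 0 = cst 1)//; exact: is_derive_cst.
  by rewrite (_ : respI 0 = cst 0)//; exact: is_derive_cst.
have dd : is_derive s 1 (fun s : R => 1 + (2 * s) ^+ 2) (8 * s).
  by apply: is_derive_eq; rewrite /GRing.scale/=; ring.
have d2 : is_derive s 1 (fun s : R => 2 * s) 2.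
  by apply: is_derive_eq; rewrite /GRing.scale/= mulr1.
have dV := @is_deriveV _ (fun s : R => 1 + (2 * s) ^+ 2) s _ 1 (resp_den_neq0 s) dd.
split.
  rewrite (_ : respR k.+1 = (fun s => (respR k s - respI k s * (2 * s)) * (1 + (2 * s) ^+ 2)^-1)); last first.
    by apply/funext => u; rewrite respRS.
  have h := is_deriveM (is_deriveB IH1 (is_deriveM IH2 d2)) dV.
  apply: (is_derive_eq h); rewrite /GRing.scale/= !fctE !(respIS, respRS) -[k.+1%:R]natr1 -exprVn.
  move: (respR k s) (respI k s) (k%:R : R) (resp_den_neq0 s) => u v K D0.
  by field; rewrite ?resp_den_neq0.
rewrite (_ : respI k.+1 = (fun s => (respR k s * (2 * s) + respI k s) * (1 + (2 * s) ^+ 2)^-1)); last first.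
  by apply/funext => u; rewrite respIS.
have h := is_deriveM (is_deriveD (is_deriveM IH1 d2) IH2) dV.
apply: (is_derive_eq h); rewrite /GRing.scale/= !fctE !(respIS, respRS) -[k.+1%:R]natr1 -exprVn.
move: (respR k s) (respI k s) (k%:R : R) (resp_den_neq0 s) => u v K D0.
by field; rewrite ?resp_den_neq0.
Qed.

End resolvent_powers.

Section cumulant_functions.
Context (R : realType).
Implicit Types (l : seq (R * R)) (t : R).

Definition logmod l t : R :=
  \sum_(p <- l) p.1 * (- (4^-1 * ln (1 + (2 * (p.2 * t)) ^+ 2))).
Definition logarg l t : R :=
  \sum_(p <- l) p.1 * (2^-1 * atan (2 * (p.2 * t)) - p.2 * t).
Definition resumR k l t : R := \sum_(p <- l) p.1 * p.2 ^+ k * respR k (p.2 * t).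
Definition resumI k l t : R := \sum_(p <- l) p.1 * p.2 ^+ k * respI k (p.2 * t).

Lemma is_derive_sum (I : Type) (s : seq I) (f df : I -> R -> R) t :
  (forall i, is_derive t 1 (f i) (df i t)) ->
  is_derive t 1 (fun t => \sum_(i <- s) f i t) (\sum_(i <- s) df i t).
Proof.
move=> h; elim: s => [|i s IH].
  under eq_fun do rewrite big_nil; rewrite big_nil; exact: is_derive_cst.
under eq_fun do rewrite big_cons; rewrite big_cons; exact: (is_deriveD (h i) IH).
Qed.

Lemma is_derive_scalel (f : R -> R) (a t df : R) : is_derive (a * t) 1 f df ->
  is_derive t 1 (fun t => f (a * t)) (a * df).
Proof.
move=> h; have h2 : is_derive (0 + a * t) 1 f df by rewrite add0r.
by have := is_derive_affinec h2; under eq_fun do rewrite add0r.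
Qed.

Lemma resum_derive k l t :
  is_derive t 1 (resumR k l) (- (2 * k%:R) * resumI k.+1 l t) /\
  is_derive t 1 (resumI k l) ((2 * k%:R) * resumR k.+1 l t).
Proof.
split.
  rewrite /resumI mulr_sumr.
  apply: (@is_derive_sum _ l (fun p t => p.1 * p.2 ^+ k * respR k (p.2 * t))
    (fun p t => - (2 * k%:R) * (p.1 * p.2 ^+ k.+1 * respI k.+1 (p.2 * t)))) => p.
  have h := is_deriveZ (p.1 * p.2 ^+ k) (is_derive_scalel (resp_derive k (p.2 * t)).1).
  by apply: (is_derive_eq h); rewrite /GRing.scale/= exprS; ring.
rewrite /resumR mulr_sumr.
apply: (@is_derive_sum _ l (fun p t => p.1 * p.2 ^+ k * respI k (p.2 * t))
  (fun p t => (2 * k%:R) * (p.1 * p.2 ^+ k.+1 * respR k.+1 (p.2 * t)))) => p.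
have h := is_deriveZ (p.1 * p.2 ^+ k) (is_derive_scalel (resp_derive k (p.2 * t)).2).
by apply: (is_derive_eq h); rewrite /GRing.scale/= exprS; ring.
Qed.

Lemma logmod_derive l t : is_derive t 1 (logmod l) (- resumI 1 l t).
Proof.
rewrite /resumI -sumrN.
apply: (@is_derive_sum _ l (fun p t => p.1 * (- (4^-1 * ln (1 + (2 * (p.2 * t)) ^+ 2))))
  (fun p t => - (p.1 * p.2 ^+ 1 * respI 1 (p.2 * t)))) => p.
have d : is_derive t 1 (fun t : R => 1 + (2 * (p.2 * t)) ^+ 2) (8 * p.2 ^+ 2 * t).
  by apply: is_derive_eq; rewrite /GRing.scale/=; ring.
have h := is_deriveZ p.1 (is_deriveN (is_deriveZ 4^-1 (@is_derive_lnc _ (fun t : R => 1 + (2 * (p.2 * t)) ^+ 2) t _ (resp_den_gt0 _) d))).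
apply: (is_derive_eq h); rewrite /GRing.scale/= (resp1 _).2.
by field; rewrite resp_den_neq0.
Qed.

Lemma logarg_derive l t : is_derive t 1 (logarg l) (resumR 1 l t - psum 1 l).
Proof.
rewrite /resumR /psum -sumrB.
apply: (@is_derive_sum _ l (fun p t => p.1 * (2^-1 * atan (2 * (p.2 * t)) - p.2 * t))
  (fun p t => (p.1 * p.2 ^+ 1 * respR 1 (p.2 * t)) - p.1 * p.2 ^+ 1)) => p.
have d2 : is_derive t 1 (fun t : R => p.2 * t) p.2.
  by apply: is_derive_eq; rewrite /GRing.scale/= mulr1.
have d : is_derive t 1 (fun t : R => 2 * (p.2 * t)) (2 * p.2).
  by apply: is_derive_eq; rewrite /GRing.scale/=; ring.
have h := is_deriveZ p.1 (is_deriveB (is_deriveZ 2^-1 (@is_derive_atanc _ (fun t : R => 2 * (p.2 * t)) t _ d)) d2).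
apply: (is_derive_eq h); rewrite /GRing.scale/= (resp1 _).1.
by field; rewrite resp_den_neq0.
Qed.

Lemma logmod0 l : logmod l 0 = 0.
Proof.
rewrite /logmod big1// => p _.
by rewrite !mulr0 expr0n/= addr0 ln1 mulr0 oppr0 mulr0.
Qed.

Lemma logarg0 l : logarg l 0 = 0.
Proof. by rewrite /logarg big1// => p _; rewrite !mulr0 atan0 mulr0 subr0 mulr0. Qed.

Lemma resum0 k l : resumR k l 0 = psum k l /\ resumI k l 0 = 0.
Proof.
split; first by apply: eq_bigr => p _; rewrite mulr0 (resp0 R k).1 mulr1.
by rewrite /resumI big1// => p _; rewrite mulr0 (resp0 R k).2 mulr0.
Qed.

End cumulant_functions.

Section char_fun.
Context (R : realType) d (T : measurableType d) (P : {measure set T -> \bar R}).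
Variables (Y : T -> R) (l : seq (R * R)).
Hypotheses (PT : P setT = 1%E) (mY : measurable_fun setT Y).
Hypotheses (iY : P.-integrable setT (EFin \o Y)) (Yl : gamma_stein P Y l).

Let C t := \int[P]_x cos (t * Y x).
Let S t := \int[P]_x sin (t * Y x).
Let Pfin : (P setT < +oo)%E. Proof. by rewrite PT ltry. Qed.

Lemma stein_cos t : \int[P]_x (Y x * cos (t * Y x)) =
  (resumR 1 l t - psum 1 l) * C t - resumI 1 l t * S t.
Proof.
rewrite (Yl (bcont_cos t)) /resumR /resumI /psum -sumrB !mulr_suml -sumrB.
have iC := bcont_comp_integrable PT mY (bcont_cos t).
have iS := bcont_comp_integrable PT mY (bcont_sin t).
apply: eq_bigr => p _.
under eq_Rintegral do rewrite expavg_cos.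
set u := (1 + _)^-1; set v := _ * u.
have -> : \int[P]_x (u * cos (t * Y x) - v * sin (t * Y x) - cos (t * Y x)) =
  u * C t - v * S t - C t.
  rewrite RintegralB//; last first.
    by apply: integrable_subR; exact: integrable_scaleR.
  by rewrite RintegralB ?RintegralZl//; exact: integrable_scaleR.
rewrite (resp1 _).1 (resp1 _).2 /v /u !expr1 mulrA; ring.
Qed.

Lemma stein_sin t : \int[P]_x (Y x * sin (t * Y x)) =
  (resumR 1 l t - psum 1 l) * S t + resumI 1 l t * C t.
Proof.
rewrite (Yl (bcont_sin t)) /resumR /resumI /psum -sumrB !mulr_suml -big_split.
have iC := bcont_comp_integrable PT mY (bcont_cos t).
have iS := bcont_comp_integrable PT mY (bcont_sin t).
apply: eq_bigr => p _.
under eq_Rintegral do rewrite expavg_sin.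
set u := (1 + _)^-1; set v := _ * u.
have -> : \int[P]_x (u * sin (t * Y x) + v * cos (t * Y x) - sin (t * Y x)) =
  u * S t + v * C t - S t.
  rewrite RintegralB//; last first.
    by apply: integrable_addR; exact: integrable_scaleR.
  by rewrite RintegralD ?RintegralZl//; exact: integrable_scaleR.
rewrite (resp1 _).1 (resp1 _).2 /v /u !expr1 mulrA /=; ring.
Qed.

Lemma mean_cos_derive (t : R) : is_derive t 1 C (- (\int[P]_x (Y x * sin (t * Y x)))).
Proof.
have -> : - (\int[P]_x (Y x * sin (t * Y x))) = \int[P]_x (- (Y x * sin (t * Y x))).
  under [RHS]eq_Rintegral do rewrite -mulN1r.
  by rewrite RintegralZl ?mulN1r//; exact: (mul_bcont_comp_integrable mY iY (bcont_sin t)).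
apply: (@is_derive_integral R _ T P (fun (t : R) x => cos (t * Y x))
  (fun (t : R) x => - (Y x * sin (t * Y x))) (fun x => `|Y x|)).
- by move=> u; exact: (bcont_comp_integrable PT mY (bcont_cos u)).
- by move=> u x; apply: is_derive_eq; rewrite /GRing.scale/=; ring.
- by have := integrable_norm iY.
- by move=> u x; rewrite normrN normrM ler_piMr// sin_max.
Qed.

Lemma mean_sin_derive (t : R) : is_derive t 1 S (\int[P]_x (Y x * cos (t * Y x))).
Proof.
apply: (@is_derive_integral R _ T P (fun (t : R) x => sin (t * Y x))
  (fun (t : R) x => (Y x * cos (t * Y x))) (fun x => `|Y x|)).
- by move=> u; exact: (bcont_comp_integrable PT mY (bcont_sin u)).
- by move=> u x; apply: is_derive_eq; rewrite /GRing.scale/=; ring.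
- by have := integrable_norm iY.
- by move=> u x; rewrite normrM ler_piMr// cos_max.
Qed.

(** The pair (E cos(t Y), E sin(t Y)) and its candidate solve the same linear
    differential equation; their quotient is constant. *)
Theorem stein_char_fun t :
  C t = expR (logmod l t) * cos (logarg l t) /\
  S t = expR (logmod l t) * sin (logarg l t).
Proof.
have dC u := mean_cos_derive u; have dS u := mean_sin_derive u.
have dm u := logmod_derive l u; have da u := logarg_derive l u.
pose U u := expR (- logmod l u) * (C u * cos (logarg l u) + S u * sin (logarg l u)).
pose V u := expR (- logmod l u) * (S u * cos (logarg l u) - C u * sin (logarg l u)).
have dU (u : R) : is_derive u 1 U 0.
  have := dC u; have := dS u; have := dm u; have := da u.
  rewrite stein_cos stein_sin => ? ? ? ?.
  by rewrite /U; apply: is_derive_eq; rewrite /GRing.scale/=; ring.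
have dV (u : R) : is_derive u 1 V 0.
  have := dC u; have := dS u; have := dm u; have := da u.
  rewrite stein_cos stein_sin => ? ? ? ?.
  by rewrite /V; apply: is_derive_eq; rewrite /GRing.scale/=; ring.
have C0 : C 0 = 1.
  by rewrite /C; under eq_Rintegral do rewrite mul0r cos0; rewrite Rintegral_cst// PT mulr1.
have S0 : S 0 = 0.
  by rewrite /S; under eq_Rintegral do rewrite mul0r sin0; rewrite Rintegral_cst// PT mulr1.
have Ut : U t = 1.
  rewrite (is_derive_0_is_cst t 0 dU) /U logmod0 logarg0 C0 S0 oppr0 expR0 cos0 sin0.
  by rewrite !(mul1r, mulr1, mulr0, addr0).
have Vt : V t = 0.
  rewrite (is_derive_0_is_cst t 0 dV) /V logmod0 logarg0 C0 S0 oppr0 expR0 cos0 sin0.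
  by rewrite !(mul1r, mulr1, mulr0, subr0).
have e : expR (logmod l t) * expR (- logmod l t) = 1 by rewrite -expRD subrr expR0.
have cs := cos2Dsin2 (logarg l t).
rewrite /U in Ut; rewrite /V in Vt.
have h1 : C t * cos (logarg l t) + S t * sin (logarg l t) = expR (logmod l t).
  by rewrite -[LHS]mul1r -e -mulrA Ut mulr1.
have h2 : S t * cos (logarg l t) - C t * sin (logarg l t) = 0.
  by rewrite -[LHS]mul1r -e -mulrA Vt mulr0.
move: cs h1 h2; move: (C t) (S t) (cos _) (sin _) => c u x y xy h1 h2.
split.
  transitivity ((c * x + u * y) * x - (u * x - c * y) * y); last by rewrite h1 h2; ring.
  by rewrite -[LHS]mulr1 -xy; ring.
transitivity ((c * x + u * y) * y + (u * x - c * y) * x); last by rewrite h1 h2; ring.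
by rewrite -[LHS]mulr1 -xy; ring.
Qed.

(** The second derivative at 0 of the identity tested against sin. *)
Lemma stein_second_moment : P.-integrable setT (EFin \o (fun x => Y x ^+ 2)) ->
  \int[P]_x (Y x ^+ 2) = 2 * psum 2 l.
Proof.
move=> iY2.
have d1 : is_derive (0 : R) 1 (fun t : R => \int[P]_x (Y x * sin (t * Y x))) (\int[P]_x (Y x ^+ 2 * cos (0 * Y x))).
  apply: (@is_derive_integral R _ T P (fun (t : R) x => Y x * sin (t * Y x))
    (fun (t : R) x => (Y x ^+ 2 * cos (t * Y x))) (fun x => Y x ^+ 2)).
  - by move=> u; exact: (mul_bcont_comp_integrable mY iY (bcont_sin u)).
  - by move=> u x; apply: is_derive_eq; rewrite /GRing.scale/=; ring.
  - exact: iY2.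
  - by move=> u x; rewrite normrM ger0_norm ?sqr_ge0// ler_piMr ?sqr_ge0// cos_max.
have d2 : is_derive (0 : R) 1 (fun t : R => (resumR 1 l t - psum 1 l) * S t + resumI 1 l t * C t) (2 * psum 2 l).
  have [h1 h2] := resum_derive 1 l 0.
  have h3 := mean_cos_derive 0; have h4 := mean_sin_derive 0.
  apply: is_derive_eq; rewrite /GRing.scale/=.
  rewrite !(resum0 _ _).1 !(resum0 _ _).2 subrr mul0r.
  have -> : C 0 = 1.
    by rewrite /C; under eq_Rintegral do rewrite mul0r cos0; rewrite Rintegral_cst// PT mulr1.
  have -> : S 0 = 0.
    by rewrite /S; under eq_Rintegral do rewrite mul0r sin0; rewrite Rintegral_cst// PT mulr1.
  by ring.
have E : (fun t => \int[P]_x (Y x * sin (t * Y x))) =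
   (fun t => (resumR 1 l t - psum 1 l) * S t + resumI 1 l t * C t).
  by apply/funext => t; exact: stein_sin.
rewrite E in d1; have [_ <-] := d2; have [_ ->] := d1.
apply: eq_Rintegral => x _; by rewrite mul0r cos0 mulr1.
Qed.

End char_fun.

(** * The Stein identity of the Gamma law *)

Section positive_half_line.
Context (R : realType).
Notation mu := (@lebesgue_measure R).
Implicit Types f F : R -> R.

Let I (n : nat) : set R := `[n.+1%:R^-1, n.+1%:R].

Let In_gt0 n x : I n x -> 0 < x.
Proof. by rewrite /I/= in_itv/= => /andP[h _]; apply: lt_le_trans h; rewrite invr_gt0. Qed.

Let In_near x : 0 < x -> \forall n \near \oo, I n x.
Proof.
move=> x0; near=> n; rewrite /I/= in_itv/=; apply/andP; split.
  rewrite -[leRHS]invrK lef_pV2 ?posrE ?invr_gt0//.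
  apply: (@le_trans _ _ n%:R); last by rewrite ler_nat.
  near: n; exact: nbhs_infty_ger.
apply: (@le_trans _ _ n%:R); last by rewrite ler_nat.
near: n; exact: nbhs_infty_ger.
Unshelve. all: by end_near. Qed.

Let cvg_patch_In f (x : R) : (f \_ (I n)) x @[n --> \oo] --> (f \_ `]0, +oo[) x.
Proof.
apply: cvg_near_cst; rewrite patchE; case: ifPn => [|].
  rewrite inE/= in_itv/= andbT => x0.
  by near=> n; rewrite patchE ifT// inE; near: n; exact: In_near.
rewrite notin_setE/= in_itv/= andbT => x0; apply: nearW => n.
by rewrite patchE ifF//; apply/negbTE; rewrite notin_setE => /In_gt0.
Unshelve. all: by end_near. Qed.

Lemma FTC_gt0_itv f F (a b : R) : 0 < a -> a <= b ->
  (forall x : R, 0 < x -> {for x, continuous f}) ->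
  (forall x : R, 0 < x -> is_derive x 1 F (f x)) ->
  mu.-integrable `[a, b] (EFin \o f) /\ \int[mu]_(x in `[a, b]) f x = F b - F a.
Proof.
move=> a0 leab cf dF.
have cF x : 0 < x -> {for x, continuous F}.
  by move=> /dF[h _]; exact/differentiable_continuous/derivable1_diffP.
have cw : {within `[a, b], continuous f}.
  apply: continuous_in_subspaceT => x; rewrite inE/= in_itv/= => /andP[ax _].
  by apply: cf; exact: lt_le_trans ax.
split.
  by apply: continuous_compact_integrable => //; exact: segment_compact.
move: leab cw; rewrite le_eqVlt => /predU1P[<- _|ab cw].
  by rewrite set_itv1 Rintegral_set1 subrr.
rewrite /Rintegral (@continuous_FTC2 _ f F)//.
- split.
  + by move=> x; rewrite in_itv/= => /andP[ax _]; have [] := dF x (lt_trans a0 ax).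
  + exact/cvg_at_right_filter/cF.
  + by apply/cvg_at_left_filter/cF; exact: lt_trans ab.
- by move=> x; rewrite in_itv/= => /andP[ax _]; rewrite derive1E; have [_ ->] := dF x (lt_trans a0 ax).
Qed.

Lemma FTC_gt0 f F (l l' : R) : measurable_fun setT f ->
  mu.-integrable `]0, +oo[ (EFin \o f) ->
  (forall x : R, 0 < x -> {for x, continuous f}) ->
  (forall x : R, 0 < x -> is_derive x 1 F (f x)) ->
  F n.+1%:R @[n --> \oo] --> l -> F n.+1%:R^-1 @[n --> \oo] --> l' ->
  \int[mu]_(x in `]0, +oo[) f x = l - l'.
Proof.
move=> mf intf cf dF Fl Fl'.
have intf' : mu.-integrable setT (EFin \o (f \_ `]0, +oo[)).
  by rewrite -restrict_EFin; apply/integrable_restrict => //; rewrite setTI.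
have [||||_] := @Rdominated_cvg _ _ _ mu (fun n => f \_ (I n)) (f \_ `]0, +oo[)
  (fun x => `|(f \_ `]0, +oo[) x|).
- move=> n; apply/measurable_restrict => //; first exact: measurable_itv.
  exact: measurable_funS mf.
- exact: cvg_patch_In.
- by have := integrable_norm intf'.
- move=> n x; rewrite !patchE; case: ifPn => [|_]; last by rewrite normr0.
  by rewrite inE => /In_gt0 x0; rewrite ifT// inE/= in_itv/= x0.
have -> : (fun n : nat => \int[mu]_x (f \_ (I n)) x) = fun n => F n.+1%:R - F n.+1%:R^-1.
  apply/funext => n; rewrite -Rintegral_mkcond.
  apply: (FTC_gt0_itv _ _ cf dF).2; first by rewrite invr_gt0.
  by rewrite (@le_trans _ _ 1)// ?ler1n// invf_le1// ler1n.
rewrite -Rintegral_mkcond => H.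
have U : F n.+1%:R - F n.+1%:R^-1 @[n --> \oo] --> l - l' by apply: cvgB.
exact: (cvg_unique _ H U).
Qed.

Lemma ge0_integrable_gt0 f (C : R) : measurable_fun setT f -> (forall x, 0 <= f x) ->
  (forall n : nat, mu.-integrable `[n.+1%:R^-1, n.+1%:R] (EFin \o f)) ->
  (forall n : nat, \int[mu]_(x in `[n.+1%:R^-1, n.+1%:R]) f x <= C) ->
  mu.-integrable `]0, +oo[ (EFin \o f).
Proof.
move=> mf f0 inf fC; apply/integrableP; split.
  by apply/measurable_EFinP; exact: measurable_funS mf.
under eq_integral do rewrite /= ger0_norm//.
apply: (@le_lt_trans _ _ C%:E); last exact: ltry.
rewrite integral_mkcond.
have mn n : measurable_fun setT (fun x => ((f \_ (I n)) x)%:E).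
  apply/measurable_EFinP/measurable_restrict => //; first exact: measurable_itv.
  exact: measurable_funS mf.
have H := @cvg_monotone_convergence _ _ _ mu setT measurableT
  (fun n x => ((f \_ (I n)) x)%:E) mn _ _.
have H2 : (\int[mu]_x ((f \_ (I n)) x)%:E)%E @[n --> \oo] -->
   (\int[mu]_x (limn (fun n => ((f \_ (I n)) x)%:E)))%E.
  apply: H.
  - by move=> n x _; rewrite lee_fin patchE; case: ifP.
  - move=> x _ n k nk; rewrite lee_fin !patchE; case: ifPn => [|_]; last by case: ifP.
    rewrite inE /I/= in_itv/= => /andP[h1 h2]; rewrite ifT// inE/= in_itv/=.
    apply/andP; split.
      by apply: le_trans h1; rewrite lef_pV2 ?posrE// ler_nat.
    by apply: (le_trans h2); rewrite ler_nat.
apply: (@le_trans _ _ (\int[mu]_x limn (fun n : nat => ((f \_ (I n)) x)%:E))%E).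
  rewrite le_eqVlt; apply/orP; left; apply/eqP; apply: eq_integral => x _.
  apply/esym/cvg_lim => //.
  rewrite [X in _ --> X](_ : _ = ((f \_ `]0, +oo[) x)%:E).
    by apply: cvg_EFin; [exact: nearW|exact: cvg_patch_In].
  by rewrite !patchE; case: ifP.
rewrite -(cvg_lim _ H2)//; apply: lime_le; first exact: cvgP H2.
apply: nearW => n.
have := fC n; rewrite -lee_fin /Rintegral fineK; last exact: integrable_fin_num (inf n).
apply: le_trans; rewrite integral_mkcond le_eqVlt; apply/orP; left; apply/eqP.
by apply: eq_integral => x _; rewrite !patchE; case: ifP.
Qed.

End positive_half_line.
Section gamma_law.
Context (R : realType).
Notation mu := (@lebesgue_measure R).
Variable a : R.
Hypothesis a0 : 0 < a.
Implicit Types (f u : R -> R).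

Let w b (x : R) : R := x `^ b * expR (- x).
Let C : R := (2 * a) `^ a.

Let w_ge0 b x : 0 <= w b x. Proof. by rewrite mulr_ge0 ?powR_ge0 ?expR_ge0. Qed.

Let measurable_w b : measurable_fun setT (w b).
Proof.
apply: measurable_funM; first exact: measurable_powR.
by apply: measurableT_comp => //; exact: measurable_expR.
Qed.

Let powR_derive (b x : R) : 0 < x -> is_derive x 1 (fun x : R => x `^ b) (b * x `^ (b - 1)).
Proof. exact: is_derive1_powR. Qed.

Let powR_continuous b (x : R) : 0 < x -> {for x, continuous (fun x : R => x `^ b)}.
Proof. by move=> /(powR_derive b)[h _]; exact/differentiable_continuous/derivable1_diffP. Qed.

Let expN_continuous c : continuous (fun x : R => expR (- (c * x))).
Proof.
move=> x; apply: (@cvg_comp _ _ _ (fun x : R => - (c * x)) expR); last exact: continuous_expR.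
by apply: cvgN; apply: cvgMr; exact: cvg_id.
Qed.

Let w_continuous b x : 0 < x -> {for x, continuous (w b)}.
Proof.
move=> x0; apply: cvgM; first exact: powR_continuous.
by have := @expN_continuous 1 x; rewrite (_ : (fun y : R => expR (- (1 * y))) = (fun y => expR (- y)))//; apply/funext => y; rewrite mul1r.
Qed.

Let w_derive (x : R) : 0 < x -> is_derive x 1 (w a) (a * w (a - 1) x - w a x).
Proof.
move=> /(powR_derive a) h; rewrite /w; apply: is_derive_eq; rewrite /GRing.scale/=; ring.
Qed.

Let w_bound x : 0 < x -> w a x <= C * expR (- (2^-1 * x)).
Proof.
move=> x0; have a2 : 0 < 2 * a by rewrite mulr_gt0.
have h : x <= (2 * a) * expR (x / (2 * a)).
  have := expR_ge1Dx (x / (2 * a)) => h.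
  have : (2 * a) * (x / (2 * a)) <= (2 * a) * expR (x / (2 * a)).
    by rewrite ler_pM2l//; lra.
  by rewrite mulrC divfK ?gt_eqF.
have h2 : x `^ a <= C * expR (2^-1 * x).
  apply: le_trans (ge0_ler_powR (ltW a0) _ _ h) _; rewrite ?nnegrE ?(ltW x0)//.
    by rewrite mulr_ge0 ?(ltW a2)// expR_ge0.
  rewrite powRM ?(ltW a2) ?expR_ge0// -expRM.
  by have -> : x / (2 * a) * a = 2^-1 * x by field; rewrite gt_eqF.
rewrite /w; apply: (@le_trans _ _ (C * expR (2^-1 * x) * expR (- x))).
  by rewrite ler_wpM2r// expR_ge0.
rewrite -mulrA -expRD; have -> : 2^-1 * x - x = - (2^-1 * x) by field.
by [].
Qed.

Let C0 : 0 <= C. Proof. exact: powR_ge0. Qed.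

Let inv_ge0 n : (n.+1%:R^-1 : R) <= n.+1%:R.
Proof. by rewrite (@le_trans _ _ 1)// ?ler1n// invf_le1// ler1n. Qed.

Let w_integrable : mu.-integrable `]0, +oo[ (EFin \o w (a - 1)) /\
  mu.-integrable `]0, +oo[ (EFin \o w a).
Proof.
have cE x : 0 < x -> {for x, continuous (fun x : R => C * expR (- (2^-1 * x)))}.
  by move=> _; apply: cvgMr; exact: expN_continuous.
have dE (x : R) : 0 < x -> is_derive x 1 (fun x : R => - (2 * C) * expR (- (2^-1 * x)))
   (C * expR (- (2^-1 * x))).
  by move=> _; apply: is_derive_eq; rewrite /GRing.scale/=; field.
have n0 n : 0 < (n.+1%:R^-1 : R) by rewrite invr_gt0.
have wi b n : mu.-integrable `[n.+1%:R^-1, n.+1%:R] (EFin \o w b).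
  apply: continuous_compact_integrable; first exact: segment_compact.
  apply: continuous_in_subspaceT => x; rewrite inE/= in_itv/= => /andP[ax _].
  by apply: w_continuous; exact: lt_le_trans ax.
have wa n : \int[mu]_(x in `[n.+1%:R^-1, n.+1%:R]) w a x <= 2 * C.
  have [h1 h2] := FTC_gt0_itv (n0 n) (inv_ge0 n) cE dE.
  apply: (@le_trans _ _ (\int[mu]_(x in `[n.+1%:R^-1, n.+1%:R]) (C * expR (- (2^-1 * x))))).
    apply: le_Rintegral => // x; rewrite /= in_itv/= => /andP[ax _].
    by apply: w_bound; exact: lt_le_trans ax.
  rewrite h2; have := mulr_ge0 C0 (expR_ge0 (- (2^-1 * n.+1%:R))).
  have : C * expR (- (2^-1 * n.+1%:R^-1)) <= C.
    by rewrite ler_piMr// -expR0 ler_expR oppr_le0 mulr_ge0 ?invr_ge0.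
  lra.
split; last first.
  exact: (@ge0_integrable_gt0 _ _ (2 * C) (measurable_w a) (w_ge0 a) (wi a) wa).
have cH x : 0 < x -> {for x, continuous (fun x => a * w (a - 1) x - w a x)}.
  by move=> x0; apply: cvgB; [apply: cvgMr|]; exact: w_continuous.
apply: (@ge0_integrable_gt0 _ _ ((C + 2 * C) / a) (measurable_w _) (w_ge0 _) (wi _)).
move=> n; rewrite ler_pdivlMr// mulrC -RintegralZl//.
have [h1 h2] := FTC_gt0_itv (n0 n) (inv_ge0 n) cH w_derive.
have -> : \int[mu]_(x in `[n.+1%:R^-1, n.+1%:R]) (a * w (a - 1) x) =
  \int[mu]_(x in `[n.+1%:R^-1, n.+1%:R]) (a * w (a - 1) x - w a x) +
  \int[mu]_(x in `[n.+1%:R^-1, n.+1%:R]) w a x.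
  by rewrite -RintegralD//; apply: eq_Rintegral => x _; rewrite subrK.
have n1 : 0 < (n.+1%:R : R) by [].
rewrite h2 lerD// lerBlDr; apply: (le_trans (w_bound n1)).
apply: (@le_trans _ _ C); last by rewrite lerDl.
by rewrite ler_piMr// -expR0 ler_expR oppr_le0 mulr_ge0 ?invr_ge0.
Qed.

Lemma Gamma_gt0 : 0 < Gamma a.
Proof.
have [h _] := w_integrable.
have w12 (x : R) : x \in `[1, 2] -> expR (- (2 * `|a - 1|) - 2) <= w (a - 1) x.
  rewrite in_itv/= => /andP[x1 x2]; have x0 : 0 < x by exact: lt_le_trans x1.
  rewrite /w /powR gt_eqF// -expRD ler_expR.
  have l0 : 0 <= ln x by rewrite ln_ge0.
  have l1 : ln x <= 2 := ltW (lt_le_trans (ln_sublinear x0) x2).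
  have := ler_norm (- (a - 1)); rewrite normrN => h1.
  have : `|a - 1| * ln x <= `|a - 1| * 2 by rewrite ler_wpM2l.
  have : - `|a - 1| * ln x <= (a - 1) * ln x by rewrite ler_wpM2r//; lra.
  lra.
have i12 : mu.-integrable `[1, 2] (EFin \o w (a - 1)).
  apply: integrableS h => //.
  by move=> x; rewrite /= !in_itv/= andbT => /andP[x1 _]; exact: lt_le_trans x1.
apply: (@lt_le_trans _ _ (\int[mu]_(x in `[1, 2]) w (a - 1) x)).
  apply: (@lt_le_trans _ _ (\int[mu]_(x in `[1, 2]) expR (- (2 * `|a - 1|) - 2))).
    set c := expR _.
    have dE (x : R) : is_derive x 1 (fun x : R => c * x) c.
      by apply: is_derive_eq; rewrite /GRing.scale/= mulr1.
    have l12 : (1 : R) <= 2 by rewrite ler1n.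
    have cc : continuous (fun _ : R => c) by exact: cst_continuous.
    rewrite (FTC_itv l12 cc dE).
    by have : 0 < c by [exact: expR_gt0]; lra.
  apply: le_Rintegral => //.
  by apply: continuous_integrable_itv; exact: cst_continuous.
rewrite /Gamma Rintegral_mkcond [leRHS]Rintegral_mkcond; apply: le_Rintegral => //.
- by rewrite -restrict_EFin; apply/integrable_restrict => //; rewrite setTI.
- by rewrite -restrict_EFin; apply/integrable_restrict => //; rewrite setTI.
- move=> x _; rewrite !patchE; case: ifPn => [|_]; last by case: ifP => // _; exact: w_ge0.
  rewrite inE/= in_itv/= => /andP[x1 _]; rewrite ifT// inE/= in_itv/= andbT.
  exact: lt_le_trans x1.
Qed.

Let Gamma_neq0 : Gamma a != 0. Proof. by rewrite gt_eqF// Gamma_gt0. Qed.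

Let pdfE f : (fun x => f x * gamma_pdf a x) =
  (fun x => (Gamma a)^-1 * (f x * w (a - 1) x)) \_ `]0, +oo[.
Proof.
apply/funext => x; rewrite /gamma_pdf !patchE; case: ifPn => _; last by rewrite mulr0.
by rewrite /w; ring.
Qed.

Let mpos : measurable (`]0, +oo[%classic : set (measurableTypeR R)).
Proof. exact: measurable_itv. Qed.

Let integrable_gt0Z f c : mu.-integrable `]0, +oo[ (EFin \o f) ->
  mu.-integrable `]0, +oo[ (EFin \o (fun x => c * f x)).
Proof. by move=> h; have := integrableZl mpos c h. Qed.

Lemma integrable_gamma f : measurable_fun setT f ->
  mu.-integrable `]0, +oo[ (EFin \o (fun x => f x * w (a - 1) x)) ->
  (gamma_prob a).-integrable setT (EFin \o f).
Proof.
move=> mf intf.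
apply/(@integrable_density _ (measurableTypeR R) R mu (gamma_prob a) (gamma_pdf a)
  (measurable_gamma_pdf a) (@gamma_pdf_ge0 _ a) (fun _ _ => erefl) f mf).
rewrite pdfE -restrict_EFin; apply/integrable_restrict => //.
by rewrite setTI; exact: integrable_gt0Z.
Qed.

Lemma Rintegral_gamma f : measurable_fun setT f ->
  mu.-integrable `]0, +oo[ (EFin \o (fun x => f x * w (a - 1) x)) ->
  \int[gamma_prob a]_x f x =
  (Gamma a)^-1 * \int[mu]_(x in `]0, +oo[) (f x * w (a - 1) x).
Proof.
move=> mf intf.
rewrite (@Rintegral_density _ (measurableTypeR R) R mu (gamma_prob a) (gamma_pdf a)
  (measurable_gamma_pdf a) (@gamma_pdf_ge0 _ a) (fun _ _ => erefl) f mf).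
  by rewrite pdfE -Rintegral_mkcond RintegralZl.
rewrite pdfE -restrict_EFin; apply/integrable_restrict => //.
by rewrite setTI; exact: integrable_gt0Z.
Qed.

Lemma gamma_probT : gamma_prob a setT = 1%E.
Proof.
have [h _] := w_integrable.
rewrite /gamma_prob (_ : (fun x => (gamma_pdf a x)%:E) = EFin \o (fun x => 1 * gamma_pdf a x)); last first.
  by apply/funext => x /=; rewrite mul1r.
rewrite pdfE -restrict_EFin -integral_mkcond.
have -> : (fun x => (Gamma a)^-1 * (1 * w (a - 1) x)) = (fun x => (Gamma a)^-1 * w (a - 1) x).
  by apply/funext => x; rewrite mul1r.
have h2 := integrable_gt0Z (Gamma a)^-1 h.
rewrite -[LHS]fineK; last exact: integrable_fin_num h2.
by congr EFin; rewrite -/(Rintegral _ _ _) RintegralZl// -/(Gamma a) mulVf.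
Qed.

Let gt0_integrable_bounded f g (M : R) : measurable_fun setT f ->
  (forall x, 0 < x -> `|f x| <= M * g x) -> mu.-integrable `]0, +oo[ (EFin \o g) ->
  mu.-integrable `]0, +oo[ (EFin \o f).
Proof.
move=> mf fM ig; apply: (le_integrable mpos _ _ (integrable_gt0Z M ig)).
  by apply/measurable_EFinP; exact: measurable_funS mf.
move=> x; rewrite /= in_itv/= andbT => x0; rewrite lee_fin.
by apply: le_trans (ler_norm _); exact: fM.
Qed.

(** Integration of the derivative of x^a e^-x u(x), where u averages k over an
    exponential step. *)
Theorem centered_gamma_stein :
  gamma_stein (gamma_prob a) (fun x => 2 * x - 2 * a) [:: (2 * a, 1)] /\
  (gamma_prob a).-integrable setT (EFin \o (fun x => 2 * x - 2 * a)).
Proof.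
have [h1 h2] := w_integrable.
have xw x : 0 < x -> x * w (a - 1) x = w a x.
  move=> x0; rewrite /w mulrA; congr (_ * _).
  rewrite -{1}(powRr1 (ltW x0)) -powRD; first by rewrite addrC subrK.
  by rewrite (gt_eqF x0) implybT.
have ib (k : R -> R) : measurable_fun setT k -> (exists M : R, forall x : R, `|k x| <= M) ->
    mu.-integrable `]0, +oo[ (EFin \o (fun x => k x * w (a - 1) x)) /\
    mu.-integrable `]0, +oo[ (EFin \o (fun x => (x * k x) * w (a - 1) x)).
  move=> mk [M kM]; split.
    apply: (gt0_integrable_bounded (M := M) _ _ h1); first exact: measurable_funM.
    by move=> x x0; rewrite normrM (ger0_norm (w_ge0 _ _)) ler_wpM2r.
  apply: (gt0_integrable_bounded (M := M) _ _ h2).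
    by apply: measurable_funM => //; exact: measurable_funM.
  move=> x x0; rewrite [x * _]mulrC -mulrA xw// normrM (ger0_norm (w_ge0 _ _)).
  by rewrite ler_wpM2r.
have ibx (k : R -> R) : measurable_fun setT k -> (exists M : R, forall x : R, `|k x| <= M) ->
    (gamma_prob a).-integrable setT (EFin \o (fun x => x * k x)) /\
    (gamma_prob a).-integrable setT (EFin \o k).
  move=> mk kM; have [i1 i2] := ib k mk kM; split; apply: integrable_gamma => //.
  exact: measurable_funM.
split; last first.
  have [|j1 j2] := ibx (cst 1) (measurable_cst _).
    by exists 1 => x; rewrite normr1.
  have := integrable_subR (integrable_scaleR 2 j1) (integrable_scaleR (2 * a) j2).
  by under eq_fun do rewrite !mulr1.
move=> k bk; rewrite big_seq1 mulr1/=.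
pose q := fun x : R => k (2 * x - 2 * a).
pose U := fun x : R => expavg 1 k (2 * x - 2 * a).
have bq : bcont q.
  by have := bcont_affine (- (2 * a)) 2 bk; under eq_fun do rewrite addrC.
have bU : bcont U.
  by have := bcont_affine (- (2 * a)) 2 (expavg_bcont 1 bk); under eq_fun do rewrite addrC.
have mq := bcont_measurable bq; have mU := bcont_measurable bU.
have [iq1 iq2] := ib q mq bq.2; have [iU1 iU2] := ib U mU bU.2.
have [jq1 jq2] := ibx q mq bq.2; have [jU1 jU2] := ibx U mU bU.2.
have dU (x : R) : is_derive x 1 U (U x - q x).
  have := expavg_derive (- (2 * a) + 2 * x) bk => /is_derive_affinec.
  rewrite (_ : (fun y : R => expavg 1 k (- (2 * a) + 2 * y)) = U); last first.
    by apply/funext => y; rewrite addrC.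
  by move=> h; apply: (is_derive_eq h); rewrite /U /q [- (2 * a) + _]addrC mulrC divfK.
have key : \int[mu]_(x in `]0, +oo[) (a * (U x * w (a - 1) x) - (x * q x) * w (a - 1) x) = 0.
  pose H := fun x : R => w a x * U x.
  pose hh := fun x : R => a * (U x * w (a - 1) x) - (x * q x) * w (a - 1) x.
  have dH (x : R) : 0 < x -> is_derive x 1 H (hh x).
    move=> x0; have e1 := w_derive x0; have e2 := dU x.
    have := is_deriveM e1 e2 => h3; apply: (is_derive_eq h3).
    by rewrite /GRing.scale/= /hh [x * _]mulrC -(mulrA (q x)) xw//; ring.
  have [M UM] := bU.2.
  have M0 : 0 <= M by exact: le_trans (UM 0).
  rewrite -[RHS](subrr 0); apply: (@FTC_gt0 _ hh H 0 0).
  - apply: measurable_funB.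
      by apply: measurable_funM => //; exact: measurable_funM.
    by apply: measurable_funM => //; exact: measurable_funM.
  - have := integrableB mpos (integrable_gt0Z a iU1) iq2.
    exact.
  - move=> x x0; apply: cvgB.
      by apply: cvgMr; apply: cvgM; [exact: bU.1|exact: w_continuous].
    apply: cvgM; last exact: w_continuous.
    by apply: cvgM; [exact: cvg_id|exact: bq.1].
  - apply/norm_cvg0P.
    apply: (@squeeze_cvgr _ _ _ _ (cst 0) (fun n => (2 * C * M) * n.+1%:R^-1)).
    + apply: nearW => n; rewrite normr_ge0/= normrM (ger0_norm (w_ge0 _ _)).
      have n0 : (0 : R) < n.+1%:R by rewrite ltr0n.
      have e1 : expR (- (2^-1 * n.+1%:R)) <= 2 * n.+1%:R^-1 :> R.
        rewrite expRN -[leRHS]invrK lef_pV2 ?posrE ?expR_gt0 ?invr_gt0 ?mulr_gt0 ?invr_gt0//.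
        rewrite invfM invrK; have := expR_ge1Dx (2^-1 * n.+1%:R : R); lra.
      apply: (@le_trans _ _ ((C * (2 * n.+1%:R^-1)) * M)); last first.
        by rewrite le_eqVlt; apply/orP; left; apply/eqP; ring.
      apply: ler_pM => //; apply: (le_trans (w_bound n0)); exact: ler_wpM2l.
    + exact: cvg_cst.
    + rewrite -[X in _ --> X](mulr0 (2 * C * M)); apply: cvgMr; exact: cvg_harmonic.
  - apply/norm_cvg0P.
    apply: (@squeeze_cvgr _ _ _ _ (cst 0) (fun n => M * (n.+1%:R^-1 `^ a))).
    + apply: nearW => n; rewrite normr_ge0/= normrM (ger0_norm (w_ge0 _ _)) mulrC.
      apply: ler_pM => //.
      by rewrite /w ler_piMr ?powR_ge0// -expR0 ler_expR oppr_le0 invr_ge0.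
    + exact: cvg_cst.
    + rewrite -[X in _ --> X](mulr0 M); apply: cvgMr.
      have /cvg_at_rightP hp := powR_cvg0 a0.
      apply: (hp (fun n => n.+1%:R^-1)); split; last exact: cvg_harmonic.
      by move=> n; rewrite invr_gt0.
have E1 : \int[gamma_prob a]_x (x * q x) = a * \int[gamma_prob a]_x U x.
  rewrite !Rintegral_gamma//; last exact: measurable_funM.
  rewrite mulrCA; congr (_ * _).
  rewrite -RintegralZl//; apply/esym/eqP; rewrite -subr_eq0; apply/eqP.
  rewrite -RintegralB//; exact: integrable_gt0Z.
rewrite -/(Rintegral _ _ _).
under eq_Rintegral do rewrite mulrBl -mulrA.
rewrite RintegralB//; [|exact: integrable_scaleR|exact: integrable_scaleR].
rewrite !RintegralZl// E1 RintegralB//.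
by ring.
Qed.

End gamma_law.

(** * The normal law *)

(** Only one iterated integral has to be bounded for the exchange, and the bound may
    depend on the outer variable. *)
Lemma Rfubini (R : realType) dd1 dd2 (T1 : measurableType dd1) (T2 : measurableType dd2)
   (m1 : {sigma_finite_measure set T1 -> \bar R})
   (m2 : {sigma_finite_measure set T2 -> \bar R}) (f : T1 -> T2 -> R) (G : T1 -> R) :
  measurable_fun setT (fun z : T1 * T2 => f z.1 z.2) ->
  m1.-integrable setT (EFin \o G) ->
  (forall x, (\int[m2]_y (`|f x y|)%:E <= (G x)%:E)%E) ->
  (forall y, m1.-integrable setT (EFin \o (f ^~ y))) ->
  measurable_fun setT (fun x => \int[m2]_y f x y) /\
  \int[m1]_x (\int[m2]_y f x y) = \int[m2]_y (\int[m1]_x f x y).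
Proof.
move=> mf iG fG f2.
have mEf : measurable_fun setT (fun z : T1 * T2 => (f z.1 z.2)%:E) by exact/measurable_EFinP.
have intf : (m1 \x m2)%E.-integrable setT (fun z : T1 * T2 => (f z.1 z.2)%:E).
  apply/integrable12ltyP => //=.
  apply: (@le_lt_trans _ _ (\int[m1]_x `|(EFin \o G) x|)%E); last by case/integrableP: iG.
  apply: ge0_le_integral => //.
  - by move=> x _; exact: integral_ge0.
  - have := @measurable_fun_fubini_tonelli_F _ _ T1 T2 R m2
      (fun z : T1 * T2 => `|(f z.1 z.2)%:E|%E).
    by apply => //; exact: measurableT_comp.
  - by apply: measurableT_comp => //; case/integrableP: iG.
  - by move=> x _; apply: le_trans (fG x) _; rewrite lee_fin ler_norm.
have f1 x : m2.-integrable setT (EFin \o f x).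
  apply/integrableP; split.
    apply/measurable_EFinP.
    exact: (measurableT_comp mf (pair1_measurable x)).
  exact: le_lt_trans (fG x) (ltry _).
split.
  have := measurable_fubini_F intf => /= mF.
  exact: (measurableT_comp (@fine_measurable R setT measurableT) mF).
have := Fubini intf => /= E.
rewrite /Rintegral; congr fine.
transitivity (\int[m1]_x (\int[m2]_y (f x y)%:E))%E.
  by apply: eq_integral => x _; rewrite fineK//; exact: integrable_fin_num (f1 x).
rewrite E; apply: eq_integral => y _; rewrite fineK//.
exact: integrable_fin_num (f2 y).
Qed.

Section normal_prob_mass.
Context (R : realType) (m s : R).
Let mass : normal_prob m s setT = 1%E. Proof. exact: probability_setT. Qed.

Lemma normal_prob_fin : (normal_prob m s setT < +oo)%E. Proof. by rewrite mass ltry. Qed.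

Lemma normal_int_cst (c : R) : \int[normal_prob m s]_(_ in setT) c = c.
Proof.
have -> := @Rintegral_cst _ (measurableTypeR R) R (normal_prob m s) setT measurableT c.
by rewrite -[RHS]mulr1; congr (_ * _); exact: (congr1 fine mass).
Qed.

Lemma normal_cst_integrable (c : R) : (normal_prob m s).-integrable setT (EFin \o (fun _ : R => c)).
Proof.
exact: (@integrable_cstR _ (measurableTypeR R) R (normal_prob m s) c normal_prob_fin).
Qed.
End normal_prob_mass.

Section normal_law.
Context (R : realType).
Notation mu := (@lebesgue_measure R).
Variables (m s : R).
Hypothesis s0 : 0 < s.
Implicit Types f : R -> R.

Let sn0 : s != 0. Proof. by rewrite gt_eqF. Qed.

Let pdfE : normal_pdf m s = fun x => normal_peak s * normal_fun m s x.
Proof. by apply/funext => x; rewrite normal_pdfE. Qed.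

Lemma normal_pdf_derive (x : R) :
  is_derive x 1 (normal_pdf m s) (- ((x - m) / s ^+ 2) * normal_pdf m s x).
Proof.
rewrite pdfE /normal_fun.
have h : is_derive x 1 (fun x : R => - (x - m) ^+ 2 / (s ^+ 2 *+ 2)) (- ((x - m) / s ^+ 2)).
  apply: is_derive_eq; rewrite /GRing.scale/= -mulr_natr; field.
  by rewrite sn0.
apply: is_derive_eq; rewrite /GRing.scale/=; ring.
Qed.

Lemma sqr_normal_pdf_bound (x : R) :
  (1 + (x - m) ^+ 2) * normal_pdf m s x <= (1 + 4 * s ^+ 2) * 2 * normal_pdf m (2 * s) x.
Proof.
have s20 : 2 * s != 0 by rewrite mulf_neq0.
have pk : normal_peak s = 2 * normal_peak (2 * s).
  rewrite /normal_peak.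
  have -> : (2 * s) ^+ 2 * pi *+ 2 = 2 ^+ 2 * (s ^+ 2 * pi *+ 2) by rewrite !mulr2n; ring.
  by rewrite [in RHS]sqrtrM ?sqr_ge0// sqrtr_sqr ger0_norm// invfM mulrA mulfV// mul1r.
rewrite pdfE normal_pdfE// pk /normal_fun.
set v := (x - m) ^+ 2; set p := normal_peak _.
have p0 : 0 <= p by exact: normal_peak_ge0.
have v0 : 0 <= v by exact: sqr_ge0.
have -> : - v / (s ^+ 2 *+ 2) = 3 * v / (8 * s ^+ 2) * -1 + - v / ((2 * s) ^+ 2 *+ 2).
  by rewrite -(mulr_natr (s ^+ 2) 2) -(mulr_natr ((2 * s) ^+ 2) 2); field; rewrite sn0.
rewrite expRD mulrN1 expRN; set e := expR (_ / _); set e2 := expR _.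
have e20 : 0 <= e2 by exact: expR_ge0.
have e0 : 0 < e by exact: expR_gt0.
have h : 1 + v <= (1 + 4 * s ^+ 2) * e.
  have h1 : 1 + 3 * v / (8 * s ^+ 2) <= e by exact: expR_ge1Dx.
  apply: (@le_trans _ _ ((1 + 4 * s ^+ 2) * (1 + 3 * v / (8 * s ^+ 2)))).
    have -> : (1 + 4 * s ^+ 2) * (1 + 3 * v / (8 * s ^+ 2)) =
      1 + v + 2^-1 * v + 4 * s ^+ 2 + 3 * v / (8 * s ^+ 2) by field; rewrite sn0.
    have : 0 <= 3 * v / (8 * s ^+ 2).
      by apply: divr_ge0; apply: mulr_ge0 => //; exact: sqr_ge0.
    have := sqr_ge0 s; lra.
  by rewrite ler_wpM2l// addr_ge0// mulr_ge0// sqr_ge0.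
have h2 : (1 + v) * e^-1 <= 1 + 4 * s ^+ 2 by rewrite ler_pdivrMr.
have -> : (1 + v) * (2 * p * (e^-1 * e2)) = ((1 + v) * e^-1) * (2 * p * e2) by ring.
have -> : (1 + 4 * s ^+ 2) * 2 * (p * e2) = (1 + 4 * s ^+ 2) * (2 * p * e2) by ring.
by rewrite ler_wpM2r// !mulr_ge0.
Qed.

Lemma normal_poly_integrable f (K : R) : measurable_fun setT f ->
  (forall x, `|f x| <= K * (1 + (x - m) ^+ 2)) ->
  (normal_prob m s).-integrable setT (EFin \o f) /\
  mu.-integrable setT (EFin \o (fun x => f x * normal_pdf m s x)).
Proof.
move=> mf fK.
have i2 : mu.-integrable setT (EFin \o (fun x => f x * normal_pdf m s x)).
  have i3 := integrable_normal_pdf m (2 * s).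
  have K0 : 0 <= K.
    have := le_trans (normr_ge0 _) (fK m); rewrite subrr expr0n/= addr0 mulr1; exact.
  apply: (le_integrable_abs _ (integrable_scaleR (K * ((1 + 4 * s ^+ 2) * 2)) i3)).
    by apply: measurable_funM => //; exact: measurable_normal_pdf.
  move=> x; rewrite normrM (ger0_norm (normal_pdf_ge0 _ _ _)).
  apply: le_trans (ler_wpM2r (normal_pdf_ge0 _ _ _) (fK x)) _.
  by have := ler_wpM2l K0 (sqr_normal_pdf_bound x); rewrite !mulrA.
split => //.
by apply/(@integrable_density _ (measurableTypeR R) R mu (normal_prob m s) (normal_pdf m s)
  (measurable_normal_pdf m s) (@normal_pdf_ge0 _ m s) (fun _ _ => erefl) f mf).
Qed.

Lemma Rintegral_normal f (K : R) : measurable_fun setT f ->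
  (forall x, `|f x| <= K * (1 + (x - m) ^+ 2)) ->
  \int[normal_prob m s]_x f x = \int[mu]_x (f x * normal_pdf m s x).
Proof.
move=> mf fK; have [_ i2] := normal_poly_integrable mf fK.
exact: (@Rintegral_density _ (measurableTypeR R) R mu (normal_prob m s) (normal_pdf m s)
  (measurable_normal_pdf m s) (@normal_pdf_ge0 _ m s) (fun _ _ => erefl) f mf i2).
Qed.

(** Gaussian integration by parts. *)
Lemma normal_stein f df (K : R) : (forall x : R, is_derive x 1 f (df x)) ->
  continuous df -> (forall x, `|(x - m) * f x| <= K * (1 + (x - m) ^+ 2)) ->
  (forall x, `|df x| <= K * (1 + (x - m) ^+ 2)) ->
  \int[normal_prob m s]_x ((x - m) * f x) = s ^+ 2 * \int[normal_prob m s]_x df x.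
Proof.
move=> dfE cdf fK dfK; have cf := is_derive_continuous dfE.
have cm : continuous (fun x => (x - m) * f x).
  by move=> x; apply: cvgM; [apply: cvgB; [exact: cvg_id|exact: cvg_cst]|exact: cf].
have m1 := continuous_measurable_fun cm; have m2 := continuous_measurable_fun cdf.
have [i1 j1] := normal_poly_integrable m1 fK.
have [i2 j2] := normal_poly_integrable m2 dfK.
rewrite (Rintegral_normal m1 fK) (Rintegral_normal m2 dfK) -RintegralZl//.
apply/eqP; rewrite -subr_eq0; apply/eqP; rewrite -RintegralB//; last exact: integrable_scaleR.
pose F x := - (s ^+ 2 * (f x * normal_pdf m s x)).
pose h x := (x - m) * f x * normal_pdf m s x - s ^+ 2 * (df x * normal_pdf m s x).
have dF (x : R) : is_derive x 1 F (h x).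
  have h1 := dfE x; have h2 := normal_pdf_derive x.
  have h3 := is_deriveN (is_deriveZ (s ^+ 2) (is_deriveM h1 h2)).
  by apply: (is_derive_eq h3); rewrite /GRing.scale/= /h; field; rewrite sn0.
have cp := is_derive_continuous normal_pdf_derive.
have [B [B0 FB]] : exists B, 0 <= B /\ forall x, `|(x - m) * F x| <= B.
  exists (s ^+ 2 * (K * ((1 + 4 * s ^+ 2) * 2 * normal_peak (2 * s)))).
  have K0 : 0 <= K.
    have := le_trans (normr_ge0 _) (dfK m); rewrite subrr expr0n/= addr0 mulr1; exact.
  split.
    apply: mulr_ge0; first exact: sqr_ge0.
    apply: mulr_ge0 => //; apply: mulr_ge0; last exact: normal_peak_ge0.
    by rewrite mulr_ge0// addr_ge0// mulr_ge0// sqr_ge0.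
  move=> x; rewrite /F.
  have -> : (x - m) * - (s ^+ 2 * (f x * normal_pdf m s x)) =
    - (s ^+ 2 * (((x - m) * f x) * normal_pdf m s x)) by ring.
  rewrite normrN normrM (ger0_norm (sqr_ge0 s)) ler_wpM2l ?sqr_ge0//.
  rewrite normrM (ger0_norm (normal_pdf_ge0 _ _ _)).
  apply: le_trans (ler_wpM2r (normal_pdf_ge0 _ _ _) (fK x)) _.
  rewrite -[leLHS]mulrA; apply: ler_wpM2l => //; apply: le_trans (sqr_normal_pdf_bound x) _.
  rewrite ler_wpM2l ?normal_pdf_ub ?mulf_neq0//.
  by rewrite mulr_ge0// addr_ge0// mulr_ge0// sqr_ge0.
have Flim (u : nat -> R) : (forall n, `|u n| = n%:R) -> F (u n) @[n --> \oo] --> (0 : R).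
  move=> un; apply/norm_cvg0P.
  apply: (@squeeze_cvgr _ _ _ _ (cst 0) (fun n => (4 * B) * n.+1%:R^-1)).
  - near=> n; rewrite normr_ge0/= ler_pdivlMr//.
    have n2 : 2 * `|m| + 1 <= n%:R by near: n; exact: nbhs_infty_ger.
    have := FB (u n); rewrite normrM => hB.
    have h1 : `|u n| - `|m| <= `|u n - m| by exact: lerB_dist.
    rewrite un in h1.
    have -> : (n.+1%:R : R) = n%:R + 1 by rewrite -natr1.
    apply: (@le_trans _ _ (4 * (`|u n - m| * `|F (u n)|))); last by rewrite ler_wpM2l.
    rewrite mulrC mulrA ler_wpM2r//; have := normr_ge0 m; lra.
  - exact: cvg_cst.
  - rewrite -[X in _ --> X](mulr0 (4 * B)); apply: cvgMr; exact: cvg_harmonic.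
rewrite -[RHS](subrr 0); apply: (@FTC_T _ h F).
- move=> x; apply: cvgB.
    by apply: cvgM; [exact: cm|exact: cp].
  by apply: cvgMr; apply: cvgM; [exact: cdf|exact: cp].
- by apply: integrable_subR => //; exact: integrable_scaleR.
- exact: (Flim (fun n => n%:R) (fun n => ger0_norm (ler0n _ n))).
- by apply: (Flim (fun n => - n%:R)) => n; rewrite normrN ger0_norm.
Unshelve. all: by end_near. Qed.

Lemma normal_integrable_id : (normal_prob m s).-integrable setT (EFin \o (fun x : R => x)).
Proof.
apply: (@normal_poly_integrable _ (1 + `|m|) _ _).1; first exact: measurable_id.
move=> x; have := ler_normD (x - m) m; rewrite subrK => h; apply: (le_trans h).
have : `|x - m| <= 1 + (x - m) ^+ 2.
  have := sqr_ge0 (`|x - m| - 1); have := real_normK (num_real (x - m)); nra.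
have := normr_ge0 m; have := sqr_ge0 (x - m); nra.
Qed.

Let abs_sqr (y : R) : `|y| <= 1 + y ^+ 2.
Proof. have := sqr_ge0 (`|y| - 1); have := real_normK (num_real y); nra. Qed.

Lemma normal_mean : \int[normal_prob m s]_x x = m.
Proof.
have d (x : R) : is_derive x 1 (fun=> 1 : R) 0 by exact: is_derive_cst.
have c : continuous (fun _ : R => 0 : R) by exact: cst_continuous.
have := @normal_stein _ _ 1 d c _ _; rewrite normal_int_cst mulr0 => h.
have {}h : \int[normal_prob m s]_x (x - m) = 0.
  under eq_Rintegral do rewrite -[_ - m]mulr1.
  apply: h => x; rewrite ?mulr1 ?mul1r ?normr0 ?addr_ge0 ?sqr_ge0//.
have i1 := normal_integrable_id.
have i2 := normal_cst_integrable m s m.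
move: h; rewrite RintegralB// => /eqP; rewrite subr_eq0 => /eqP ->.
exact: normal_int_cst.
Qed.

Lemma normal_variance : \int[normal_prob m s]_x ((x - m) ^+ 2) = s ^+ 2.
Proof.
have d (x : R) : is_derive x 1 (fun x : R => x - m) 1.
  by apply: is_derive_eq; rewrite subr0.
have c : continuous (fun _ : R => 1 : R) by exact: cst_continuous.
have h := @normal_stein _ _ 1 d c _ _; rewrite normal_int_cst mulr1 in h.
under eq_Rintegral do rewrite expr2.
apply: h => x.
  by rewrite mul1r -expr2 ger0_norm ?sqr_ge0// lerDr.
by rewrite normr1 mul1r lerDl sqr_ge0.
Qed.

End normal_law.

Section normal_char.
Context (R : realType) (s : R).
Hypothesis s0 : 0 < s.
Let N := normal_prob 0 s.

Let NT : N setT = 1%E. Proof. exact: probability_setT. Qed.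

Let int_bcont k : bcont k -> N.-integrable setT (EFin \o k).
Proof.
move=> bk; have mid : measurable_fun setT (fun x : measurableTypeR R => x : R) by exact: measurable_id.
exact: (@bcont_comp_integrable R _ (measurableTypeR R) N (fun x : R => x) NT mid k bk).
Qed.

Lemma normal_char t : \int[N]_x cos (t * x) = expR (- (s ^+ 2 * t ^+ 2 / 2)) /\
  \int[N]_x sin (t * x) = 0.
Proof.
pose C t := \int[N]_x cos (t * x); pose S t := \int[N]_x sin (t * x).
have iabs := integrable_norm (normal_integrable_id 0 s0).
have sC (u : R) : \int[N]_x (x * sin (u * x)) = s ^+ 2 * u * C u.
  have d (x : R) : is_derive x 1 (fun x : R => sin (u * x)) (u * cos (u * x)).
    by apply: is_derive_eq; rewrite /GRing.scale/=; ring.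
  have := @normal_stein R 0 s s0 _ _ (1 + `|u|) d (bcontZ u (bcont_cos u)).1 _ _.
  under eq_Rintegral do rewrite subr0.
  rewrite RintegralZl//; last by exact: int_bcont (bcont_cos u).
  rewrite mulrA; apply => x; rewrite subr0.
    rewrite normrM.
    have h1 := sin_max (u * x); have h2 := normr_ge0 x; have h3 := normr_ge0 u.
    have h4 := real_normK (num_real x); have h5 := sqr_ge0 (`|x| - 1).
    have h6 : `|x| * `|sin (u * x)| <= `|x| by rewrite ler_piMr.
    have h7 : 0 <= `|u| * (1 + x ^+ 2) by rewrite mulr_ge0// addr_ge0// sqr_ge0.
    by rewrite mulrDl mul1r; nra.
  rewrite normrM; have h1 := cos_max (u * x).
  have h3 := normr_ge0 u; have h6 : `|u| * `|cos (u * x)| <= `|u| by rewrite ler_piMr.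
  have h7 := sqr_ge0 x; have h8 : 0 <= `|u| * x ^+ 2 by rewrite mulr_ge0.
  rewrite mulrDl mul1r mulrDr mulr1; lra.
have sS (u : R) : \int[N]_x (x * cos (u * x)) = - (s ^+ 2 * u * S u).
  have d (x : R) : is_derive x 1 (fun x : R => cos (u * x)) (- u * sin (u * x)).
    by apply: is_derive_eq; rewrite /GRing.scale/=; ring.
  have := @normal_stein R 0 s s0 _ _ (1 + `|u|) d (bcontZ (- u) (bcont_sin u)).1 _ _.
  under eq_Rintegral do rewrite subr0.
  rewrite RintegralZl//; last by exact: int_bcont (bcont_sin u).
  rewrite mulrA mulrN mulNr; apply => x; rewrite subr0.
    rewrite normrM.
    have h1 := cos_max (u * x); have h2 := normr_ge0 x; have h3 := normr_ge0 u.
    have h4 := real_normK (num_real x); have h5 := sqr_ge0 (`|x| - 1).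
    have h6 : `|x| * `|cos (u * x)| <= `|x| by rewrite ler_piMr.
    have h7 : 0 <= `|u| * (1 + x ^+ 2) by rewrite mulr_ge0// addr_ge0// sqr_ge0.
    by rewrite mulrDl mul1r; nra.
  rewrite normrM normrN; have h1 := sin_max (u * x).
  have h3 := normr_ge0 u; have h6 : `|u| * `|sin (u * x)| <= `|u| by rewrite ler_piMr.
  have h7 := sqr_ge0 x; have h8 : 0 <= `|u| * x ^+ 2 by rewrite mulr_ge0.
  rewrite mulrDl mul1r mulrDr mulr1; lra.
have dC (u : R) : is_derive u 1 C (- (s ^+ 2 * u * C u)).
  rewrite -sC.
  have -> : - (\int[N]_x (x * sin (u * x))) = \int[N]_x (- (x * sin (u * x))).
    under [RHS]eq_Rintegral do rewrite -mulN1r.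
    rewrite RintegralZl ?mulN1r//.
    apply: (@le_integrable_abs _ (measurableTypeR R) R N _ (fun x : R => `|x|)).
    - by apply: measurable_funM; [exact: measurable_id|exact: bcont_measurable (bcont_sin u)].
    - exact: iabs.
    - by move=> x; rewrite normrM ler_piMr// sin_max.
  apply: (@is_derive_integral R _ (measurableTypeR R) N (fun (t : R) (x : R) => cos (t * x))
    (fun (t : R) (x : R) => - (x * sin (t * x))) (fun x : R => `|x|)).
  - by move=> v; exact: int_bcont (bcont_cos v).
  - by move=> v x; apply: is_derive_eq; rewrite /GRing.scale/=; ring.
  - exact: iabs.
  - by move=> v x; rewrite normrN normrM ler_piMr// sin_max.
have dS (u : R) : is_derive u 1 S (- (s ^+ 2 * u * S u)).
  rewrite -sS.
  apply: (@is_derive_integral R _ (measurableTypeR R) N (fun (t : R) (x : R) => sin (t * x))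
    (fun (t : R) (x : R) => x * cos (t * x)) (fun x : R => `|x|)).
  - by move=> v; exact: int_bcont (bcont_sin v).
  - by move=> v x; apply: is_derive_eq; rewrite /GRing.scale/=; ring.
  - exact: iabs.
  - by move=> v x; rewrite normrM ler_piMr// cos_max.
have ode (D : R -> R) : (forall u : R, is_derive u 1 D (- (s ^+ 2 * u * D u))) ->
    D t = expR (- (s ^+ 2 * t ^+ 2 / 2)) * D 0.
  move=> dD.
  pose V := fun u : R => expR (s ^+ 2 * u ^+ 2 / 2) * D u.
  have dV (u : R) : is_derive u 1 V 0.
    by have := dD u => ?; rewrite /V; apply: is_derive_eq; rewrite /GRing.scale/=; field.
  have := is_derive_0_is_cst t 0 dV; rewrite /V expr0n/= mulr0 mul0r expR0 mul1r => <-.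
  by rewrite mulrA -expRD addNr expR0 mul1r.
rewrite -/(C t) -/(S t) (ode _ dC) (ode _ dS).
have -> : C 0 = 1.
  rewrite /C; under eq_Rintegral do rewrite mul0r cos0; exact: normal_int_cst.
have -> : S 0 = 0.
  rewrite /S; under eq_Rintegral do rewrite mul0r sin0; exact: normal_int_cst.
by rewrite mulr1 mulr0.
Qed.

End normal_char.

(** * Fourier uniqueness *)

Section mollify.
Context (R : realType).
Notation mu := (@lebesgue_measure R).
Notation gauss := (normal_prob (0 : R) 1).

(** A narrow normal density is an average of cosines, because the normal characteristic
    function is again a Gaussian; this replaces Fourier inversion. *)
Lemma normal_pdf_fourier (x eps y : R) : 0 < eps ->
  normal_pdf x eps y = normal_peak eps * \int[gauss]_v cos (v * ((y - x) / eps)).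
Proof.
move=> e0; have en0 : eps != 0 by rewrite gt_eqF.
rewrite normal_pdfE//; congr (_ * _).
under eq_Rintegral do rewrite mulrC.
rewrite (normal_char ltr01 _).1 /normal_fun; congr expR.
by rewrite -(mulr_natr (eps ^+ 2) 2); field; rewrite en0.
Qed.

Lemma normal_bcont_integral k (x eps : R) : 0 < eps -> bcont k ->
  (normal_prob x eps).-integrable setT (EFin \o k) /\
  mu.-integrable setT (EFin \o (fun y => k y * normal_pdf x eps y)) /\
  \int[normal_prob x eps]_y k y = \int[mu]_y (k y * normal_pdf x eps y).
Proof.
move=> e0 bk; have [ck [M kM]] := bk; have mk := bcont_measurable bk.
have kM' y : `|k y| <= M * (1 + (y - x) ^+ 2).
  have M0 : 0 <= M by exact: le_trans (kM 0).
  by rewrite (le_trans (kM y))// ler_peMr// lerDl sqr_ge0.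
have [i1 i2] := normal_poly_integrable e0 mk kM'.
by rewrite (Rintegral_normal e0 mk kM').
Qed.

(** Chebyshev: the mass outside a fixed neighbourhood of x is at most the variance over
    the square of its radius. *)
Lemma mollify_cvg k (x : R) : bcont k ->
  \int[normal_prob x n.+1%:R^-1]_y k y @[n --> \oo] --> k x.
Proof.
move=> bk; have [ck [M kM]] := bk.
have M0 : 0 <= M by exact: le_trans (kM 0).
apply/cvgrPdist_le => e e0.
have e2 : 0 < e / 2 by rewrite divr_gt0.
have /cvgrPdist_le/(_ _ e2)[dl /= d0 hd] := ck x.
have key y : `|k x - k y| <= e / 2 + 2 * M / dl ^+ 2 * (y - x) ^+ 2.
  have [yd|yd] := ltP `|x - y| dl.
    apply: (le_trans (hd _ yd)); rewrite lerDl mulr_ge0 ?sqr_ge0// divr_ge0 ?sqr_ge0//.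
    by rewrite mulr_ge0.
  apply: (@le_trans _ _ (2 * M)).
    by rewrite (le_trans (ler_normB _ _))//; have := kM x; have := kM y; lra.
  apply: (@le_trans _ _ (2 * M / dl ^+ 2 * (y - x) ^+ 2)); last by rewrite lerDr ltW.
  rewrite mulrAC ler_pdivlMr ?exprn_gt0// ler_wpM2l ?mulr_ge0//.
  have -> : (y - x) ^+ 2 = `|x - y| ^+ 2 by rewrite real_normK ?num_real//; ring.
  by rewrite ler_sqr// nnegrE ltW.
near=> n.
have n0 : (0 : R) < n.+1%:R^-1 by rewrite invr_gt0.
have [i1 _] := normal_bcont_integral x n0 bk.
have i2 := normal_cst_integrable x n.+1%:R^-1 (k x).
rewrite -{1}(normal_int_cst x n.+1%:R^-1 (k x)) -RintegralB//.
apply: le_trans (le_normr_Rintegral measurableT (integrable_subR i2 i1)) _.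
have i3 : (normal_prob x n.+1%:R^-1).-integrable setT (EFin \o (fun y : R => (y - x) ^+ 2)).
  apply: (@normal_poly_integrable _ _ _ n0 _ 1 _ _).1.
    by apply: measurable_funX; exact: measurable_funB.
  by move=> y; rewrite ger0_norm ?sqr_ge0// mul1r lerDr.
have i4 := normal_cst_integrable x n.+1%:R^-1 (e / 2).
apply: (@le_trans _ _ (\int[normal_prob x n.+1%:R^-1]_y
    (e / 2 + 2 * M / dl ^+ 2 * (y - x) ^+ 2))).
  apply: le_Rintegral => //.
  - by have := integrable_norm (integrable_subR i2 i1).
  - by apply: integrable_addR => //; exact: integrable_scaleR.
rewrite RintegralD//; last exact: integrable_scaleR.
rewrite RintegralZl// normal_int_cst normal_variance//.
have : 2 * M / dl ^+ 2 * n.+1%:R^-1 ^+ 2 <= e / 2 :> R.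
  near: n.
  have : 2 * M / dl ^+ 2 * n.+1%:R^-1 ^+ 2 @[n --> \oo] --> (0 : R).
    rewrite -(mulr0 (2 * M / dl ^+ 2)); apply: cvgMr.
    rewrite -(mulr0 0) ; under eq_fun do rewrite expr2.
    by apply: cvgM; exact: cvg_harmonic.
  move=> /cvgr0_norm_le/(_ _ e2)[N _ hN]; exists N => // j Nj.
  exact: le_trans (ler_norm _) (hN j Nj).
by move=> H0; rewrite {2}(splitr e) lerD2l.
Unshelve. all: by end_near. Qed.

Section one_space.
Context d (T : measurableType d) (m : {sigma_finite_measure set T -> \bar R}).
Variables (Z Y : T -> R).
Hypotheses (iZ : m.-integrable setT (EFin \o Z)) (mY : measurable_fun setT Y).

Let mZ : measurable_fun setT Z.
Proof. by case/integrableP : iZ => /measurable_EFinP. Qed.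

Lemma bounded_mul_integrable (g : T -> R) (M : R) : measurable_fun setT g ->
  (forall x, `|g x| <= M) -> m.-integrable setT (EFin \o (fun w => Z w * g w)).
Proof.
move=> mg gM; apply: (@le_integrable_abs _ _ _ m _ (fun w => M * `|Z w|)).
- exact: measurable_funM.
- by apply: integrable_scaleR; have := integrable_norm iZ.
- by move=> w; rewrite normrM mulrC ler_wpM2r.
Qed.

(** After mollification, the integral of Z k(Y) depends on Z and Y only through the
    integrals of Z cos(u Y) and Z sin(u Y). *)
Lemma mollify_fourier k (eps : R) : 0 < eps -> bcont k ->
  measurable_fun setT (fun w => Z w * \int[normal_prob (Y w) eps]_y k y) /\
  \int[m]_w (Z w * \int[normal_prob (Y w) eps]_y k y) =
  \int[mu]_y (k y * (normal_peak eps * \int[gauss]_v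
    (cos (v * (y / eps)) * \int[m]_w (Z w * cos (v / eps * Y w)) +
     sin (v * (y / eps)) * \int[m]_w (Z w * sin (v / eps * Y w))))).
Proof.
move=> e0 bk; have [ck [M kM]] := bk; have mk := bcont_measurable bk.
have M0 : 0 <= M by exact: le_trans (kM 0).
have en0 : eps != 0 by rewrite gt_eqF.
have E1 w : Z w * \int[normal_prob (Y w) eps]_y k y =
    \int[mu]_y (Z w * (k y * normal_pdf (Y w) eps y)).
  by have [_ [i ->]] := normal_bcont_integral (Y w) e0 bk; rewrite RintegralZl.
have pk := normal_peak_ge0 eps.
have pE w y : normal_pdf (Y w) eps y = normal_peak eps * expR (- (y - Y w) ^+ 2 / (eps ^+ 2 *+ 2)).
  by rewrite normal_pdfE.
have mjoint : measurable_fun setT (fun z : T * R => Z z.1 * (k z.2 * normal_pdf (Y z.1) eps z.2)).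
  have m1 : measurable_fun setT (fun z : T * R => Z z.1) := measurableT_comp mZ measurable_fst.
  have m2 : measurable_fun setT (fun z : T * R => Y z.1) := measurableT_comp mY measurable_fst.
  have m3 : measurable_fun setT (fun z : T * R => k z.2) := measurableT_comp mk measurable_snd.
  under eq_fun do rewrite pE.
  apply: measurable_funM => //; apply: measurable_funM => //; apply: measurable_funM => //.
  apply: measurableT_comp; first exact: measurable_expR.
  apply: measurable_funM => //; apply: measurableT_comp => //; apply: measurable_funX.
  by apply: measurable_funB => //; exact: measurable_snd.
have [|||mF EF] := @Rfubini R _ _ T _ m mu (fun w y => Z w * (k y * normal_pdf (Y w) eps y))
  (fun w => M * `|Z w|) mjoint.
- by apply: integrable_scaleR; have := integrable_norm iZ.
- move=> w; have i := integrable_normal_pdf (Y w) eps.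
  have ip := integral_normal_pdf (Y w) eps.
  apply: (@le_trans _ _ (\int[mu]_y ((M * `|Z w|) * normal_pdf (Y w) eps y)%:E)%E).
    apply: ge0_le_integral => //.
    + apply/measurable_EFinP; apply: measurableT_comp => //.
      exact: (measurableT_comp mjoint (pair1_measurable w)).
    + apply/measurable_EFinP; apply: measurable_funM => //; exact: measurable_normal_pdf.
    + move=> y _; rewrite lee_fin !normrM (ger0_norm (normal_pdf_ge0 _ _ _)) mulrA.
      by rewrite ler_wpM2r ?normal_pdf_ge0// mulrC ler_wpM2r.
  under eq_integral do rewrite EFinM.
  by rewrite integralZl// ip mule1.
- move=> y; apply: (bounded_mul_integrable (M := M * normal_peak eps)).
    under eq_fun do rewrite pE.
    apply: measurable_funM => //; apply: measurable_funM => //.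
    apply: measurableT_comp; first exact: measurable_expR.
    apply: measurable_funM => //; apply: measurableT_comp => //; apply: measurable_funX.
    exact: measurable_funB.
  move=> w; rewrite normrM (ger0_norm (normal_pdf_ge0 _ _ _)).
  by apply: ler_pM => //; [exact: normal_pdf_ge0|exact: normal_pdf_ub].
split; first by under eq_fun do rewrite E1.
under eq_Rintegral do rewrite E1.
rewrite EF; apply: eq_Rintegral => y _.
have mcos (c : R) : measurable_fun setT (fun w => cos (c * Y w)).
  by apply: (measurableT_comp (bcont_measurable (bcont_cos c))).
have msin (c : R) : measurable_fun setT (fun w => sin (c * Y w)).
  by apply: (measurableT_comp (bcont_measurable (bcont_sin c))).
have icos (c : R) := bounded_mul_integrable (mcos c) (fun w => cos_max (c * Y w)).
have isin (c : R) := bounded_mul_integrable (msin c) (fun w => sin_max (c * Y w)).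
have icv (c : R) : gauss.-integrable setT (EFin \o (fun v : R => cos (v * c))).
  have [h _] := normal_bcont_integral 0 ltr01 (bcont_cos c).
  by under eq_fun do rewrite mulrC.
have mcv (w : T) : measurable_fun setT (fun v : R => cos (v * ((y - Y w) / eps))).
  by case/integrableP : (icv ((y - Y w) / eps)) => /measurable_EFinP.
have Ew w : Z w * (k y * normal_pdf (Y w) eps y) =
   (k y * normal_peak eps) * \int[gauss]_v (Z w * cos (v * ((y - Y w) / eps))).
  by rewrite normal_pdf_fourier// RintegralZl//; ring.
under eq_Rintegral do rewrite Ew.
have mj2 : measurable_fun setT (fun z : T * R => Z z.1 * cos (z.2 * ((y - Y z.1) / eps))).
  have m1 : measurable_fun setT (fun z : T * R => Z z.1) := measurableT_comp mZ measurable_fst.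
  have m2 : measurable_fun setT (fun z : T * R => Y z.1) := measurableT_comp mY measurable_fst.
  apply: measurable_funM => //; apply: measurableT_comp.
    exact: continuous_measurable_fun (@continuous_cos R).
  apply: measurable_funM; first exact: measurable_snd.
  by apply: measurable_funM => //; exact: measurable_funB.
have iv (v : R) : m.-integrable setT (EFin \o (fun w => Z w * cos (v * ((y - Y w) / eps)))).
  apply: (bounded_mul_integrable (M := 1)); last by move=> w; exact: cos_max.
  apply: measurableT_comp; first exact: continuous_measurable_fun (@continuous_cos R).
  by apply: measurable_funM => //; apply: measurable_funM => //; exact: measurable_funB.
have [|mF2 EF2] := @Rfubini R _ _ T _ m gauss
    (fun w v => Z w * cos (v * ((y - Y w) / eps))) (fun w => `|Z w|) mj2
    (integrable_norm iZ) _ iv.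
  move=> w; apply: (@le_trans _ _ (\int[gauss]_v (`|Z w|)%:E)%E).
    apply: ge0_le_integral => //.
    - apply/measurable_EFinP; apply: measurableT_comp => //.
      by apply: measurable_funM => //; exact: mcv.
    - by move=> v _; rewrite lee_fin normrM ler_piMr// cos_max.
  rewrite integral_cst//= [X in (_ * X)%E](_ : _ = 1%E) ?mule1//.
  exact: (@probability_setT _ _ _ gauss).
rewrite RintegralZl//; last first.
  have E2 w : \int[gauss]_v (Z w * cos (v * ((y - Y w) / eps))) =
      Z w * \int[gauss]_v cos (v * ((y - Y w) / eps)).
    exact: (RintegralZl (Z w) measurableT (icv ((y - Y w) / eps))).
  apply: (le_integrable_abs mF2 (integrable_norm iZ)) => w; rewrite E2 normrM ler_piMr//.
  under eq_Rintegral do rewrite mulrC.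
  by rewrite (normal_char ltr01 _).1 ger0_norm ?expR_ge0// expR_le1 oppr_le0 divr_ge0// mulr_ge0// ?sqr_ge0.
rewrite EF2 mulrA; congr (_ * _); apply: eq_Rintegral => v _.
have -> : \int[m]_w (Z w * cos (v * ((y - Y w) / eps))) =
   \int[m]_w (cos (v * (y / eps)) * (Z w * cos (v / eps * Y w)) +
              sin (v * (y / eps)) * (Z w * sin (v / eps * Y w))).
  apply: eq_Rintegral => w _.
  have -> : v * ((y - Y w) / eps) = v * (y / eps) - v / eps * Y w by field; rewrite en0.
  by rewrite cosB; ring.
have ic := icos (v / eps); have is_ := isin (v / eps).
have ic' := integrable_scaleR (cos (v * (y / eps))) ic.
have is' := integrable_scaleR (sin (v * (y / eps))) is_.
have -> := RintegralD measurableT ic' is'.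
by rewrite (RintegralZl _ measurableT ic) (RintegralZl _ measurableT is_).
Qed.
End one_space.

(** The weights Z1 and Z2 need not be positive, so this compares signed and unnormalised
    laws; mollify k and let the width tend to 0. *)
Lemma char_unique d1 (T1 : measurableType d1) (m1 : {sigma_finite_measure set T1 -> \bar R})
    (Z1 Y1 : T1 -> R) d2 (T2 : measurableType d2)
    (m2 : {sigma_finite_measure set T2 -> \bar R}) (Z2 Y2 : T2 -> R) :
  m1.-integrable setT (EFin \o Z1) -> measurable_fun setT Y1 ->
  m2.-integrable setT (EFin \o Z2) -> measurable_fun setT Y2 ->
  (forall u, \int[m1]_w (Z1 w * cos (u * Y1 w)) = \int[m2]_w (Z2 w * cos (u * Y2 w))) ->
  (forall u, \int[m1]_w (Z1 w * sin (u * Y1 w)) = \int[m2]_w (Z2 w * sin (u * Y2 w))) ->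
  forall k, bcont k ->
    \int[m1]_w (Z1 w * k (Y1 w)) = \int[m2]_w (Z2 w * k (Y2 w)).
Proof.
move=> iZ1 mY1 iZ2 mY2 Ec Es k bk; have [ck [M kM]] := bk.
have n0 n : (0 : R) < n.+1%:R^-1 by rewrite invr_gt0.
have lim dd (T : measurableType dd) (m : {sigma_finite_measure set T -> \bar R})
    (Z Y : T -> R) : m.-integrable setT (EFin \o Z) -> measurable_fun setT Y ->
    \int[m]_w (Z w * \int[normal_prob (Y w) n.+1%:R^-1]_y k y) @[n --> \oo] -->
    \int[m]_w (Z w * k (Y w)).
  move=> iZ mY; apply: (@Rdominated_cvg _ _ _ m _ _ (fun w => M * `|Z w|) _ _ _ _).2.
  - by move=> n; exact: (mollify_fourier iZ mY (n0 n) bk).1.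
  - by move=> w; apply: cvgMr; exact: mollify_cvg.
  - exact: integrable_scaleR (integrable_norm iZ).
  - move=> n w; rewrite normrM mulrC ler_wpM2r//.
    have [i _] := normal_bcont_integral (Y w) (n0 n) bk.
    apply: le_trans (le_normr_Rintegral measurableT i) _.
    rewrite -[leRHS](normal_int_cst (Y w) n.+1%:R^-1).
    by apply: le_Rintegral => //; [exact: (integrable_norm i)|exact: normal_cst_integrable].
have := lim _ _ _ _ _ iZ1 mY1; have := lim _ _ _ _ _ iZ2 mY2.
have -> : (fun n => \int[m2]_w (Z2 w * \int[normal_prob (Y2 w) n.+1%:R^-1]_y k y)) =
   (fun n => \int[m1]_w (Z1 w * \int[normal_prob (Y1 w) n.+1%:R^-1]_y k y)).
  apply/funext => n; rewrite (mollify_fourier iZ1 mY1 (n0 n) bk).2.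
  rewrite (mollify_fourier iZ2 mY2 (n0 n) bk).2.
  apply: eq_Rintegral => y _; congr (_ * (_ * _)).
  by apply: eq_Rintegral => v _; rewrite Ec Es.
by move=> h1 h2; exact: cvg_unique h2 h1.
Qed.

(** If Z exp(i V) is orthogonal to every exp(i s Y), then it is orthogonal to every
    bounded continuous function of Y, in particular to exp(i phi(Y)).  Replacing s by -
    s separates the cosine and the sine parts, so that uniqueness applies to real
    weights. *)
Lemma phase_swap d (T : measurableType d) (P : {sigma_finite_measure set T -> \bar R})
    (Z V Y : T -> R) (phi : R -> R) :
  P.-integrable setT (EFin \o Z) -> measurable_fun setT V -> measurable_fun setT Y ->
  continuous phi ->
  (forall s, \int[P]_w (Z w * cos (V w + s * Y w)) = 0 /\
             \int[P]_w (Z w * sin (V w + s * Y w)) = 0) ->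
  \int[P]_w (Z w * cos (V w + phi (Y w))) = 0 /\
  \int[P]_w (Z w * sin (V w + phi (Y w))) = 0.
Proof.
move=> iZ mV mY cphi H0.
have mZ : measurable_fun setT Z by case/integrableP : iZ => /measurable_EFinP.
have msin f : measurable_fun setT f -> measurable_fun setT (fun w : T => sin (f w) : R).
  by move=> mf; apply: measurableT_comp mf; exact: continuous_measurable_fun (@continuous_sin R).
have mcos f : measurable_fun setT f -> measurable_fun setT (fun w : T => cos (f w) : R).
  by move=> mf; apply: measurableT_comp mf; exact: continuous_measurable_fun (@continuous_cos R).
have bmi := bounded_mul_integrable iZ.
have iZc := bmi _ _ (mcos _ mV) (fun w => cos_max (V w)).
have iZs := bmi _ _ (msin _ mV) (fun w => sin_max (V w)).
have mk k : bcont k -> measurable_fun setT (fun w => k (Y w)).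
  by move=> bk; exact: measurableT_comp (bcont_measurable bk) mY.
pose A k := \int[P]_w (Z w * cos (V w) * k (Y w)).
pose B k := \int[P]_w (Z w * sin (V w) * k (Y w)).
have bcosf (f : R -> R) : continuous f -> bcont (fun x => cos (f x)).
  move=> cf; split; last by exists 1 => x; exact: cos_max.
  by move=> x; apply: continuous_comp; [exact: cf|exact: continuous_cos].
have bsinf (f : R -> R) : continuous f -> bcont (fun x => sin (f x)).
  move=> cf; split; last by exists 1 => x; exact: sin_max.
  by move=> x; apply: continuous_comp; [exact: cf|exact: continuous_sin].
have split f : continuous f ->
   \int[P]_w (Z w * cos (V w + f (Y w))) = A (fun x => cos (f x)) - B (fun x => sin (f x)) /\
   \int[P]_w (Z w * sin (V w + f (Y w))) = B (fun x => cos (f x)) + A (fun x => sin (f x)).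
  move=> cf; have bk := bcosf _ cf; have bl := bsinf _ cf.
  have [_ [M kM]] := bk; have [_ [L lL]] := bl.
  have i1 := bounded_mul_integrable iZc (mk _ bk) (fun w => kM (Y w)).
  have i2 := bounded_mul_integrable iZs (mk _ bl) (fun w => lL (Y w)).
  have i3 := bounded_mul_integrable iZs (mk _ bk) (fun w => kM (Y w)).
  have i4 := bounded_mul_integrable iZc (mk _ bl) (fun w => lL (Y w)).
  split.
    rewrite /A /B -(RintegralB measurableT i1 i2); apply: eq_Rintegral => w _.
    by rewrite cosD; ring.
  rewrite /A /B -(RintegralD measurableT i3 i4); apply: eq_Rintegral => w _.
  by rewrite sinD; ring.
have four u : [/\ A (fun x => cos (u * x)) = 0, B (fun x => cos (u * x)) = 0,
                  A (fun x => sin (u * x)) = 0 & B (fun x => sin (u * x)) = 0].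
  have [c1 s1] := H0 u; have [c2 s2] := H0 (- u).
  have clin (s : R) : continuous (fun x : R => s * x).
    by move=> x; apply: cvgMr; exact: cvg_id.
  have [e1 e2] := split _ (clin u); have [e3 e4] := split _ (clin (- u)).
  have fc : (fun x => cos (- u * x)) = (fun x : R => cos (u * x)).
    by apply/funext => x; rewrite mulNr cosN.
  have fs : (fun x => sin (- u * x)) = (fun x : R => -1 * sin (u * x)).
    by apply/funext => x; rewrite mulN1r mulNr sinN.
  have AN : A (fun x => -1 * sin (u * x)) = - A (fun x => sin (u * x)).
    rewrite /A -[RHS]mulN1r -(RintegralZl (-1) measurableT).
      by apply: eq_Rintegral => w _; ring.
    exact: (bounded_mul_integrable iZc (mk _ (bcont_sin u)) (fun w => sin_max _)).
  have BN : B (fun x => -1 * sin (u * x)) = - B (fun x => sin (u * x)).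
    rewrite /B -[RHS]mulN1r -(RintegralZl (-1) measurableT).
      by apply: eq_Rintegral => w _; ring.
    exact: (bounded_mul_integrable iZs (mk _ (bcont_sin u)) (fun w => sin_max _)).
  rewrite c1 in e1; rewrite s1 in e2; rewrite c2 fc fs BN in e3; rewrite s2 fc fs AN in e4.
  by split; lra.
have i0 : P.-integrable setT (EFin \o (fun _ : T => 0 : R)) by exact: integrable0.
have z0 (f : T -> R) : \int[P]_w (0 * f w) = 0.
  by under eq_Rintegral do rewrite mul0r; by rewrite /Rintegral integral0.
have Ak k : bcont k -> A k = 0.
  move=> bk; rewrite /A (char_unique iZc mY i0 mY _ _ bk) ?z0// => u.
    by rewrite z0; have [] := four u.
  by rewrite z0; have [] := four u.
have Bk k : bcont k -> B k = 0.
  move=> bk; rewrite /B (char_unique iZs mY i0 mY _ _ bk) ?z0// => u.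
    by rewrite z0; have [] := four u.
  by rewrite z0; have [] := four u.
have [-> ->] := split _ cphi; have bk := bcosf _ cphi; have bl := bsinf _ cphi.
by rewrite !Ak// !Bk// subrr addr0.
Qed.
End mollify.

(** * Gaussian quadratic forms *)

Section gaussian_family.
Context (R : realType) d (T : measurableType d) (P : probability T R).
Notation gauss := (normal_prob (0 : R) 1).
Notation expo := (@expo R).

(** Independence of standard normal variables, encoded by the joint characteristic
    function. *)
Definition gaussian_family m (G : 'I_m -> T -> R) :=
  [/\ forall i, measurable_fun setT (G i),
      forall i, P.-integrable setT (EFin \o (fun w => G i w ^+ 2)) &
      forall u : 'I_m -> R,
        \int[P]_w cos (\sum_i u i * G i w) = expR (- ((\sum_i u i ^+ 2) / 2)) /\
        \int[P]_w sin (\sum_i u i * G i w) = 0].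

Context m (G : 'I_m -> T -> R).
Hypothesis gG : gaussian_family G.

Let mG : forall i, measurable_fun setT (G i). Proof. by case: gG. Qed.

Let mphase (phi : 'I_m -> R -> R) : (forall i, continuous (phi i)) ->
  measurable_fun setT (fun w => \sum_i phi i (G i w)).
Proof.
move=> cphi; apply: measurable_sum => i.
exact: measurableT_comp (continuous_measurable_fun (cphi i)) (mG i).
Qed.

(** Linear phases are turned into arbitrary ones one index at a time: this is how
    independence of G_j from a nonlinear function of the other variables is obtained
    without product measures. *)
Lemma phases_swap (Z : T -> R) (j : 'I_m) : P.-integrable setT (EFin \o Z) ->
  (forall u : 'I_m -> R, u j = 0 ->
     \int[P]_w (Z w * cos (\sum_i u i * G i w)) = 0 /\
     \int[P]_w (Z w * sin (\sum_i u i * G i w)) = 0) ->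
  forall phi : 'I_m -> R -> R, (forall i, continuous (phi i)) -> phi j = cst 0 ->
     \int[P]_w (Z w * cos (\sum_i phi i (G i w))) = 0 /\
     \int[P]_w (Z w * sin (\sum_i phi i (G i w))) = 0.
Proof.
move=> iZ H0.
have key n : forall phi : 'I_m -> R -> R, (forall i, continuous (phi i)) -> phi j = cst 0 ->
     (forall i : 'I_m, (n <= i)%N -> exists s, phi i = *%R s) ->
     \int[P]_w (Z w * cos (\sum_i phi i (G i w))) = 0 /\
     \int[P]_w (Z w * sin (\sum_i phi i (G i w))) = 0.
  elim: n => [|n IH] phi cphi phij lphi.
    have [s hs] : {s : 'I_m -> R & forall i, phi i = *%R (s i)}.
      by apply: (@choice _ _ (fun i s => phi i = *%R s)) => i; exact: lphi.
    have sj : s j = 0 by have := hs j; rewrite phij => /(congr1 (@^~ 1)); rewrite mulr1.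
    have E w : \sum_i phi i (G i w) = \sum_i s i * G i w by apply: eq_bigr => i _; rewrite hs.
    by have [h1 h2] := H0 s sj; split; under eq_Rintegral do rewrite E.
  have [nm|nm] := ltnP n m; last first.
    by apply: IH => // i ni; have := leq_ltn_trans ni (ltn_ord i); rewrite ltnNge nm.
  pose i0 := Ordinal nm.
  have [ij|ij] := eqVneq i0 j.
    apply: IH => // i ni; have [ii|ii] := eqVneq i i0.
      by exists 0; rewrite ii ij phij; apply/funext => x; rewrite mul0r.
    by apply: lphi; rewrite ltn_neqAle ni andbT; apply: contraNneq ii => ni0; apply/eqP/val_inj.
  have E w : \sum_i phi i (G i w) = \sum_(i | i != i0) phi i (G i w) + phi i0 (G i0 w).
    by rewrite (bigD1 i0)//= addrC.
  have := @phase_swap _ _ _ P Z (fun w => \sum_(i | i != i0) phi i (G i w)) (G i0) (phi i0)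
    iZ _ (mG i0) (cphi i0) _.
  have -> : (fun w => Z w * cos (\sum_i phi i (G i w))) =
     (fun w => Z w * cos (\sum_(i | i != i0) phi i (G i w) + phi i0 (G i0 w))).
    by apply/funext => w; rewrite E.
  have -> : (fun w => Z w * sin (\sum_i phi i (G i w))) =
     (fun w => Z w * sin (\sum_(i | i != i0) phi i (G i w) + phi i0 (G i0 w))).
    by apply/funext => w; rewrite E.
  apply.
    under eq_fun do rewrite big_mkcond.
    apply: measurable_sum => i; case: (i != i0) => //.
    exact: measurableT_comp (continuous_measurable_fun (cphi i)) (mG i).
  move=> s; pose phi' i := if i == i0 then *%R s else phi i.
  have E' w : \sum_(i | i != i0) phi i (G i w) + s * G i0 w = \sum_i phi' i (G i w).
    rewrite [RHS](bigD1 i0)//= addrC /phi' eqxx; congr (_ + _).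
    by apply: eq_bigr => i /negbTE ->.
  have [|||h1 h2] := IH phi'.
  - move=> i; rewrite /phi'; case: ifP => // _ x; apply: cvgMr; exact: cvg_id.
  - by rewrite /phi' eq_sym (negbTE ij).
  - move=> i ni; rewrite /phi'; case: ifPn => [_|ii]; first by exists s.
    by apply: lphi; rewrite ltn_neqAle ni andbT; apply: contraNneq ii => ni0; apply/eqP/val_inj.
  by split; under eq_Rintegral do rewrite E'.
by move=> phi cphi phij; apply: (key m) => // i; rewrite leqNgt ltn_ord.
Qed.

Let mcosf (f : T -> R) : measurable_fun setT f -> measurable_fun setT (fun w : T => cos (f w) : R).
Proof. by move=> mf; apply: measurableT_comp mf; exact: continuous_measurable_fun (@continuous_cos R). Qed.
Let msinf (f : T -> R) : measurable_fun setT f -> measurable_fun setT (fun w : T => sin (f w) : R).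
Proof. by move=> mf; apply: measurableT_comp mf; exact: continuous_measurable_fun (@continuous_sin R). Qed.

Let Pfin : (P setT < +oo)%E. Proof. by rewrite probability_setT ltry. Qed.

Let ibd (f : T -> R) (M : R) : measurable_fun setT f -> (forall w, `|f w| <= M) ->
  P.-integrable setT (EFin \o f).
Proof. exact: bounded_integrable. Qed.

Lemma gaussian_cos_sin (j : 'I_m) (v : R) (u : 'I_m -> R) : u j = 0 ->
  [/\ \int[P]_w ((cos (v * G j w) - expR (- (v ^+ 2 / 2))) * cos (\sum_i u i * G i w)) = 0,
      \int[P]_w ((cos (v * G j w) - expR (- (v ^+ 2 / 2))) * sin (\sum_i u i * G i w)) = 0,
      \int[P]_w (sin (v * G j w) * cos (\sum_i u i * G i w)) = 0 &
      \int[P]_w (sin (v * G j w) * sin (\sum_i u i * G i w)) = 0].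
Proof.
move=> uj; pose U w := \sum_i u i * G i w.
pose e := expR (- (v ^+ 2 / 2)); pose n2 := \sum_i u i ^+ 2.
pose up i := u i + (if i == j then v else 0); pose um i := u i - (if i == j then v else 0).
have mU : measurable_fun setT U.
  by apply: measurable_sum => i; exact: measurable_funM.
have Up w : \sum_i up i * G i w = U w + v * G j w.
  rewrite /U; transitivity (\sum_i (u i * G i w + (if i == j then v * G j w else 0))).
    by apply: eq_bigr => i _; rewrite /up; case: eqP => [->|_]; ring.
  by rewrite big_split/= -big_mkcond big_pred1_eq.
have Um w : \sum_i um i * G i w = U w - v * G j w.
  rewrite /U; transitivity (\sum_i (u i * G i w + (if i == j then - (v * G j w) else 0))).
    by apply: eq_bigr => i _; rewrite /um; case: eqP => [->|_]; ring.
  by rewrite big_split/= -big_mkcond big_pred1_eq.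
have np : \sum_i up i ^+ 2 = n2 + v ^+ 2.
  transitivity (\sum_i (u i ^+ 2 + (if i == j then v ^+ 2 else 0))).
    by apply: eq_bigr => i _; rewrite /up; case: eqP => [->|_]; rewrite ?uj; ring.
  by rewrite big_split/= -big_mkcond big_pred1_eq.
have nm : \sum_i um i ^+ 2 = n2 + v ^+ 2.
  transitivity (\sum_i (u i ^+ 2 + (if i == j then v ^+ 2 else 0))).
    by apply: eq_bigr => i _; rewrite /um; case: eqP => [->|_]; rewrite ?uj; ring.
  by rewrite big_split/= -big_mkcond big_pred1_eq.
have [_ _ hG] := gG.
have [c0 s0] := hG u; have [cp sp] := hG up; have [cm sm] := hG um.
rewrite np in cp; rewrite nm in cm.
have Ep w : U w + v * G j w = \sum_i up i * G i w by rewrite Up.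
have Em w : U w - v * G j w = \sum_i um i * G i w by rewrite Um.
have mp : measurable_fun setT (fun w => \sum_i up i * G i w).
  by apply: measurable_sum => i; exact: measurable_funM.
have mm : measurable_fun setT (fun w => \sum_i um i * G i w).
  by apply: measurable_sum => i; exact: measurable_funM.
have icp := ibd (mcosf mp) (fun w => cos_max _); have isp := ibd (msinf mp) (fun w => sin_max _).
have icm := ibd (mcosf mm) (fun w => cos_max _); have ism := ibd (msinf mm) (fun w => sin_max _).
have ic := ibd (mcosf mU) (fun w => cos_max _); have is_ := ibd (msinf mU) (fun w => sin_max _).
have comb (a b c : R) (f g h : T -> R) : P.-integrable setT (EFin \o f) ->
    P.-integrable setT (EFin \o g) -> P.-integrable setT (EFin \o h) ->
    \int[P]_w (a * f w + b * g w + c * h w) =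
    a * \int[P]_w f w + b * \int[P]_w g w + c * \int[P]_w h w.
  move=> i1 i2 i3.
  have j1 := integrable_scaleR a i1; have j2 := integrable_scaleR b i2.
  have j3 := integrable_scaleR c i3; have j12 := integrable_addR j1 j2.
  rewrite (RintegralD measurableT j12 j3) (RintegralD measurableT j1 j2).
  by rewrite (RintegralZl _ measurableT i1) (RintegralZl _ measurableT i2) (RintegralZl _ measurableT i3).
have ee : expR (- ((n2 + v ^+ 2) / 2)) = e * expR (- (n2 / 2)).
  by rewrite /e -expRD; congr expR; field.
split.
- transitivity (\int[P]_w (2^-1 * cos (\sum_i up i * G i w) + 2^-1 * cos (\sum_i um i * G i w)
     + (- e) * cos (U w))).
    by apply: eq_Rintegral => w _; rewrite -Ep -Em cosD cosB /U /e; field.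
  by have /= -> := comb 2^-1 2^-1 (- e) _ _ _ icp icm ic; rewrite cp cm c0 ee; field.
- transitivity (\int[P]_w (2^-1 * sin (\sum_i up i * G i w) + 2^-1 * sin (\sum_i um i * G i w)
     + (- e) * sin (U w))).
    by apply: eq_Rintegral => w _; rewrite -Ep -Em sinD sinB /U /e; field.
  by have /= -> := comb 2^-1 2^-1 (- e) _ _ _ isp ism is_; rewrite sp sm s0; field.
- transitivity (\int[P]_w (2^-1 * sin (\sum_i up i * G i w) + (- 2^-1) * sin (\sum_i um i * G i w)
     + 0 * cos (U w))).
    by apply: eq_Rintegral => w _; rewrite -Ep -Em sinD sinB /U; field.
  by have /= -> := comb 2^-1 (- 2^-1) 0 _ _ _ isp ism ic; rewrite sp sm; field.
- transitivity (\int[P]_w ((- 2^-1) * cos (\sum_i up i * G i w) + 2^-1 * cos (\sum_i um i * G i w)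
     + 0 * cos (U w))).
    by apply: eq_Rintegral => w _; rewrite -Ep -Em cosD cosB /U; field.
  by have /= -> := comb (- 2^-1) 2^-1 0 _ _ _ icp icm ic; rewrite cp cm; field.
Qed.

(** Apply [phases_swap] to Z = cos(v G_j) - exp(-v^2/2) and Z = sin(v G_j), then
    recognise in v the characteristic function of a normal variable. *)
Lemma gaussian_phase_indep (j : 'I_m) (phi : 'I_m -> R -> R) k :
  (forall i, continuous (phi i)) -> phi j = cst 0 -> bcont k ->
  \int[P]_w (cos (\sum_i phi i (G i w)) * k (G j w)) =
    \int[gauss]_x ((\int[P]_w cos (\sum_i phi i (G i w))) * k x) /\
  \int[P]_w (sin (\sum_i phi i (G i w)) * k (G j w)) =
    \int[gauss]_x ((\int[P]_w sin (\sum_i phi i (G i w))) * k x).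
Proof.
move=> cphi phij bk.
have mV := mphase cphi; have mc := mcosf mV; have ms := msinf mV.
have ic := ibd mc (fun w => cos_max _); have is_ := ibd ms (fun w => sin_max _).
have mcj v : measurable_fun setT (fun w => cos (v * G j w)) by apply: mcosf; exact: measurable_funM.
have msj v : measurable_fun setT (fun w => sin (v * G j w)) by apply: msinf; exact: measurable_funM.
have key v := @phases_swap (fun w => cos (v * G j w) - expR (- (v ^+ 2 / 2))) j.
have keys v := @phases_swap (fun w => sin (v * G j w)) j.
have iZ v : P.-integrable setT (EFin \o (fun w => cos (v * G j w) - expR (- (v ^+ 2 / 2)))).
  apply: integrable_subR; first exact: ibd (mcj v) (fun w => cos_max _).
  by apply: (ibd (M := `|expR (- (v ^+ 2 / 2))|)).
have iZs v : P.-integrable setT (EFin \o (fun w => sin (v * G j w))).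
  exact: ibd (msj v) (fun w => sin_max _).
have K v : [/\ \int[P]_w (cos (\sum_i phi i (G i w)) * cos (v * G j w)) =
                 expR (- (v ^+ 2 / 2)) * \int[P]_w cos (\sum_i phi i (G i w)),
               \int[P]_w (sin (\sum_i phi i (G i w)) * cos (v * G j w)) =
                 expR (- (v ^+ 2 / 2)) * \int[P]_w sin (\sum_i phi i (G i w)),
               \int[P]_w (cos (\sum_i phi i (G i w)) * sin (v * G j w)) = 0 &
               \int[P]_w (sin (\sum_i phi i (G i w)) * sin (v * G j w)) = 0].
  have [|h1 h2] := key v (iZ v) _ phi cphi phij.
    by move=> u uj; have [] := gaussian_cos_sin v uj.
  have [|h3 h4] := keys v (iZs v) _ phi cphi phij.
    by move=> u uj; have [] := gaussian_cos_sin v uj.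
  have icc := bounded_mul_integrable ic (mcj v) (fun w => cos_max _).
  have isc := bounded_mul_integrable is_ (mcj v) (fun w => cos_max _).
  split.
  - apply/eqP; rewrite -subr_eq0 -(RintegralZl _ measurableT ic).
    rewrite -(RintegralB measurableT icc (integrable_scaleR _ ic)); apply/eqP.
    by rewrite -[RHS]h1; apply: eq_Rintegral => w _; ring.
  - apply/eqP; rewrite -subr_eq0 -(RintegralZl _ measurableT is_).
    rewrite -(RintegralB measurableT isc (integrable_scaleR _ is_)); apply/eqP.
    by rewrite -[RHS]h2; apply: eq_Rintegral => w _; ring.
  - by rewrite -[RHS]h3; apply: eq_Rintegral => w _; ring.
  - by rewrite -[RHS]h4; apply: eq_Rintegral => w _; ring.
have NC (c v : R) : \int[gauss]_x (c * cos (v * x)) = c * expR (- (v ^+ 2 / 2)) /\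
      \int[gauss]_x (c * sin (v * x)) = 0.
  have [_ [_ _]] := normal_bcont_integral 0 ltr01 (bcont_cos v).
  have [i1 _] := normal_bcont_integral 0 ltr01 (bcont_cos v).
  have [i2 _] := normal_bcont_integral 0 ltr01 (bcont_sin v).
  have [e1 e2] := normal_char (ltr01 : (0:R) < 1) v.
  rewrite (RintegralZl c measurableT i1) (RintegralZl c measurableT i2) e1 e2.
  by rewrite mulr0 expr1n mul1r.
have mid : measurable_fun setT (fun x : R => x) by exact: measurable_id.
split.
- apply: (@char_unique R _ _ P _ _ _ _ gauss _ (fun x => x) ic (mG j) _ mid _ _ k bk).
  + exact: normal_cst_integrable.
  + by move=> u; have [-> _ _ _] := K u; rewrite (NC _ u).1 mulrC.
  + by move=> u; have [_ _ -> _] := K u; rewrite (NC _ u).2.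
- apply: (@char_unique R _ _ P _ _ _ _ gauss _ (fun x => x) is_ (mG j) _ mid _ _ k bk).
  + exact: normal_cst_integrable.
  + by move=> u; have [_ -> _ _] := K u; rewrite (NC _ u).1 mulrC.
  + by move=> u; have [_ _ _ ->] := K u; rewrite (NC _ u).2.
Qed.

Lemma expavg_fubini (Y : T -> R) (s : R) k : measurable_fun setT Y -> bcont k ->
  (P \x expo)%E.-integrable setT (EFin \o (fun z : T * R => k (Y z.1 + 2 * s * z.2))) /\
  \int[(P \x expo)%E]_z k (Y z.1 + 2 * s * z.2) = \int[P]_w expavg s k (Y w).
Proof.
move=> mY bk; have [ck [M kM]] := bk.
have mk : measurable_fun setT (fun z : T * R => k (Y z.1 + 2 * s * z.2)).
  apply: measurableT_comp (bcont_measurable bk) _; apply: measurable_funD.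
    exact: measurableT_comp mY measurable_fst.
  by apply: measurable_funM => //; exact: measurable_snd.
have tot : (P \x expo)%E setT = 1%E.
  exact: (@probability_setT _ _ _ (P \x expo)%E).
have i : (P \x expo)%E.-integrable setT (EFin \o (fun z : T * R => k (Y z.1 + 2 * s * z.2))).
  apply: (bounded_integrable (M := M)) => //; first by rewrite [X in (X < _)%E]tot ltry.
split => //.
rewrite /Rintegral; congr fine.
have := integral12_prod_meas1 i => /= <-; apply: eq_integral => w _.
rewrite fineK//; have := bcont_expo (bcont_affine (Y w) (2 * s) bk).
exact: integrable_fin_num.
Qed.

(** With J = E[exp(i s N^2)] this is (1 - 2 i s) E[N^2 exp(i s N^2)] = J, integration by
    parts for x exp(i s x^2). *)
Lemma normal_sqr_phase (s : R) :
  \int[gauss]_x (x ^+ 2 * cos (s * x ^+ 2)) =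
    \int[gauss]_x cos (s * x ^+ 2) - 2 * s * \int[gauss]_x (x ^+ 2 * sin (s * x ^+ 2)) /\
  \int[gauss]_x (x ^+ 2 * sin (s * x ^+ 2)) =
    \int[gauss]_x sin (s * x ^+ 2) + 2 * s * \int[gauss]_x (x ^+ 2 * cos (s * x ^+ 2)).
Proof.
have dc (x : R) : is_derive x 1 (fun x : R => x * cos (s * x ^+ 2))
    (cos (s * x ^+ 2) - 2 * s * (x ^+ 2 * sin (s * x ^+ 2))).
  by apply: is_derive_eq; rewrite /GRing.scale/=; ring.
have ds (x : R) : is_derive x 1 (fun x : R => x * sin (s * x ^+ 2))
    (sin (s * x ^+ 2) + 2 * s * (x ^+ 2 * cos (s * x ^+ 2))).
  by apply: is_derive_eq; rewrite /GRing.scale/=; ring.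
have csq : continuous (fun x : R => s * x ^+ 2).
  by move=> x; apply: cvgMr; exact: exprn_continuous.
have cc : continuous (fun x : R => cos (s * x ^+ 2)).
  by move=> x; apply: continuous_comp; [exact: csq|exact: continuous_cos].
have cs : continuous (fun x : R => sin (s * x ^+ 2)).
  by move=> x; apply: continuous_comp; [exact: csq|exact: continuous_sin].
have cqc : continuous (fun x : R => x ^+ 2 * cos (s * x ^+ 2)).
  by move=> x; apply: cvgM; [exact: exprn_continuous|exact: cc].
have cqs : continuous (fun x : R => x ^+ 2 * sin (s * x ^+ 2)).
  by move=> x; apply: cvgM; [exact: exprn_continuous|exact: cs].
have poly (f : R -> R) : continuous f -> (forall x, `|f x| <= 1 + x ^+ 2) ->
    gauss.-integrable setT (EFin \o f).
  move=> cf fb; apply: (@normal_poly_integrable _ 0 1 ltr01 f 1 _ _).1.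
    exact: continuous_measurable_fun.
  by move=> x; rewrite mul1r subr0.
have icc := poly _ cc; have ics := poly _ cs; have iqc := poly _ cqc; have iqs := poly _ cqs.
have b1 (u x : R) : `|u| <= 1 -> `|u| <= 1 + x ^+ 2.
  by move=> h; rewrite (le_trans h)// lerDl sqr_ge0.
have b2 (u x : R) : `|u| <= 1 -> `|x ^+ 2 * u| <= 1 + x ^+ 2.
  move=> h; rewrite normrM ger0_norm ?sqr_ge0//.
  by apply: (@le_trans _ _ (x ^+ 2)); [rewrite ler_piMr// sqr_ge0|rewrite lerDr].
have b3 (u v x : R) : `|u| <= 1 -> `|v| <= 1 ->
   `|u + 2 * s * (x ^+ 2 * v)| <= (1 + 2 * `|s|) * (1 + (x - 0) ^+ 2).
  move=> h1 h2; rewrite subr0 (le_trans (ler_normD _ _))//.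
  rewrite [X in _ + X]normrM normrM (@ger0_norm _ 2)//.
  have := b1 u x h1; have := b2 v x h2; have := normr_ge0 s; nra.
have b4 (u x : R) : `|u| <= 1 -> `|(x - 0) * (x * u)| <= (1 + 2 * `|s|) * (1 + (x - 0) ^+ 2).
  move=> h; rewrite subr0 mulrA -expr2; have := b2 u x h; have := normr_ge0 s.
  have := sqr_ge0 x; nra.
have {}icc := icc (fun x => b1 _ x (cos_max _)).
have {}ics := ics (fun x => b1 _ x (sin_max _)).
have {}iqc := iqc (fun x => b2 _ x (cos_max _)).
have {}iqs := iqs (fun x => b2 _ x (sin_max _)).
have r1 : \int[gauss]_x (x ^+ 2 * cos (s * x ^+ 2)) =
    \int[gauss]_x (cos (s * x ^+ 2) - 2 * s * (x ^+ 2 * sin (s * x ^+ 2))).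
  have := @normal_stein R 0 1 ltr01 _ _ (1 + 2 * `|s|) dc.
  rewrite expr1n mul1r => <-.
  - by apply: eq_Rintegral => x _; rewrite subr0; ring.
  - by move=> x; apply: cvgB; [exact: cc|apply: cvgMr; exact: cqs].
  - by move=> x; apply: b4; exact: cos_max.
  - move=> x; rewrite -mulrN -mulrN; apply: b3; first exact: cos_max.
    by rewrite normrN; exact: sin_max.
have r2 : \int[gauss]_x (x ^+ 2 * sin (s * x ^+ 2)) =
    \int[gauss]_x (sin (s * x ^+ 2) + 2 * s * (x ^+ 2 * cos (s * x ^+ 2))).
  have := @normal_stein R 0 1 ltr01 _ _ (1 + 2 * `|s|) ds.
  rewrite expr1n mul1r => <-.
  - by apply: eq_Rintegral => x _; rewrite subr0; ring.
  - by move=> x; apply: cvgD; [exact: cs|apply: cvgMr; exact: cqc].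
  - by move=> x; apply: b4; exact: sin_max.
  - by move=> x; apply: b3; [exact: sin_max|exact: cos_max].
split.
  rewrite r1 (RintegralB measurableT icc (integrable_scaleR (2 * s) iqs)).
  by rewrite (RintegralZl _ measurableT iqs).
rewrite r2 (RintegralD measurableT ics (integrable_scaleR (2 * s) iqc)).
by rewrite (RintegralZl _ measurableT iqc).
Qed.

(** Truncate x^2 at level n and pass to the limit by dominated convergence. *)
Lemma gaussian_phase_sqr (j : 'I_m) (phi : 'I_m -> R -> R) k :
  (forall i, continuous (phi i)) -> phi j = cst 0 -> bcont k ->
  (P.-integrable setT (EFin \o (fun w => G j w ^+ 2 * k (G j w))) /\
  \int[P]_w (cos (\sum_i phi i (G i w)) * (G j w ^+ 2 * k (G j w))) =
    (\int[P]_w cos (\sum_i phi i (G i w))) * \int[gauss]_x (x ^+ 2 * k x)) /\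
  \int[P]_w (sin (\sum_i phi i (G i w)) * (G j w ^+ 2 * k (G j w))) =
    (\int[P]_w sin (\sum_i phi i (G i w))) * \int[gauss]_x (x ^+ 2 * k x).
Proof.
move=> cphi phij bk; have [ck [M kM]] := bk.
have [_ iG _] := gG.
have mV := mphase cphi; have mc := mcosf mV; have ms := msinf mV.
pose kn (n : nat) (x : R) := Num.min (x ^+ 2) n%:R * k x.
have min_ge0 (n : nat) (x : R) : 0 <= Num.min (x ^+ 2) n%:R by rewrite le_min sqr_ge0/=.
have kn_le (n : nat) (x : R) : `|Num.min (x ^+ 2) n%:R| <= x ^+ 2.
  by rewrite ger0_norm ?min_ge0// ge_min lexx.
have knM n x : `|kn n x| <= M * x ^+ 2.
  by rewrite normrM mulrC ler_pM// kn_le.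
have bkn n : bcont (kn n).
  split.
    move=> x; apply: cvgM; last exact: ck.
    exact: (continuous_min (@exprn_continuous R 2 x) (cvg_cst _)).
  exists (n%:R * M) => x; rewrite normrM ler_pM//.
  by rewrite ger0_norm ?min_ge0// ge_min lexx orbT.
have knE x : kn n x @[n --> \oo] --> x ^+ 2 * k x.
  apply: cvgMl; apply: cvg_near_cst; near=> n; apply/min_idPl.
  near: n; exact: nbhs_infty_ger.
have m2 : measurable_fun setT (fun w => G j w ^+ 2 * k (G j w)).
  apply: measurable_funM; first exact: measurable_funX.
  exact: measurableT_comp (bcont_measurable bk) (mG j).
have iGk : P.-integrable setT (EFin \o (fun w => G j w ^+ 2 * k (G j w))).
  apply: (le_integrable_abs m2 (integrable_scaleR M (iG j))) => w.
  by rewrite normrM (ger0_norm (sqr_ge0 _)) mulrC ler_wpM2r// sqr_ge0.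
have lim (W : T -> R) : measurable_fun setT W -> (forall w, `|W w| <= 1) ->
    \int[P]_w (W w * kn n (G j w)) @[n --> \oo] --> \int[P]_w (W w * (G j w ^+ 2 * k (G j w))).
  move=> mW W1.
  apply: (Rdominated_cvg (g := fun w => M * G j w ^+ 2) _ _ _ _).2.
  - move=> n; apply: measurable_funM => //.
    exact: measurableT_comp (bcont_measurable (bkn n)) (mG j).
  - by move=> w; apply: cvgMr; exact: knE.
  - exact: integrable_scaleR.
  - move=> n w; rewrite normrM; apply: le_trans (knM n (G j w)).
    by rewrite ler_piMl.
have limN (c : R) : \int[gauss]_x (c * kn n x) @[n --> \oo] --> c * \int[gauss]_x (x ^+ 2 * k x).
  have ix (f : R -> R) K : continuous f -> (forall x, `|f x| <= K * (1 + (x - 0) ^+ 2)) ->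
      gauss.-integrable setT (EFin \o f).
    move=> cf fb; apply: (@normal_poly_integrable _ 0 1 ltr01 f K _ fb).1.
    exact: continuous_measurable_fun.
  have M0 : 0 <= M by exact: le_trans (kM 0).
  have h := @Rdominated_cvg _ (measurableTypeR R) R gauss kn (fun x => x ^+ 2 * k x)
    (fun x => M * x ^+ 2) (fun n => bcont_measurable (bkn n)) knE _ knM.
  have [|i1 l1] := h.
    apply: (ix _ M) => [x|x]; first by apply: cvgMr; exact: exprn_continuous.
    by rewrite subr0 normrM !ger0_norm ?(sqr_ge0 x)//; apply: ler_wpM2l => //; rewrite lerDr.
  have E n : \int[gauss]_x (c * kn n x) = c * \int[gauss]_x kn n x.
    have [i _] := normal_bcont_integral 0 ltr01 (bkn n).
    exact: (RintegralZl c measurableT i).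
  under eq_fun do rewrite E.
  by apply: cvgMr; exact: l1.
split; first split => //.
  have l1 := lim _ mc (fun w => cos_max _).
  have l2 := limN (\int[P]_w cos (\sum_i phi i (G i w))).
  have E : (fun n => \int[P]_w (cos (\sum_i phi i (G i w)) * kn n (G j w))) =
     (fun n => \int[gauss]_x ((\int[P]_w cos (\sum_i phi i (G i w))) * kn n x)).
    by apply/funext => n; exact: (gaussian_phase_indep cphi phij (bkn n)).1.
  by rewrite E in l1; exact: cvg_unique l1 l2.
have l1 := lim _ ms (fun w => sin_max _).
have l2 := limN (\int[P]_w sin (\sum_i phi i (G i w))).
have E : (fun n => \int[P]_w (sin (\sum_i phi i (G i w)) * kn n (G j w))) =
     (fun n => \int[gauss]_x ((\int[P]_w sin (\sum_i phi i (G i w))) * kn n x)).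
    by apply/funext => n; exact: (gaussian_phase_indep cphi phij (bkn n)).2.
  by rewrite E in l1; exact: cvg_unique l1 l2.
Unshelve. all: by end_near. Qed.

Variable alpha : 'I_m -> R.

(** This is (1 - 2 i alpha_j t) E[G_j^2 exp(i t Q)] = E[exp(i t Q)] for Q = sum_i
    alpha_i G_i^2, in real and imaginary parts. *)
Lemma gaussian_quadratic_phase (j : 'I_m) (t : R) :
  \int[P]_w (G j w ^+ 2 * cos (t * \sum_i alpha i * G i w ^+ 2)) =
    \int[P]_w cos (t * \sum_i alpha i * G i w ^+ 2) -
    2 * alpha j * t * \int[P]_w (G j w ^+ 2 * sin (t * \sum_i alpha i * G i w ^+ 2)) /\
  \int[P]_w (G j w ^+ 2 * sin (t * \sum_i alpha i * G i w ^+ 2)) =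
    \int[P]_w sin (t * \sum_i alpha i * G i w ^+ 2) +
    2 * alpha j * t * \int[P]_w (G j w ^+ 2 * cos (t * \sum_i alpha i * G i w ^+ 2)).
Proof.
pose phi (i : 'I_m) := if i == j then cst 0 else (fun x : R => t * alpha i * x ^+ 2).
pose s := t * alpha j; pose V w := \sum_i phi i (G i w).
have phij : phi j = cst 0 by rewrite /phi eqxx.
have cphi i : continuous (phi i).
  rewrite /phi; case: ifP => _ x; first exact: cvg_cst.
  by apply: cvgMr; exact: exprn_continuous.
have E w : t * (\sum_i alpha i * G i w ^+ 2) = V w + s * G j w ^+ 2.
  rewrite /V (bigD1 j)//= [X in _ = X + _](bigD1 j)//= phij /= add0r addrC mulrDr mulr_sumr.
  rewrite /s mulrA; congr (_ + _); apply: eq_bigr => i /negbTE ij.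
  by rewrite /phi ij mulrA.
have csq : continuous (fun x : R => s * x ^+ 2).
  by move=> x; apply: cvgMr; exact: exprn_continuous.
have bc : bcont (fun x : R => cos (s * x ^+ 2)).
  split; last by exists 1 => x; exact: cos_max.
  by move=> x; apply: continuous_comp; [exact: csq|exact: continuous_cos].
have bs : bcont (fun x : R => sin (s * x ^+ 2)).
  split; last by exists 1 => x; exact: sin_max.
  by move=> x; apply: continuous_comp; [exact: csq|exact: continuous_sin].
have mV := mphase cphi; have mc := mcosf mV; have ms := msinf mV.
have mk k : bcont k -> measurable_fun setT (fun w => k (G j w)).
  by move=> bk; exact: measurableT_comp (bcont_measurable bk) (mG j).
have imul (W f : T -> R) : measurable_fun setT W -> (forall w, `|W w| <= 1) ->
   P.-integrable setT (EFin \o f) -> P.-integrable setT (EFin \o (fun w => W w * f w)).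
  move=> mW W1 iff.
  by have := bounded_mul_integrable iff mW W1; under eq_fun do rewrite mulrC.
have [[iqc qcc] qsc] := gaussian_phase_sqr cphi phij bc.
have [[iqs qcs] qss] := gaussian_phase_sqr cphi phij bs.
have ic : P.-integrable setT (EFin \o (fun w => cos (s * G j w ^+ 2))).
  exact: ibd (mk _ bc) (fun w => cos_max _).
have is_ : P.-integrable setT (EFin \o (fun w => sin (s * G j w ^+ 2))).
  exact: ibd (mk _ bs) (fun w => sin_max _).
have N (c : R) k : bcont k -> \int[gauss]_x (c * k x) = c * \int[gauss]_x k x.
  move=> bk; have [i _] := normal_bcont_integral 0 ltr01 bk.
  exact: (RintegralZl c measurableT i).
have [cc sc] := gaussian_phase_indep cphi phij bc.
have [cs ss] := gaussian_phase_indep cphi phij bs.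
rewrite (N _ _ bc) in cc; rewrite (N _ _ bc) in sc; rewrite (N _ _ bs) in cs; rewrite (N _ _ bs) in ss.
have c1 := fun w => cos_max (V w); have s1 := fun w => sin_max (V w).
have [nc ns] := normal_sqr_phase s.
have -> : \int[P]_w (G j w ^+ 2 * cos (t * \sum_i alpha i * G i w ^+ 2)) =
   \int[P]_w cos (V w) * \int[gauss]_x (x ^+ 2 * cos (s * x ^+ 2)) -
   \int[P]_w sin (V w) * \int[gauss]_x (x ^+ 2 * sin (s * x ^+ 2)).
  rewrite -qcc -qss -(RintegralB measurableT (imul _ _ mc c1 iqc) (imul _ _ ms s1 iqs)).
  by apply: eq_Rintegral => w _; rewrite E cosD /V; ring.
have -> : \int[P]_w (G j w ^+ 2 * sin (t * \sum_i alpha i * G i w ^+ 2)) =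
   \int[P]_w sin (V w) * \int[gauss]_x (x ^+ 2 * cos (s * x ^+ 2)) +
   \int[P]_w cos (V w) * \int[gauss]_x (x ^+ 2 * sin (s * x ^+ 2)).
  rewrite -qsc -qcs -(RintegralD measurableT (imul _ _ ms s1 iqc) (imul _ _ mc c1 iqs)).
  by apply: eq_Rintegral => w _; rewrite E sinD /V; ring.
have -> : \int[P]_w cos (t * \sum_i alpha i * G i w ^+ 2) =
   \int[P]_w cos (V w) * \int[gauss]_x (cos (s * x ^+ 2)) -
   \int[P]_w sin (V w) * \int[gauss]_x (sin (s * x ^+ 2)).
  rewrite -cc -ss -(RintegralB measurableT (imul _ _ mc c1 ic) (imul _ _ ms s1 is_)).
  by apply: eq_Rintegral => w _; rewrite E cosD.
have -> : \int[P]_w sin (t * \sum_i alpha i * G i w ^+ 2) =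
   \int[P]_w sin (V w) * \int[gauss]_x (cos (s * x ^+ 2)) +
   \int[P]_w cos (V w) * \int[gauss]_x (sin (s * x ^+ 2)).
  rewrite -sc -cs -(RintegralD measurableT (imul _ _ ms s1 ic) (imul _ _ mc c1 is_)).
  by apply: eq_Rintegral => w _; rewrite E sinD.
rewrite (_ : 2 * alpha j * t = 2 * s); last by rewrite /s; ring.
set C := \int[gauss]_x (x ^+ 2 * cos (s * x ^+ 2)) in nc ns *.
set S := \int[gauss]_x (x ^+ 2 * sin (s * x ^+ 2)) in nc ns *.
have -> : \int[gauss]_x cos (s * x ^+ 2) = C + 2 * s * S by rewrite [in RHS]nc; ring.
have -> : \int[gauss]_x sin (s * x ^+ 2) = S - 2 * s * C by rewrite [in RHS]ns; ring.
by split; ring.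
Qed.

(** The relation (1 - 2 i alpha_j t) E[G_j^2 exp(i t F)] = E[exp(i t F)] says that F
    weighted by G_j^2 and F + 2 alpha_j Z, with Z exponential and independent of F, have
    the same characteristic function. *)
Lemma gaussian_quadratic_stein :
  gamma_stein P (fun w => \sum_i alpha i * (G i w ^+ 2 - 1))
    [seq (1, alpha i) | i <- enum 'I_m].
Proof.
have [_ iG _] := gG.
pose Q w := \sum_i alpha i * G i w ^+ 2; pose a := \sum_i alpha i.
pose F w := \sum_i alpha i * (G i w ^+ 2 - 1).
have FE w : F w = Q w - a.
  by rewrite /F /Q /a -sumrB; apply: eq_bigr => i _; ring.
have mQ : measurable_fun setT Q.
  by apply: measurable_sum => i; apply: measurable_funM => //; exact: measurable_funX.
have mF : measurable_fun setT F.
  have -> : F = (fun w => Q w - a) by apply/funext.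
  exact: measurable_funB.
have key (j : 'I_m) k : bcont k ->
    \int[P]_w (G j w ^+ 2 * k (F w)) = \int[P]_w expavg (alpha j) k (F w).
  move=> bk; have [ifb <-] := expavg_fubini (alpha j) mF bk.
  have fin1 : (P \x expo)%E setT = 1%E by exact: (@probability_setT _ _ _ (P \x expo)%E).
  have i1 : (P \x expo)%E.-integrable setT (EFin \o (fun _ : T * R => 1 : R)).
    by apply: integrable_cstR; rewrite [X in (X < _)%E]fin1 ltry.
  have mY2 : measurable_fun setT (fun z : T * R => F z.1 + 2 * alpha j * z.2).
    apply: measurable_funD; first exact: measurableT_comp mF measurable_fst.
    by apply: measurable_funM => //; exact: measurable_snd.
  have bmi (f : T -> R) : measurable_fun setT f -> (forall w, `|f w| <= 1) ->
      P.-integrable setT (EFin \o (fun w => G j w ^+ 2 * f w)).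
    by move=> mf f1; exact: (bounded_mul_integrable (iG j) mf f1).
  have mtQ t : measurable_fun setT (fun w => t * Q w) by exact: measurable_funM.
  have lin (u : T -> R) (b c t : R) : (forall w, u w = b * cos (t * Q w) + c * sin (t * Q w)) ->
     \int[P]_w u w = b * \int[P]_w cos (t * Q w) + c * \int[P]_w sin (t * Q w) /\
     \int[P]_w (G j w ^+ 2 * u w) = b * \int[P]_w (G j w ^+ 2 * cos (t * Q w)) +
         c * \int[P]_w (G j w ^+ 2 * sin (t * Q w)).
    move=> uE.
    have j1 := ibd (mcosf (mtQ t)) (fun w => cos_max _).
    have j2 := ibd (msinf (mtQ t)) (fun w => sin_max _).
    have j3 := bmi _ (mcosf (mtQ t)) (fun w => cos_max _).
    have j4 := bmi _ (msinf (mtQ t)) (fun w => sin_max _).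
    rewrite -(RintegralZl b measurableT j1) -(RintegralZl c measurableT j2).
    rewrite -(RintegralZl b measurableT j3) -(RintegralZl c measurableT j4).
    rewrite -(RintegralD measurableT (integrable_scaleR b j1) (integrable_scaleR c j2)).
    rewrite -(RintegralD measurableT (integrable_scaleR b j3) (integrable_scaleR c j4)).
    by split; apply: eq_Rintegral => w _; rewrite uE//; ring.
  have := @char_unique R _ _ P (fun w => G j w ^+ 2) F _ _ ((P \x expo)%E : probability _ R)
    (fun=> 1) (fun z => F z.1 + 2 * alpha j * z.2) (iG j) mF i1 mY2 _ _ k bk.
  move=> ->.
  - by apply: eq_Rintegral => w _; rewrite mul1r.
  - move=> t; under [RHS]eq_Rintegral do rewrite mul1r.
    have [_ ->] := expavg_fubini (alpha j) mF (bcont_cos t).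
    under [RHS]eq_Rintegral do rewrite expavg_cos.
    set b := 2 * alpha j * t; have b0 : 1 + b ^+ 2 != 0 by rewrite lt0r_neq0// ltr_wpDr// sqr_ge0.
    have [|_ ->] := lin (fun w => cos (t * F w)) (cos (t * a)) (sin (t * a)) t.
      by move=> w; rewrite FE mulrBr cosB; ring.
    have [|-> _] := lin (fun w => (1 + b ^+ 2)^-1 * cos (t * F w) - b * (1 + b ^+ 2)^-1 * sin (t * F w))
        ((1 + b ^+ 2)^-1 * (cos (t * a) + b * sin (t * a)))
        ((1 + b ^+ 2)^-1 * (sin (t * a) - b * cos (t * a))) t.
      by move=> w; rewrite FE mulrBr cosB sinB; ring.
    have [h1 h2] := gaussian_quadratic_phase j t; rewrite -/b in h1 h2.
    set C := (X in _ * X + _ = _); set S := (X in _ + _ * X = _).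
    have -> : \int[P]_w cos (t * Q w) = C + b * S by rewrite [C]h1 -/S; ring.
    have -> : \int[P]_w sin (t * Q w) = S - b * C by rewrite [S]h2 -/C; ring.
    by field; rewrite b0.
  - move=> t; under [RHS]eq_Rintegral do rewrite mul1r.
    have [_ ->] := expavg_fubini (alpha j) mF (bcont_sin t).
    under [RHS]eq_Rintegral do rewrite expavg_sin.
    set b := 2 * alpha j * t; have b0 : 1 + b ^+ 2 != 0 by rewrite lt0r_neq0// ltr_wpDr// sqr_ge0.
    have [|_ ->] := lin (fun w => sin (t * F w)) (- sin (t * a)) (cos (t * a)) t.
      by move=> w; rewrite FE mulrBr sinB; ring.
    have [|-> _] := lin (fun w => (1 + b ^+ 2)^-1 * sin (t * F w) + b * (1 + b ^+ 2)^-1 * cos (t * F w))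
        ((1 + b ^+ 2)^-1 * (b * cos (t * a) - sin (t * a)))
        ((1 + b ^+ 2)^-1 * (cos (t * a) + b * sin (t * a))) t.
      by move=> w; rewrite FE mulrBr cosB sinB; ring.
    have [h1 h2] := gaussian_quadratic_phase j t; rewrite -/b in h1 h2.
    set C := (X in _ * X + _ = _); set S := (X in _ + _ * X = _).
    have -> : \int[P]_w cos (t * Q w) = C + b * S by rewrite [C]h1 -/S; ring.
    have -> : \int[P]_w sin (t * Q w) = S - b * C by rewrite [S]h2 -/C; ring.
    by field; rewrite b0.
move=> k bk; have [_ [M kM]] := bk; have bA j := expavg_bcont (alpha j) bk.
have mk f : bcont f -> measurable_fun setT (fun w => f (F w)).
  by move=> bf; exact: measurableT_comp (bcont_measurable bf) mF.
have iGk j := bounded_mul_integrable (iG j) (mk _ bk) (fun w => kM (F w)).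
have ik := ibd (mk _ bk) (fun w => kM (F w)).
have iA j : P.-integrable setT (EFin \o (fun w => expavg (alpha j) k (F w))).
  by have [_ [N kN]] := bA j; exact: ibd (mk _ (bA j)) (fun w => kN (F w)).
rewrite big_map big_enum/=.
transitivity (\int[P]_w (\sum_j alpha j * (G j w ^+ 2 * k (F w) - k (F w)))).
  by apply: eq_Rintegral => w _; rewrite -/(F w) /F mulr_suml; apply: eq_bigr => j _; ring.
have [|_ ->] := @Rintegral_sum _ _ R P _ (index_enum _)
   (fun j w => alpha j * (G j w ^+ 2 * k (F w) - k (F w))).
  by move=> j; apply: integrable_scaleR; exact: integrable_subR (iGk j) ik.
apply: eq_bigr => j _; rewrite mul1r.
rewrite (RintegralZl (alpha j) measurableT (integrable_subR (iGk j) ik)).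
rewrite (RintegralB measurableT (iGk j) ik) (RintegralB measurableT (iA j) ik).
by rewrite key.
Qed.
End gaussian_family.

From mathcomp Require Import complex spectral.

(** * Diagonalisation of real symmetric matrices *)

Section spectral.
Context (R : realType).

(** Over the complex numbers there is an eigenvector x + i y with some eigenvalue a + i
    b; symmetry forces b (|x|^2 + |y|^2) = 0, hence b = 0 and x or y is a real
    eigenvector. *)
Lemma symmetric_eigenvector n (B : 'M[R]_n.+1) : B^T = B ->
  exists (a : R) (v : 'rV[R]_n.+1), v *m v^T = 1%:M /\ v *m B = a *: v.
Proof.
move=> symB.
have unit_of (a : R) (x : 'rV[R]_n.+1) : x != 0 -> x *m B = a *: x ->
    exists (a : R) (v : 'rV[R]_n.+1), v *m v^T = 1%:M /\ v *m B = a *: v.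
  move=> x0 xB; have sE : (x *m x^T) 0 0 = \sum_i x 0 i ^+ 2.
    by rewrite mxE; apply: eq_bigr => i _; rewrite mxE expr2.
  have s0 : 0 < (x *m x^T) 0 0.
    have /rV0Pn[i xi] := x0.
    rewrite sE (bigD1 i)//= ltr_pwDl//; first by rewrite exprn_even_gt0.
    by apply: sumr_ge0 => k _; exact: sqr_ge0.
  set s := (x *m x^T) 0 0 in s0; pose c := (Num.sqrt s)^-1.
  exists a, (c *: x); split; last by rewrite -scalemxAl xB !scalerA mulrC.
  rewrite linearZ /= -scalemxAl -scalemxAr scalerA [x *m _]mx11_scalar -/s.
  rewrite -scalemx1 scalerA /c -invfM -expr2 sqr_sqrtr ?ltW//.
  by rewrite mulVf ?scale1r// gt_eqF.
pose toC : R -> R[i] := fun x => Complex x 0.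
pose Bc : 'M[R[i]]_n.+1 := \matrix_(i, j) Complex (B i j) 0.
have [a /eigenvalueP[v vB v0]] := @eigenvalue_closed _ n.+1 Bc isT.
pose x : 'rV[R]_n.+1 := \row_j complex.Re (v 0 j).
pose y : 'rV[R]_n.+1 := \row_j complex.Im (v 0 j).
have rm (z : R[i]) (r : R) : complex.Re (z * Complex r 0) = complex.Re z * r /\
    complex.Im (z * Complex r 0) = complex.Im z * r.
  by case: z => p q /=; split; ring.
have cm (z w : R[i]) :
    complex.Re (z * w) = complex.Re z * complex.Re w - complex.Im z * complex.Im w /\
    complex.Im (z * w) = complex.Re z * complex.Im w + complex.Im z * complex.Re w.
  by case: z => p q; case: w => p' q' /=; split; ring.
have E j : \sum_k v 0 k * Bc k j = a * v 0 j.
  by have := congr1 (fun M : 'rV_n.+1 => M 0 j) vB; rewrite !mxE.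
have reS (F : 'I_n.+1 -> R[i]) : complex.Re (\sum_k F k) = \sum_k complex.Re (F k).
  by apply: (big_morph (@complex.Re R)) => // -[? ?] [? ?].
have imS (F : 'I_n.+1 -> R[i]) : complex.Im (\sum_k F k) = \sum_k complex.Im (F k).
  by apply: (big_morph (@complex.Im R)) => // -[? ?] [? ?].
have xB : x *m B = complex.Re a *: x - complex.Im a *: y.
  apply/rowP => j; rewrite !mxE -(cm _ _).1 -E reS.
  by apply: eq_bigr => k _; rewrite [Bc k j]mxE (rm _ _).1 ?mxE.
have yB : y *m B = complex.Re a *: y + complex.Im a *: x.
  apply/rowP => j; rewrite !mxE -(cm _ _).2 -E imS.
  by apply: eq_bigr => k _; rewrite [Bc k j]mxE (rm _ _).2 ?mxE.
have sq (z : 'rV[R]_n.+1) : 0 <= (z *m z^T) 0 0 ?= iff (z == 0).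
  have sE : (z *m z^T) 0 0 = \sum_i z 0 i ^+ 2.
    by rewrite mxE; apply: eq_bigr => i _; rewrite mxE expr2.
  have s0 : 0 <= (z *m z^T) 0 0 by rewrite sE sumr_ge0// => k _; exact: sqr_ge0.
  split => //; apply/eqP/eqP => [|->]; last by rewrite mul0mx mxE.
  move=> /esym; rewrite sE => z0; apply/rowP => i; rewrite mxE; apply/eqP.
  rewrite -sqrf_eq0; apply/eqP.
  by apply: (psumr_eq0P _ z0) => // k _; exact: sqr_ge0.
pose dotr (u w : 'rV[R]_n.+1) := (u *m w^T) 0 0.
have dotrC u w : dotr u w = dotr w u.
  by rewrite /dotr -[u *m w^T]trmxK trmx_mul trmxK [LHS]mxE.
have dotrL c e u w z : dotr (c *: u + e *: w) z = c * dotr u z + e * dotr w z.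
  by rewrite /dotr mulmxDl -!scalemxAl [LHS]mxE [X in X + _ = _]mxE [X in _ + X = _]mxE.
have dotrB u w : dotr (u *m B) w = dotr (w *m B) u.
  by rewrite [RHS]dotrC /dotr trmx_mul symB mulmxA.
have im0 : complex.Im a * (dotr x x + dotr y y) = 0.
  have := dotrB x y; rewrite xB yB -scaleNr !dotrL (dotrC y x) => h.
  by rewrite mulrDr; move: h; lra.
have [/eqP nn|nn] := eqVneq (dotr x x + dotr y y) 0.
  move: nn; rewrite paddr_eq0 ?(sq _).1// ![_ == 0]eq_sym (sq x).2 (sq y).2.
  move=> /andP[/eqP x0 /eqP y0]; move/eqP: v0; case; apply/rowP => j.
  have := congr1 (fun M : 'rV[R]_n.+1 => M 0 j) x0.
  have := congr1 (fun M : 'rV[R]_n.+1 => M 0 j) y0.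
  by rewrite !mxE; case: (v 0 j) => p q /= -> ->.
have a0 : complex.Im a = 0 by move/eqP: im0; rewrite mulf_eq0 (negbTE nn) orbF => /eqP.
rewrite a0 !scale0r ?subr0 ?addr0 in xB yB.
have [x0|x0] := eqVneq x 0; last exact: unit_of xB.
apply: unit_of yB; apply: contraNneq nn => y0.
by rewrite x0 y0 /dotr mul0mx mxE addr0.
Qed.

(** Householder deflation: the reflection exchanging a unit eigenvector and the first
    basis vector brings the matrix to block form. *)
Lemma symmetric_diag n (B : 'M[R]_n) : B^T = B ->
  exists (O : 'M[R]_n) (a : 'rV[R]_n), O *m O^T = 1%:M /\ O *m B *m O^T = diag_mx a.
Proof.
elim: n B => [|n IH] B symB.
  by exists 1%:M, 0; split; apply/matrixP => -[].
have [a [v [vv vB]]] := symmetric_eigenvector symB.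
have [Q [QT QQ Q0]] : exists Q : 'M[R]_n.+1, [/\ Q^T = Q, Q *m Q = 1%:M & delta_mx 0 0 *m Q = v].
  pose e : 'rV[R]_n.+1 := delta_mx 0 0; pose u := v - e.
  have [u0|u0] := eqVneq u 0.
    exists 1%:M; split; rewrite ?trmx1 ?mulmx1//.
    by apply/esym/eqP; rewrite -subr_eq0 -/u u0.
  have ee : e *m e^T = 1%:M.
    rewrite /e trmx_delta mul_delta_mx; apply/matrixP => i j; rewrite !ord1 !mxE//.
  pose p := (e *m v^T) 0 0.
  have ev : e *m v^T = p%:M by rewrite [LHS]mx11_scalar.
  have ve : v *m e^T = p%:M by rewrite -[v]trmxK -trmx_mul ev tr_scalar_mx.
  pose c := 2 - 2 * p.
  have uu : u *m u^T = c%:M.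
    rewrite /u linearB /= mulmxBl !mulmxBr vv ee ev ve.
    by rewrite -!raddfB /=; congr (_%:M); rewrite /c; ring.
  have c0 : c != 0.
    apply: contraNneq u0 => c0; apply/eqP/rowP => i; rewrite [RHS]mxE.
    have : \sum_k u 0 k ^+ 2 = 0.
      rewrite -[RHS]c0; transitivity ((u *m u^T) 0 0); last by rewrite uu mxE eqxx mulr1n.
      by rewrite [RHS]mxE;  apply: eq_bigr => k _; rewrite [u^T _ _]mxE expr2.
    move=> z0; apply/eqP; rewrite -sqrf_eq0; apply/eqP.
    by apply: (psumr_eq0P _ z0) => // k _; exact: sqr_ge0.
  pose W := u^T *m u.
  have WW : W *m W = c *: W.
    by rewrite /W mulmxA -[u^T *m u *m u^T]mulmxA uu mul_mx_scalar -scalemxAl.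
  exists (1%:M - (2 / c) *: W); split.
  - by rewrite linearB /= linearZ /= trmx1 /W trmx_mul trmxK.
  - rewrite mulmxBl mul1mx mulmxBr mulmx1 -scalemxAl -scalemxAr WW !scalerA.
    by rewrite (_ : 2 / c * (2 / c) * c = 2 / c + 2 / c) ?scalerDl; [rewrite opprB addrK subrK|by field; rewrite c0].
  - have eu : e *m u^T = (p - 1)%:M.
      by rewrite /u [(v - e)^T]linearB /= mulmxBr ev ee -raddfB.
    rewrite -/e mulmxBr mulmx1 -scalemxAr /W mulmxA eu mul_scalar_mx scalerA.
    rewrite (_ : 2 / c * (p - 1) = -1) ?scaleN1r ?opprK; first by rewrite /u addrC subrK.
    by move: c0; rewrite /c => c0; field; rewrite c0.
have Qv : v *m Q = delta_mx 0 0 by rewrite -Q0 -mulmxA QQ mulmx1.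
pose M : 'M[R]_(1 + n) := Q *m B *m Q.
have MT : M^T = M by rewrite /M !trmx_mul QT symB mulmxA.
have M0 : delta_mx 0 0 *m M = a *: delta_mx 0 0 :> 'rV[R]_(1 + n).
  by rewrite /M !mulmxA Q0 vB -scalemxAl Qv.
have Mrow j : M 0 j = if j == 0 then a else 0.
  have := congr1 (fun N : 'rV[R]_n.+1 => N 0 j) M0.
  rewrite -rowE [LHS]mxE => ->; rewrite !mxE eqxx/=.
  by case: eqP; rewrite ?mulr1 ?mulr0.
have Mcol i : M i 0 = if i == 0 then a else 0 by rewrite -[in LHS]MT mxE Mrow.
have [N [NE NT Nrow Ncol]] : exists N : 'M[R]_(1 + n), [/\ N = Q *m B *m Q, N^T = N,
    forall j, N 0 j = (if j == 0 then a else 0) &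
    forall i, N i 0 = (if i == 0 then a else 0)] by exists M.
have Nblock : N = block_mx a%:M 0 0 (drsubmx N).
  rewrite -[LHS]submxK; congr block_mx.
  - by apply/matrixP => i j; rewrite !ord1 !mxE lshift0 Nrow eqxx mulr1n.
  - by apply/matrixP => i j; rewrite !ord1 !mxE lshift0 Nrow.
  - by apply/matrixP => i j; rewrite !ord1 !mxE lshift0 Ncol.
have [|O' [a' [OO' OB']]] := IH (drsubmx N).
  by rewrite -[in RHS]NT trmx_drsub.
pose E : 'M[R]_(1 + n) := block_mx 1%:M 0 0 O'.
have ET : E^T = block_mx 1%:M 0 0 O'^T by rewrite /E tr_block_mx !trmx0 trmx1.
have EE : E *m E^T = 1%:M.
  rewrite ET /E mulmx_block.
  by rewrite !mul0mx !mulmx0 !addr0 add0r mulmx1 OO' -scalar_mx_block.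
have EN : E *m N *m E^T = diag_mx (row_mx a%:M a').
  rewrite Nblock ET /E !mulmx_block.
  rewrite !mul0mx !mulmx0 !addr0 !add0r mulmx1 mul1mx !mul0mx OB' diag_mx_row.
  by congr block_mx; apply/matrixP => i j; rewrite !ord1 !mxE.
exists (E *m Q), (row_mx a%:M a'); split.
  by rewrite trmx_mul QT mulmxA -(mulmxA E) QQ mulmx1.
by rewrite trmx_mul QT -EN NE !mulmxA.
Qed.
End spectral.

(** * Gaussian families in an isonormal process *)

(** Stated with the law as a set function, since the law of a Gaussian variable is given
    on measurable sets only. *)
Lemma Rintegral_law (R : realType) d (T : measurableType d) (P : {measure set T -> \bar R})
    (Y : T -> R) (m : {measure set (measurableTypeR R) -> \bar R}) (f : R -> R) :
  measurable_fun setT Y -> measurable_fun setT f ->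
  (forall B, measurable B -> pushforward P Y B = m B) ->
  P.-integrable setT (EFin \o (fun w => f (Y w))) ->
  \int[P]_w f (Y w) = \int[m]_x f x.
Proof.
move=> mY mf law i; rewrite /Rintegral; congr fine.
have mf' : measurable_fun setT (EFin \o f) by exact/measurable_EFinP.
have := @integral_pushforward _ _ T (measurableTypeR R) R Y mY P setT (EFin \o f) mf'.
move=> /(_ i measurableT) /= <-.
by apply: eq_measure_integral => A mA _ /=; exact: law.
Qed.

Section square_integrable.
Context (R : realType) d (T : measurableType d) (P : probability T R).

Definition sqint (f : T -> R) :=
  measurable_fun setT f /\ P.-integrable setT (EFin \o (fun w => f w ^+ 2)).

Lemma sqint_integrable f : sqint f -> P.-integrable setT (EFin \o f).
Proof.
move=> [mf i2]; have i1 : P.-integrable setT (EFin \o (fun _ : T => 1 : R)).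
  have Pfin : (P setT < +oo)%E by rewrite probability_setT ltry.
  exact: integrable_cstR.
apply: (le_integrable_abs mf (integrable_addR i1 i2)) => w.
have := sqr_ge0 (`|f w| - 1); have := real_normK (num_real (f w)).
have := normr_ge0 (f w); nra.
Qed.

Lemma sqint_mul f g : sqint f -> sqint g -> P.-integrable setT (EFin \o (fun w => f w * g w)).
Proof.
move=> [mf i2] [mg j2].
apply: (le_integrable_abs (measurable_funM mf mg) (integrable_addR i2 j2)) => w.
rewrite normrM -(real_normK (num_real (f w))) -(real_normK (num_real (g w))).
have := sqr_ge0 (`|f w| - `|g w|).
have := mulr_ge0 (normr_ge0 (f w)) (normr_ge0 (g w)); nra.
Qed.

Lemma sqintZ c f : sqint f -> sqint (fun w => c * f w).
Proof.
move=> [mf i2]; split; first exact: measurable_funM.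
by have := integrable_scaleR (c ^+ 2) i2; under eq_fun do rewrite -exprMn.
Qed.

Lemma sqintD f g : sqint f -> sqint g -> sqint (fun w => f w + g w).
Proof.
move=> sf sg; have ifg := integrable_scaleR 2 (sqint_mul sf sg).
case: sf sg => [mf i2] [mg j2]; split; first exact: measurable_funD.
have := integrable_addR (integrable_addR i2 ifg) j2; congr (_.-integrable _ _).
by apply/funext => w /=; congr EFin; ring.
Qed.

Lemma sqint_sum (I : Type) (s : seq I) (f : I -> T -> R) :
  (forall i, sqint (f i)) -> sqint (fun w => \sum_(i <- s) f i w).
Proof.
move=> sf; elim: s => [|i s IH].
  under eq_fun do rewrite big_nil.
  split; first exact: measurable_cst.
  under eq_fun do rewrite expr0n; exact: integrable0.
under eq_fun do rewrite big_cons; exact: sqintD.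
Qed.
End square_integrable.

Section isonormal_moments.
Context (R : realType) d (T : measurableType d) (P : probability T R).
Context (H : completeNormedModType R) (dot : {dot H for idfun}) (X : H -> {RV P >-> R}).
Hypothesis isoX : isonormal dot X.

Lemma dotC (x y : H) : dot x y = dot y x.
Proof. by rewrite hermC/= expr0 mul1r. Qed.

Lemma isonormal_sqint h : sqint P (X h).
Proof.
have [_ _ /(_ h h)] := isoX; rewrite unlock => E _.
split; first exact: measurable_funPT.
apply/integrableP; split.
  by apply/measurable_EFinP; apply: measurable_funX; exact: measurable_funPT.
rewrite (_ : (\int[P]_x _)%E = (dot h h)%:E) ?ltry// -E.
by apply: eq_integral => w _ /=; rewrite ger0_norm ?sqr_ge0// expr2.
Qed.

Definition field_comb (l : seq (R * H)) (w : T) := \sum_(p <- l) p.1 * X p.2 w.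

Lemma field_comb_sqint l : sqint P (field_comb l).
Proof. by apply: sqint_sum => p; apply: sqintZ; exact: isonormal_sqint. Qed.

Lemma field_comb_mean l : \int[P]_w field_comb l w = 0.
Proof.
have [_ E0 _ _] := isoX.
have iX h := sqint_integrable (isonormal_sqint h).
have [|_ ->] := @Rintegral_sum _ _ R P _ l (fun p w => p.1 * X p.2 w).
  by move=> p; exact: integrable_scaleR.
rewrite big1// => p _; rewrite (RintegralZl _ measurableT (iX p.2)).
by have := E0 p.2; rewrite unlock /Rintegral => ->; rewrite mulr0.
Qed.

Lemma field_comb_cov l g :
  \int[P]_w (field_comb l w * X g w) = dot (\sum_(p <- l) p.1 *: p.2) g.
Proof.
have [_ _ Ec _] := isoX.
have iX h := sqint_mul (isonormal_sqint h) (isonormal_sqint g).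
transitivity (\int[P]_w (\sum_(p <- l) p.1 * (X p.2 w * X g w))).
  by apply: eq_Rintegral => w _; rewrite mulr_suml; apply: eq_bigr => p _; ring.
have [|_ ->] := @Rintegral_sum _ _ R P _ l (fun p w => p.1 * (X p.2 w * X g w)).
  by move=> p; exact: integrable_scaleR.
rewrite linear_sumlz; apply: eq_bigr => p _.
rewrite (RintegralZl _ measurableT (iX p.2)) linearZl_LR /=; congr (_ * _).
by have := Ec p.2 g; rewrite unlock /Rintegral => ->.
Qed.

Lemma field_comb_var l (h := \sum_(p <- l) p.1 *: p.2) :
  \int[P]_w (field_comb l w ^+ 2) = dot h h.
Proof.
have iX g := sqint_mul (field_comb_sqint l) (isonormal_sqint g).
transitivity (\int[P]_w (\sum_(p <- l) p.1 * (field_comb l w * X p.2 w))).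
  apply: eq_Rintegral => w _; rewrite expr2 {2}/field_comb mulr_sumr.
  by apply: eq_bigr => p _; ring.
have [|_ ->] := @Rintegral_sum _ _ R P _ l (fun p w => p.1 * (field_comb l w * X p.2 w)).
  by move=> p; exact: integrable_scaleR.
rewrite -[RHS]/(dot (\sum_(p <- l) p.1 *: p.2) h) linear_sumlz; apply: eq_bigr => p _.
rewrite (RintegralZl _ measurableT (iX p.2)) linearZl_LR /= [dot p.2 h]dotC; congr (_ * _).
exact: field_comb_cov.
Qed.

(** The law is normal or a point mass; in both cases the two moments determine its
    parameters. *)
Lemma field_comb_char l (h := \sum_(p <- l) p.1 *: p.2) :
  \int[P]_w cos (field_comb l w) = expR (- (dot h h / 2)) /\
  \int[P]_w sin (field_comb l w) = 0.
Proof.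
have [gX _ _ _] := isoX.
have [mW iW2] := field_comb_sqint l.
have iW := sqint_integrable (field_comb_sqint l).
have Pfin : (P setT < +oo)%E by rewrite probability_setT ltry.
have mcos : measurable_fun setT (@cos R) by exact: continuous_measurable_fun (@continuous_cos R).
have msin : measurable_fun setT (@sin R) by exact: continuous_measurable_fun (@continuous_sin R).
have ic : P.-integrable setT (EFin \o (fun w => cos (field_comb l w))).
  apply: (bounded_integrable (M := 1)) => //; first exact: measurableT_comp mcos mW.
  by move=> w; exact: cos_max.
have is_ : P.-integrable setT (EFin \o (fun w => sin (field_comb l w))).
  apply: (bounded_integrable (M := 1)) => //; first exact: measurableT_comp msin mW.
  by move=> w; exact: sin_max.
have := field_comb_mean l; have := field_comb_var l; rewrite -/h.
have msq : measurable_fun setT (fun x : R => x ^+ 2) by exact: measurable_funX.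
have mid : measurable_fun setT (fun x : R => x) by exact: measurable_id.
case: (gX l) => [[m [s [s0 law]]]|[m law]].
  rewrite (Rintegral_law mW mid law iW) (Rintegral_law mW msq law iW2).
  rewrite (Rintegral_law mW mcos law ic) (Rintegral_law mW msin law is_).
  move=> Ev Em; have m0 : m = 0 by rewrite -Em normal_mean.
  move: Ev; rewrite m0; under eq_Rintegral do rewrite -[X in X ^+ 2]subr0.
  rewrite (@normal_variance R 0 s s0) => <-.
  have := normal_char s0 1; under eq_Rintegral do rewrite mul1r.
  by move=> [-> h2]; split; [rewrite expr1n mulr1|rewrite -[RHS]h2; apply: eq_Rintegral => x _; rewrite mul1r].
pose D : {measure set (measurableTypeR R) -> \bar R} := @dirac _ (measurableTypeR R) m R.
have lawD B : measurable B -> pushforward P (field_comb l) B = D B by exact: law.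
rewrite (Rintegral_law mW mid lawD iW) (Rintegral_law mW msq lawD iW2).
rewrite (Rintegral_law mW mcos lawD ic) (Rintegral_law mW msin lawD is_).
have Dint f : measurable_fun setT f -> \int[D]_x f x = f m.
  move=> mf; rewrite /Rintegral integral_dirac//; last exact/measurable_EFinP.
  by rewrite diracT mul1e.
rewrite !Dint// => <- ->.
by rewrite cos0 sin0 expr0n mul0r oppr0 expR0.
Qed.
End isonormal_moments.

Section orthonormal_coordinates.
Context (R : realType) (H : completeNormedModType R) (dot : {dot H for idfun}).

Definition orthonormal_fam m (e : 'I_m -> H) := forall i j, dot (e i) (e j) = (i == j)%:R.

Lemma dot_sumZ m (e : 'I_m -> H) (c : 'I_m -> R) i : orthonormal_fam e ->
  dot (\sum_j c j *: e j) (e i) = c i.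
Proof.
move=> oe; rewrite linear_sumlz (bigD1 i)//= linearZl_LR /= oe eqxx mulr1 big1 ?addr0// => j ji.
by rewrite linearZl_LR /= oe (negbTE ji) mulr0.
Qed.

Lemma dot_coord m (e : 'I_m -> H) (c b : 'I_m -> R) : orthonormal_fam e ->
  dot (\sum_j c j *: e j) (\sum_j b j *: e j) = \sum_j c j * b j.
Proof.
move=> oe; rewrite linear_sumlz; apply: eq_bigr => i _.
by rewrite linearZl_LR /= dotC dot_sumZ.
Qed.

(** Coordinates in an orthonormal family turn the finite combinations of the field into
    vectors. *)
Lemma gram_schmidt (s : seq H) : is_inner_product dot ->
  exists m (e : 'I_m -> H), orthonormal_fam e /\
    forall h, h \in s -> exists c : 'I_m -> R, h = \sum_i c i *: e i.
Proof.
move=> ip; elim: s => [|h s [m [e [oe hs]]]].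
  by exists 0%N, (fun _ => 0); split => // -[].
pose c i := dot h (e i); pose r := h - \sum_i c i *: e i.
have hE : h = r + \sum_i c i *: e i by rewrite /r subrK.
have [r0|r0] := eqVneq r 0.
  exists m, e; split => // g; rewrite inE => /orP[/eqP ->|/hs//].
  by exists c; rewrite {1}hE r0 add0r.
have re i : dot r (e i) = 0 by have h1 := dot_sumZ c i oe; rewrite /r linearBl /= h1 subrr.
have n0 : `|r| != 0 by rewrite normr_eq0.
pose v := `|r|^-1 *: r.
have ve i : dot v (e i) = 0 by rewrite linearZl_LR /= re mulr0.
have vv : dot v v = 1.
  by rewrite ip normrZ normrV ?unitfE// normr_id mulVf// expr1n.
pose e' (i : 'I_m.+1) := if unlift ord_max i is Some j then e j else v.
exists m.+1, e'; split.
  move=> i j; rewrite /e'; case: unliftP => [i'|] ->; case: unliftP => [j'|] ->.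
  - by rewrite oe (inj_eq lift_inj).
  - by rewrite dotC ve eq_sym (negbTE (neq_lift _ _)).
  - by rewrite ve (negbTE (neq_lift _ _)).
  - by rewrite vv eqxx.
have ext (b : 'I_m -> R) z : exists b' : 'I_m.+1 -> R,
    z *: v + \sum_i b i *: e i = \sum_i b' i *: e' i.
  exists (fun i => if unlift ord_max i is Some j then b j else z).
  rewrite [RHS](bigD1_ord ord_max)//= /e' unlift_none; congr (_ + _).
  by apply: eq_bigr => i _; rewrite liftK.
move=> g; rewrite inE => /orP[/eqP ->|/hs[b ->]]; last first.
  by have [b' h'] := ext b 0; exists b'; rewrite -h' scale0r add0r.
have [b' h'] := ext c `|r|; exists b'; rewrite -h' {1}hE; congr (_ + _).
by rewrite /v scalerA divff ?scale1r.
Qed.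
End orthonormal_coordinates.

Section elementary_chaos.
Context (R : realType) d (T : measurableType d) (P : probability T R).
Context (H : completeNormedModType R) (dot : {dot H for idfun}) (X : H -> {RV P >-> R}).
Hypotheses (isoX : isonormal dot X) (ip : is_inner_product dot).

(** A linear combination of the new variables is a field element whose norm is preserved
    by the orthogonal matrix. *)
Lemma gaussian_rotation m (e : 'I_m -> H) (O : 'M[R]_m) : orthonormal_fam dot e ->
  O *m O^T = 1%:M ->
  gaussian_family P (fun j w => \sum_i O j i * X (e i) w).
Proof.
move=> oe OO.
have GE j w : \sum_i O j i * X (e i) w = field_comb X [seq (O j i, e i) | i <- enum 'I_m] w.
  by rewrite /field_comb big_map big_enum.
have sG j : sqint P (fun w => \sum_i O j i * X (e i) w).
  under eq_fun do rewrite GE; exact: field_comb_sqint isoX _.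
split=> [j|j|u]; [by case: (sG j)|by case: (sG j)|].
pose v i := \sum_j u j * O j i.
have E w : \sum_j u j * (\sum_i O j i * X (e i) w) =
    field_comb X [seq (v i, e i) | i <- enum 'I_m] w.
  rewrite /field_comb big_map big_enum /=.
  under eq_bigr do rewrite mulr_sumr.
  rewrite exchange_big /=; apply: eq_bigr => i _; rewrite /v mulr_suml.
  by apply: eq_bigr => j _; rewrite mulrA.
have n : \sum_j u j ^+ 2 = dot (\sum_i v i *: e i) (\sum_i v i *: e i).
  rewrite dot_coord//; pose ur : 'rV[R]_m := \row_j u j.
  have vE i : v i = (ur *m O) 0 i by rewrite mxE; apply: eq_bigr => j _; rewrite mxE.
  transitivity ((ur *m ur^T) 0 0).
    by rewrite [RHS]mxE; apply: eq_bigr => j _; rewrite [ur^T _ _]mxE [ur _ _]mxE expr2.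
  have -> : ur *m ur^T = (ur *m O) *m (ur *m O)^T.
    by rewrite trmx_mul mulmxA -(mulmxA ur) OO mulmx1.
  by rewrite [LHS]mxE; apply: eq_bigr => i _; rewrite [_^T _ _]mxE !vE.
have [h1 h2] := field_comb_char isoX [seq (v i, e i) | i <- enum 'I_m].
rewrite big_map big_enum /= -n in h1.
by split; under eq_Rintegral do rewrite E.
Qed.

(** Each X(h) is almost surely the combination of the X(e_i) given by the coordinates of
    h, the difference having zero variance; since |h| = 1 the sum of the coefficients is
    the trace of the quadratic form, so the constants match. *)
Lemma elem_I2_diag (s : seq (R * H)) : unit_vectors s ->
  exists m (G : 'I_m -> T -> R) (alpha : 'I_m -> R), gaussian_family P G /\
    \forall w \ae P, elem_I2 X s w = \sum_i alpha i * (G i w ^+ 2 - 1).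
Proof.
move=> us; have [m [e [oe hs]]] := gram_schmidt [seq p.2 | p <- s] ip.
have [c hc] : {c : H -> 'I_m -> R & forall h, h \in [seq p.2 | p <- s] ->
    h = \sum_i c h i *: e i}.
  apply: (@choice _ _ (fun h (c : 'I_m -> R) => h \in [seq p.2 | p <- s] -> h = \sum_i c i *: e i)).
  move=> h; have [/hs[b hb]|] := boolP (h \in [seq p.2 | p <- s]); first by exists b.
  by exists (fun=> 0).
pose B : 'M[R]_m := \matrix_(i, j) \sum_(p <- s) p.1 * (c p.2 i * c p.2 j).
have symB : B^T = B.
  by apply/matrixP => i j; rewrite !mxE; apply: eq_bigr => p _; rewrite (mulrC (c _ j)).
have [ O [a [OO OB]]] := symmetric_diag symB.
have OtO : O^T *m O = 1%:M by apply: mulmx1C.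
have BE : B = O^T *m diag_mx a *m O.
  by rewrite -OB !mulmxA OtO mul1mx -mulmxA OtO mulmx1.
exists m, (fun j w => \sum_i O j i * X (e i) w), (fun j => a 0 j); split.
  exact: gaussian_rotation.
pose dv (p : R * H) w := X p.2 w - \sum_i c p.2 i * X (e i) w.
pose D w := \sum_(p <- s) (if p \in s then dv p w ^+ 2 else 0).
have dvE p w : dv p w = field_comb X ((1, p.2) :: [seq (- c p.2 i, e i) | i <- enum 'I_m]) w.
  rewrite /field_comb big_cons /= mul1r big_map big_enum /= /dv; congr (_ + _).
  by rewrite -sumrN; apply: eq_bigr => i _; rewrite mulNr.
have sdv p : sqint P (dv p).
  have -> : dv p = field_comb X ((1, p.2) :: [seq (- c p.2 i, e i) | i <- enum 'I_m]).
    by apply/funext => w; exact: dvE.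
  exact: field_comb_sqint isoX _.
have idv p : P.-integrable setT (EFin \o (fun w => if p \in s then dv p w ^+ 2 else 0)).
  by case: (p \in s); [case: (sdv p)|exact: integrable0].
have dvz p : p \in s -> \int[P]_w (dv p w ^+ 2) = 0.
  move=> ps; under eq_Rintegral do rewrite dvE.
  rewrite (field_comb_var isoX) big_cons big_map big_enum /= scale1r.
  under eq_bigr do rewrite scaleNr.
  rewrite sumrN -hc ?subrr ?linear0l//; exact: map_f.
have [iD D0] := Rintegral_sum s idv.
have {}D0 : \int[P]_w D w = 0.
  rewrite D0 big_seq big1// => p ps; rewrite ps; exact: dvz.
have Dge w : 0 <= D w.
  by apply: sumr_ge0 => p _; case: ifP => // _; exact: sqr_ge0.
have : ae_eq P setT (EFin \o D) (cst 0%E).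
  apply/ae_eq_integral_abs => //.
    by case/integrableP : iD.
  transitivity (\int[P]_w (D w)%:E)%E.
    by apply: eq_integral => w _ /=; rewrite ger0_norm.
  rewrite -[LHS]fineK; last exact: integrable_fin_num iD.
  by rewrite -[X in _ = X]/(0%:E) -D0.
apply: filterS => w /(_ I) /= [Dw].
have XE p : p \in s -> X p.2 w = \sum_i c p.2 i * X (e i) w.
  move=> ps; apply/eqP; rewrite -subr_eq0 -sqrf_eq0 -/(dv p w); apply/eqP.
  move/eqP: Dw; rewrite /D psumr_eq0; last by move=> q _; case: ifP => // _; exact: sqr_ge0.
  by move=> /allP/(_ _ ps); rewrite ps /= => /eqP.
have c1 p : p \in s -> \sum_i c p.2 i ^+ 2 = 1.
  move=> ps; have := ip p.2; rewrite us// expr1n {1 2}(hc p.2); last exact: map_f.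
  by rewrite dot_coord// => <-; apply: eq_bigr => i _; rewrite expr2.
pose x : 'rV[R]_m := \row_i X (e i) w.
have quad : \sum_(p <- s) p.1 * X p.2 w ^+ 2 = (x *m B *m x^T) 0 0.
  rewrite [RHS]mxE.
  transitivity (\sum_j \sum_i \sum_(p <- s) p.1 * (c p.2 i * x 0 i * (c p.2 j * x 0 j))).
    rewrite exchange_big /=; under [RHS]eq_bigr do rewrite exchange_big /=.
    rewrite exchange_big /= [LHS]big_seq [RHS]big_seq; apply: eq_bigr => p ps.
    rewrite XE// expr2 mulr_suml mulr_sumr; apply: eq_bigr => i _.
    rewrite mulr_sumr mulr_sumr; apply: eq_bigr => j _; rewrite !mxE; ring.
  apply: eq_bigr => j _; rewrite [in RHS]mxE [x^T _ _]mxE mulr_suml; apply: eq_bigr => i _.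
  rewrite [B _ _]mxE mulr_sumr mulr_suml; apply: eq_bigr => p _; ring.
have tr : \sum_(p <- s) p.1 = \tr B.
  rewrite /mxtrace; under [RHS]eq_bigr do rewrite mxE.
  rewrite exchange_big /= [LHS]big_seq [RHS]big_seq; apply: eq_bigr => p ps.
  rewrite -[LHS]mulr1 -(c1 p ps) mulr_sumr; apply: eq_bigr => i _; by rewrite expr2.
have trA : \tr B = \sum_i a 0 i.
  by rewrite BE mxtrace_mulC mulmxA OO mul1mx mxtrace_diag.
have quadA : (x *m B *m x^T) 0 0 = \sum_j a 0 j * (\sum_i O j i * X (e i) w) ^+ 2.
  have gE j : (O *m x^T) j 0 = \sum_i O j i * X (e i) w.
    by rewrite mxE; apply: eq_bigr => i _; rewrite !mxE.
  rewrite BE !mulmxA -(mulmxA _ O) -[x *m O^T]trmxK trmx_mul trmxK.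
  rewrite mxE; apply: eq_bigr => j _; rewrite mul_mx_diag [X in X * _]mxE [_^T _ _]mxE !gE; ring.
have -> : elem_I2 X s w = \sum_(p <- s) (p.1 * X p.2 w ^+ 2 - p.1).
  by apply: eq_bigr => p _; rewrite /hermite2 mulrBr mulr1.
have -> : \sum_j a 0 j * ((\sum_i O j i * X (e i) w) ^+ 2 - 1) =
   \sum_j (a 0 j * (\sum_i O j i * X (e i) w) ^+ 2 - a 0 j).
  by apply: eq_bigr => j _; rewrite mulrBr mulr1.
by rewrite !sumrB quad quadA tr trA.
Qed.
End elementary_chaos.

(** * Convergence of derivatives *)

Section derivative_of_limit.
Context (R : realType).

Lemma is_derive_quadratic (v : R -> R) (t w K tau : R) : 0 < tau ->
  (forall h, `|h| < tau -> `|v (t + h) - v t - h * w| <= K * h ^+ 2) ->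
  is_derive t 1 v w.
Proof.
move=> tau0 q.
have c : h^-1 *: ((v \o shift t) (h *: (1:R)) - v t) @[h --> 0^'] --> w.
  apply/cvgrPdist_le => e e0.
  have K0 : 0 < 1 + `|K| by rewrite ltr_pwDl.
  near=> h.
  have h0 : h != 0 by near: h; exact: nbhs_dnbhs_neq.
  have ht : `|h| < tau by near: h; apply: dnbhs0_lt.
  have he : `|h| < e / (1 + `|K|) by near: h; apply: dnbhs0_lt; rewrite divr_gt0.
  have -> : w - h^-1 *: ((v \o shift t) (h *: (1:R)) - v t) = - (h^-1 * (v (t + h) - v t - h * w)).
    by rewrite /= /GRing.scale /= mulr1 (addrC h); field.
  rewrite normrN normrM normfV.
  have n0 : 0 < `|h| by rewrite normr_gt0.
  rewrite mulrC ler_pdivrMr// (le_trans (q h ht))// -(real_normK (num_real h)).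
  move: he; rewrite ltr_pdivlMr// => he.
  have := ler_norm K; have := normr_ge0 K; nra.
split; first by apply/cvg_ex; exists w.
exact: cvg_lim c.
Unshelve. all: by end_near. Qed.

Lemma MVT_dist (f df : R -> R) (a b eps : R) :
  (forall x : R, is_derive x 1 f (df x)) ->
  (forall x, `|x - a| <= `|b - a| -> `|df x| <= eps) -> `|f b - f a| <= eps * `|b - a|.
Proof.
move=> dfE dfe; have cf := is_derive_continuous dfE.
have [ab|ba] := leP a b.
  rewrite [X in _ * X]ger0_norm ?subr_ge0//.
  apply: (MVT_abs ab (fun x _ => dfE x)); first exact: continuous_subspaceT.
  move=> x; rewrite in_itv/= => /andP[ax xb]; apply: dfe.
  by rewrite !ger0_norm ?subr_ge0 ?lerD2r// ltW.
rewrite distrC [X in _ * X]distrC [X in _ * X]ger0_norm ?subr_ge0 ?(ltW ba)//.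
apply: (MVT_abs (ltW ba) (fun x _ => dfE x)); first exact: continuous_subspaceT.
move=> x; rewrite in_itv/= => /andP[ax xb]; apply: dfe.
by rewrite !ler0_norm ?subr_le0 ?(ltW ba) ?(ltW xb)// lerN2 lerD2r ltW.
Qed.

(** The difference quotient of u_n differs from f_n by at most K h, uniformly in n, so
    f_n(t) is Cauchy and its limit is the derivative of the limit. *)
Lemma derive_limit (u f g : nat -> R -> R) (v : R -> R) (K tau : R) :
  (forall n (t : R), is_derive t 1 (u n) (f n t)) ->
  (forall n (t : R), is_derive t 1 (f n) (g n t)) ->
  (forall n t, `|g n t| <= K) ->
  (forall t, `|t| < tau -> u n t @[n --> \oo] --> v t) ->
  exists w : R -> R, forall t : R, `|t| < tau ->
    f n t @[n --> \oo] --> w t /\ is_derive t 1 v (w t).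
Proof.
move=> du df gK uv.
have K0 : 0 <= K by exact: le_trans (gK 0%N 0).
have T n (t h : R) : `|u n (t + h) - u n t - h * f n t| <= K * h ^+ 2.
  pose q (s : R) := u n s - s * f n t.
  have dq (s : R) : is_derive s 1 q (f n s - f n t).
    have d2 : is_derive s 1 (fun s : R => s * f n t) (f n t).
      by apply: is_derive_eq; rewrite /GRing.scale /=; ring.
    exact: is_deriveB (du n s) d2.
  have -> : u n (t + h) - u n t - h * f n t = q (t + h) - q t by rewrite /q; ring.
  have tht : t + h - t = h by ring.
  have := @MVT_dist q _ t (t + h) (K * `|h|) dq.
  rewrite tht -mulrA -expr2 real_normK ?num_real//; apply => x xt.
  apply: (le_trans (MVT_dist (df n) (fun y _ => gK n y))).
  by rewrite ler_wpM2l.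
have I h t : `|t| < tau -> `|h| < tau - `|t| -> `|t + h| < tau.
  by move=> tt ht; rewrite (le_lt_trans (ler_normD _ _))// addrC -ltrBrDr.
have C t : `|t| < tau -> cvg (f n t @[n --> \oo]).
  move=> tt; apply/cauchy_cvgP; apply: cauchy_exP => e e0.
  have K1 : 0 < 1 + K by rewrite ltr_pwDl.
  pose h := Num.min (e / (4 * (1 + K))) ((tau - `|t|) / 2).
  have h0 : 0 < h by rewrite lt_min !divr_gt0 ?mulr_gt0// subr_gt0.
  have hn0 : h != 0 by rewrite gt_eqF.
  have h1 : h <= e / (4 * (1 + K)) by rewrite ge_min lexx.
  have h2 : `|h| < tau - `|t|.
    rewrite gtr0_norm//; apply: (@le_lt_trans _ _ ((tau - `|t|) / 2)).
      by rewrite ge_min lexx orbT.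
    by rewrite ltr_pdivrMr// ltr_pMr ?subr_gt0// ltr1n.
  exists ((v (t + h) - v t) / h).
  have lim : u n (t + h) - u n t @[n --> \oo] --> v (t + h) - v t.
    by apply: cvgB; apply: uv => //; exact: I.
  have he : 0 < h * (e / 4) by rewrite mulr_gt0// divr_gt0.
  have /cvgrPdist_le/(_ _ he) := lim.
  apply: filterS => n /= hn.
  rewrite /ball /=.
  have Th := T n t h.
  have -> : (v (t + h) - v t) / h - f n t = (v (t + h) - v t - h * f n t) / h by field.
  rewrite normrM normfV (gtr0_norm h0) ltr_pdivrMr//.
  have -> : v (t + h) - v t - h * f n t = (v (t + h) - v t - (u n (t + h) - u n t)) +
     (u n (t + h) - u n t - h * f n t) by ring.
  apply: (le_lt_trans (ler_normD _ _)).
  have : K * h ^+ 2 <= h * (e / 4).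
    rewrite ler_pdivlMr ?mulr_gt0// in h1.
    rewrite expr2 mulrA mulrC ler_wpM2l ?(ltW h0)//.
    rewrite ler_pdivlMr//; nra.
  nra.
exists (fun t => lim (f n t @[n --> \oo])) => t tt; split; first exact: C.
have r0 : 0 < tau - `|t| by rewrite subr_gt0.
apply: (@is_derive_quadratic v t _ K _ r0) => h ht.
have lim : `|u n (t + h) - u n t - h * f n t| @[n --> \oo] -->
    `|v (t + h) - v t - h * lim (f n t @[n --> \oo])|.
  apply: cvg_norm; apply: cvgB; last by apply: cvgMr; exact: C.
  by apply: cvgB; apply: uv => //; exact: I.
rewrite -(cvg_lim _ lim)//; apply: limr_le; first by apply/cvg_ex; eexists; exact: lim.
by apply: nearW => n; exact: T.
Qed.

(** The first derivative need not be bounded uniformly: bounds are only asked from the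
    second one on. *)
Lemma derive_limit_iter (D : nat -> nat -> R -> R) (K : nat -> R) (v : R -> R) (tau : R) :
  0 < tau ->
  (forall k n (t : R), is_derive t 1 (D k n) (D k.+1 n t)) ->
  (forall k n t, `|D k.+2 n t| <= K k) ->
  (forall t, `|t| < tau -> D 0%N n t @[n --> \oo] --> v t) ->
  forall k t, `|t| < tau -> D k n t @[n --> \oo] --> derive1n k v t.
Proof.
move=> tau0 dD bD Dv; elim=> [|k IH] t tt; first exact: Dv.
have [w hw] := derive_limit (dD k) (dD k.+1) (bD k) IH.
by have [c e] := hw t tt; rewrite derive1nS derive1E derive_val.
Qed.
End derivative_of_limit.

(** * Logarithms of characteristic functions *)

Section log_char_bounds.
Context (R : realType).
Implicit Types (l : seq (R * R)) (t A : R).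

(** What makes all the estimates uniform along an approximating sequence. *)
Definition spectrum_bounded A l :=
  [/\ forall p, p \in l -> 0 <= p.1, forall p, p \in l -> `|p.2| <= A & psum 2 l <= A].

Lemma spectrum_sum_bound A l (f : R * R -> R) (K : R) : spectrum_bounded A l ->
  0 <= K -> (forall p, p \in l -> `|f p| <= K * p.2 ^+ 2) ->
  `|\sum_(p <- l) p.1 * f p| <= K * A.
Proof.
move=> [w _ p2] K0 fK; apply: (le_trans (ler_norm_sum _ _ _)).
apply: (@le_trans _ _ (K * psum 2 l)); last by rewrite ler_wpM2l.
rewrite /psum mulr_sumr [leLHS]big_seq [leRHS]big_seq; apply: ler_sum => p pl.
rewrite normrM (ger0_norm (w p pl)) mulrCA ler_wpM2l ?w//; exact: fK.
Qed.

Lemma spectrum_ge0 A l : spectrum_bounded A l -> 0 <= A.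
Proof.
move=> [w _ p2]; apply: le_trans p2; rewrite /psum big_seq sumr_ge0// => p pl.
by rewrite mulr_ge0 ?w ?sqr_ge0.
Qed.

Lemma resum_bound A l k t : spectrum_bounded A l ->
  `|resumR k.+2 l t| <= A ^+ k * A /\ `|resumI k.+2 l t| <= A ^+ k * A.
Proof.
move=> sl; have A0 := spectrum_ge0 sl; have [w pA _] := sl.
have b p r : p \in l -> `|r| <= 1 -> `|p.2 ^+ k.+2 * r| <= A ^+ k * p.2 ^+ 2.
  move=> pl r1; rewrite normrM normrX -addn2 exprD -[p.2 ^+ 2](real_normK (num_real _)) -mulrA.
  apply: ler_pM; rewrite ?exprn_ge0 ?mulr_ge0 ?exprn_ge0//.
    by apply: lerXn2r; rewrite ?nnegrE ?pA.
  by rewrite ler_piMr ?exprn_ge0.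
split; rewrite /resumR /resumI.
  under eq_bigr do rewrite -mulrA.
  by apply: spectrum_sum_bound => // [|p pl]; [exact: exprn_ge0|apply: b => //; exact: respR_le1].
under eq_bigr do rewrite -mulrA.
by apply: spectrum_sum_bound => // [|p pl]; [exact: exprn_ge0|apply: b => //; exact: respI_le1].
Qed.

Lemma logmod_ge A l t : spectrum_bounded A l -> - (t ^+ 2 * A) <= logmod l t.
Proof.
move=> [w _ p2]; apply: (@le_trans _ _ (- (t ^+ 2 * psum 2 l))).
  by rewrite lerN2 ler_wpM2l ?sqr_ge0.
rewrite /psum /logmod mulr_sumr -sumrN [leLHS]big_seq [leRHS]big_seq.
apply: ler_sum => p pl.
have -> : - (t ^+ 2 * (p.1 * p.2 ^+ 2)) = p.1 * - (t ^+ 2 * p.2 ^+ 2) by ring.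
apply: ler_wpM2l; first exact: w.
rewrite lerN2 ler_pdivrMl//.
have h : 0 <= (2 * (p.2 * t)) ^+ 2 by exact: sqr_ge0.
apply: (le_trans (le_ln1Dx _)); first by rewrite (lt_le_trans _ h)// ltrN10.
by rewrite le_eqVlt; apply/orP; left; apply/eqP; ring.
Qed.

Lemma logmod_le0 A l t : spectrum_bounded A l -> logmod l t <= 0.
Proof.
move=> [w _ _]; rewrite /logmod big_seq sumr_le0// => p pl.
by rewrite mulr_ge0_le0 ?w// oppr_le0 mulr_ge0// ln_ge0// lerDl sqr_ge0.
Qed.

(** The derivative of atan(2 s)/2 - s is at most 2 |s|, so the argument is quadratic in
    t with a constant that only involves the second power sum, although the first power
    sum is unbounded along the sequence. *)
Lemma logarg_abs A l t : spectrum_bounded A l -> `|logarg l t| <= 2 * t ^+ 2 * A.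
Proof.
move=> sl; have A0 := spectrum_ge0 sl; rewrite -[logarg l t]subr0 -(logarg0 l).
have h := @MVT_dist R (logarg l) (fun t => resumR 1 l t - psum 1 l) 0 t (2 * `|t| * A)
  (logarg_derive l).
apply: le_trans (h _) _.
  move=> x; rewrite !subr0 => xt; rewrite /resumR /psum -sumrB.
  have -> : \sum_(p <- l) (p.1 * p.2 ^+ 1 * respR 1 (p.2 * x) - p.1 * p.2 ^+ 1) =
      \sum_(p <- l) p.1 * (p.2 * (respR 1 (p.2 * x) - 1)).
    by apply: eq_bigr => p _; rewrite expr1; ring.
  apply: spectrum_sum_bound => // p pl.
  rewrite (resp1 _).1; have d0 := resp_den_gt0 (p.2 * x).
  have -> : p.2 * ((1 + (2 * (p.2 * x)) ^+ 2)^-1 - 1) =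
     - (p.2 * (2 * (p.2 * x)) ^+ 2 / (1 + (2 * (p.2 * x)) ^+ 2)).
    by field; rewrite gt_eqF.
  rewrite normrN normrM normfV (gtr0_norm d0) ler_pdivrMr// normrM normrX.
  rewrite -[p.2 ^+ 2](real_normK (num_real _)) -[(2 * (p.2 * x)) ^+ 2 in leRHS](real_normK (num_real _)).
  rewrite !normrM (@ger0_norm _ 2)//.
  set a := `|p.2|; set y := `|x| in xt *.
  have a0 : 0 <= a by exact: normr_ge0. have y0 : 0 <= y by exact: normr_ge0.
  have h1 : y * a ^+ 2 * (1 + (2 * (a * y)) ^+ 2) <= `|t| * a ^+ 2 * (1 + (2 * (a * y)) ^+ 2).
    rewrite -subr_ge0 (_ : _ - _ = (`|t| - y) * (a ^+ 2 * (1 + (2 * (a * y)) ^+ 2))); last by ring.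
    by rewrite mulr_ge0 ?subr_ge0// mulr_ge0 ?addr_ge0 ?sqr_ge0.
  have h2 : a * (2 * (a * y)) ^+ 2 <= 2 * (y * a ^+ 2 * (1 + (2 * (a * y)) ^+ 2)).
    rewrite -subr_ge0 (_ : _ - _ = 2 * y * a ^+ 2 * ((1 - a * y) ^+ 2 + 3 * (a * y) ^+ 2)); last by ring.
    apply: mulr_ge0; last by rewrite addr_ge0 ?sqr_ge0 ?mulr_ge0 ?sqr_ge0.
    by apply: mulr_ge0; [exact: mulr_ge0|exact: sqr_ge0].
  apply: (le_trans h2).
  rewrite [leRHS](_ : _ = 2 * (`|t| * a ^+ 2 * (1 + (2 * (a * y)) ^+ 2))); last by ring.
  by rewrite ler_pM2l.
rewrite subr0 -(real_normK (num_real t)) le_eqVlt; apply/orP; left; apply/eqP; ring.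
Qed.

(** Coefficients of the real and imaginary resolvent sums in the successive derivatives:
    w^k has derivative 2 i k w^(k+1). *)
Fixpoint logcoef (a b : R) k : R * R :=
  if k is k'.+1 then
    (2 * k%:R * (logcoef a b k').2, - (2 * k%:R * (logcoef a b k').1))
  else (a, b).

(** The successive derivatives of the modulus (a = 0, b = -1, c = 0) and of the argument
    (a = 1, b = 0, c the first power sum). *)
Definition logderiv (f0 : R -> R) (a b c : R) l k t :=
  if k is k'.+1 then
    (logcoef a b k').1 * resumR k l t + (logcoef a b k').2 * resumI k l t -
    (if k' is 0%N then c else 0)
  else f0 t.

Lemma logderivP f0 a b c l : (forall t, is_derive t 1 f0 (a * resumR 1 l t + b * resumI 1 l t - c)) ->
  forall k t, is_derive t 1 (logderiv f0 a b c l k) (logderiv f0 a b c l k.+1 t).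
Proof.
move=> d0 [|k] t; first exact: d0.
have [dR dI] := resum_derive k.+1 l t.
have h := is_deriveB (is_deriveD (is_deriveZ (logcoef a b k).1 dR) (is_deriveZ (logcoef a b k).2 dI))
  (is_derive_cst (if k is 0%N then c else 0) t 1).
by apply: (is_derive_eq h); rewrite /logderiv /= /GRing.scale /= !subr0; ring.
Qed.

Lemma logderiv_bound f0 a b c A l k t : spectrum_bounded A l ->
  `|logderiv f0 a b c l k.+2 t| <=
    (`|(logcoef a b k.+1).1| + `|(logcoef a b k.+1).2|) * (A ^+ k * A).
Proof.
move=> sl; have [h1 h2] := resum_bound k t sl; rewrite /logderiv subr0.
rewrite (le_trans (ler_normD _ _))// mulrDl !normrM.
by rewrite lerD// ler_wpM2l.
Qed.

Lemma logderiv_at0 f0 a b c l :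
  logderiv f0 a b c l 3 0 = - 8 * a * psum 3 l /\ logderiv f0 a b c l 4 0 = - 48 * b * psum 4 l.
Proof.
rewrite /logderiv (resum0 3 l).1 (resum0 3 l).2 (resum0 4 l).1 (resum0 4 l).2 /=.
by split; ring.
Qed.
End log_char_bounds.
Section limit_cumulants.
Context (R : realType).

(** Inverts the formula through which the principal argument is defined. *)
Lemma half_angle (th : R) : `|th| <= 1 -> 2 * atan (sin th / (1 + cos th)) = th.
Proof.
move=> th1; pose x := th / 2; have thx : th = x *+ 2 by rewrite /x -(mulr_natr _ 2); field.
have px : - (pi / 2) < x < pi / 2.
  have p1 := @pihalf_ge1 R.
  have : `|x| < pi / 2.
    rewrite /x normrM normfV (@ger0_norm _ 2)//; apply: lt_le_trans p1.
    by rewrite ltr_pdivrMr// mul1r (le_lt_trans th1)// ltr1n.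
  by rewrite ltr_norml.
have c0 : cos x != 0 by rewrite gt_eqF// cos_gt0_pihalf.
have -> : sin th / (1 + cos th) = tan x.
  rewrite thx sin_mulr2n cos_mulr2n /tan -(mulr_natr (cos x * sin x) 2) -(mulr_natr (cos x ^+ 2) 2).
  by field; rewrite c0 /= addrCA subrr addr0 mulf_neq0 ?expf_neq0.
by rewrite tanK ?in_itv// thx -(mulr_natr x 2) mulrC.
Qed.

Variables (l : nat -> seq (R * R)) (A : R) (C S : R -> R).
Hypothesis sl : forall n, spectrum_bounded A (l n).
Hypothesis hC : forall t, expR (logmod (l n) t) * cos (logarg (l n) t) @[n --> \oo] --> C t.
Hypothesis hS : forall t, expR (logmod (l n) t) * sin (logarg (l n) t) @[n --> \oo] --> S t.

Let L t := Cln (Complex (C t) (S t)).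

Lemma limit_sqmod t : expR (logmod (l n) t) ^+ 2 @[n --> \oo] --> C t ^+ 2 + S t ^+ 2 /\
  0 < C t ^+ 2 + S t ^+ 2.
Proof.
have c : expR (logmod (l n) t) ^+ 2 @[n --> \oo] --> C t ^+ 2 + S t ^+ 2.
  have E n : expR (logmod (l n) t) ^+ 2 =
    (expR (logmod (l n) t) * cos (logarg (l n) t)) ^+ 2 +
    (expR (logmod (l n) t) * sin (logarg (l n) t)) ^+ 2.
    by rewrite !exprMn -mulrDr cos2Dsin2 mulr1.
  under eq_fun do rewrite E.
  by under eq_fun do rewrite !expr2; rewrite !expr2; apply: cvgD; apply: cvgM; (exact: hC || exact: hS).
split => //; apply: (@lt_le_trans _ _ (expR (- (t ^+ 2 * A)) ^+ 2)); first by rewrite exprn_gt0// expR_gt0.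
rewrite -(cvg_lim _ c)//; apply: limr_ge; first by apply/cvg_ex; eexists; exact: c.
apply: nearW => n; apply: lerXn2r; rewrite ?nnegrE ?expR_ge0//.
by rewrite ler_expR; exact: logmod_ge (sl n).
Qed.

Lemma limit_expmod t : expR (logmod (l n) t) @[n --> \oo] --> Normc.normc (Complex (C t) (S t)) /\
  0 < Normc.normc (Complex (C t) (S t)).
Proof.
have [c p] := limit_sqmod t; rewrite /Normc.normc; split; last by rewrite sqrtr_gt0.
have -> : (fun n => expR (logmod (l n) t)) = (fun n => Num.sqrt (expR (logmod (l n) t) ^+ 2)).
  by apply/funext => n; rewrite sqrtr_sqr ger0_norm ?expR_ge0.
exact: (continuous_cvg _ (@sqrt_continuous R _) c).
Qed.

Lemma limit_mod t : logmod (l n) t @[n --> \oo] --> complex.Re (L t).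
Proof.
have [c p] := limit_expmod t; rewrite /L /Cln /=.
have -> : (fun n => logmod (l n) t) = (fun n => ln (expR (logmod (l n) t))).
  by apply/funext => n; rewrite expRK.
exact: (continuous_cvg _ (continuous_ln p) c).
Qed.

(** The bound on t keeps the argument away from the cut, uniformly in n. *)
Lemma limit_arg t : 2 * t ^+ 2 * A <= 1 -> logarg (l n) t @[n --> \oo] --> complex.Im (L t).
Proof.
move=> t1; have [c p] := limit_expmod t.
have th1 n : `|logarg (l n) t| <= 1 by exact: le_trans (logarg_abs t (sl n)) t1.
have cos0 n : 0 <= cos (logarg (l n) t).
  apply: cos_ge0_pihalf; rewrite -ler_norml; apply: (le_trans (th1 n)); exact: pihalf_ge1.
set r := Normc.normc (Complex (C t) (S t)) in c p *.
have C0 : 0 <= C t.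
  rewrite -(cvg_lim _ (@hC t))//; apply: limr_ge; first by apply/cvg_ex; eexists; exact: hC.
  by apply: nearW => n; rewrite mulr_ge0// expR_ge0.
have d0 : 0 < r + C t by rewrite ltr_pwDl.
rewrite /L /Cln /= -/r gt_eqF//.
have E n : logarg (l n) t = 2 * atan (expR (logmod (l n) t) * sin (logarg (l n) t) /
   (expR (logmod (l n) t) + expR (logmod (l n) t) * cos (logarg (l n) t))).
  rewrite -[LHS](half_angle (th1 n)); congr (_ * atan _).
  have c1 : 1 + cos (logarg (l n) t) != 0 by rewrite gt_eqF// ltr_pwDl.
  have e0 := expR_gt0 (logmod (l n) t); field; rewrite c1 /=.
  by rewrite -[X in X + _]mulr1 -mulrDr mulf_neq0// gt_eqF.
rewrite (_ : (fun n => logarg (l n) t) = (fun n => 2 * atan (expR (logmod (l n) t) * sin (logarg (l n) t) /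
   (expR (logmod (l n) t) + expR (logmod (l n) t) * cos (logarg (l n) t))))); last by apply/funext.
apply: cvgMr; apply: (continuous_cvg _ (@continuous_atan R _)).
apply: cvgM; first exact: hS.
by apply: cvgV; [rewrite gt_eqF|apply: cvgD; [exact: c|exact: hC]].
Qed.

(** The third and fourth derivatives at 0 of the limit are the limits of those of the
    approximations, which are power sums. *)
Lemma limit_cumulants : exists p3 p4 : R,
  [/\ psum 3 (l n) @[n --> \oo] --> p3, psum 4 (l n) @[n --> \oo] --> p4,
      Cderive1n 3 L 0 = Complex 0 (- 8 * p3) & Cderive1n 4 L 0 = Complex (48 * p4) 0].
Proof.
have A0 := spectrum_ge0 (sl 0%N).
pose tau : R := (2 * (1 + A))^-1.
have tau0 : 0 < tau by rewrite invr_gt0 mulr_gt0// ltr_pwDl.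
have ht t : `|t| < tau -> 2 * t ^+ 2 * A <= 1.
  rewrite -(real_normK (num_real t)) /tau => h.
  have n0 := normr_ge0 t; have h1 : `|t| * (2 * (1 + A)) < 1.
    by rewrite -ltr_pdivlMr ?mul1r// mulr_gt0// ltr_pwDl.
  nra.
have dm n (t : R) : is_derive t 1 (logmod (l n)) (0 * resumR 1 (l n) t + (-1) * resumI 1 (l n) t - 0).
  by rewrite mul0r add0r mulN1r subr0; exact: logmod_derive.
have da n (t : R) : is_derive t 1 (logarg (l n)) (1 * resumR 1 (l n) t + 0 * resumI 1 (l n) t - psum 1 (l n)).
  by rewrite mul0r addr0 mul1r; exact: logarg_derive.
pose Dm k n t := logderiv (logmod (l n)) 0 (-1) 0 (l n) k t.
pose Da k n t := logderiv (logarg (l n)) 1 0 (psum 1 (l n)) (l n) k t.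
have m := @derive_limit_iter R Dm _ (fun t => complex.Re (L t)) tau tau0
  (fun k n => logderivP (dm n) k) (fun k n t => logderiv_bound _ _ _ _ k t (sl n))
  (fun t _ => @limit_mod t).
have a := @derive_limit_iter R Da _ (fun t => complex.Im (L t)) tau tau0
  (fun k n => logderivP (da n) k) (fun k n t => logderiv_bound _ _ _ _ k t (sl n))
  (fun t tt => @limit_arg t (ht t tt)).
have z0 : `|0 : R| < tau by rewrite normr0.
have c4 := m 4 0 z0; have c3 := m 3 0 z0; have c2 := a 4 0 z0; have c1 := a 3 0 z0.
rewrite (_ : (fun n => Da 3 n 0) = (fun n => - 8 * psum 3 (l n))) in c1; last first.
  by apply/funext => n; rewrite /Da (logderiv_at0 _ _ _ _ _).1 mulr1.
rewrite (_ : (fun n => Da 4 n 0) = (fun n => 0)) in c2; last first.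
  by apply/funext => n; rewrite /Da (logderiv_at0 _ _ _ _ _).2 mulr0 mul0r.
rewrite (_ : (fun n => Dm 3 n 0) = (fun n => 0)) in c3; last first.
  by apply/funext => n; rewrite /Dm (logderiv_at0 _ _ _ _ _).1 mulr0 mul0r.
rewrite (_ : (fun n => Dm 4 n 0) = (fun n => 48 * psum 4 (l n))) in c4; last first.
  by apply/funext => n; rewrite /Dm (logderiv_at0 _ _ _ _ _).2 mulrN1 opprK.
set a3 := derive1n 3 _ 0 in c1; set a4 := derive1n 4 _ 0 in c2.
set m3 := derive1n 3 _ 0 in c3; set m4 := derive1n 4 _ 0 in c4.
have E2 : a4 = 0 by exact: (cvg_unique _ c2 (cvg_cst _)).
have E3 : m3 = 0 by exact: (cvg_unique _ c3 (cvg_cst _)).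
exists (- 8^-1 * a3), (48^-1 * m4); split.
- rewrite (_ : (fun n => psum 3 (l n)) = (fun n => - 8^-1 * (- 8 * psum 3 (l n)))).
    by apply: cvgMr; exact: c1.
  by apply/funext => n; rewrite mulrA mulrNN mulVf// mul1r.
- rewrite (_ : (fun n => psum 4 (l n)) = (fun n => 48^-1 * (48 * psum 4 (l n)))).
    by apply: cvgMr; exact: c4.
  by apply/funext => n; rewrite mulrA mulVf// mul1r.
- rewrite /Cderive1n -/a3 -/m3 E3; congr Complex; by rewrite mulrA mulrNN mulfV// mul1r.
- rewrite /Cderive1n -/a4 -/m4 E2; congr Complex; by rewrite mulrA mulfV// mul1r.
Qed.
End limit_cumulants.

(** * Lower bound for the logarithms *)

Lemma resum_second_order (R : realType) (l : seq (R * R)) (s : R) :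
  - resumI 1 l s = - (2 * s) * (\sum_(p <- l) p.1 * (p.2 ^+ 2 * respR 1 (p.2 * s))) /\
  resumR 1 l s - psum 1 l = - (2 * s) * (\sum_(p <- l) p.1 * (p.2 ^+ 2 * respI 1 (p.2 * s))).
Proof.
rewrite /resumI /resumR /psum -sumrN -sumrB !mulr_sumr.
split; apply: eq_bigr => p _; have [-> ->] := resp1 (p.2 * s).
  by rewrite expr1; ring.
by rewrite expr1; field; rewrite resp_den_neq0.
Qed.

Section log_char_lower_bound.
Context (R : realType) (A : R) (l : seq (R * R)).
Hypothesis sl : spectrum_bounded A l.
Implicit Types s t nu : R.

Let a3 := psum 3 l - psum 2 l.
Let b := pdev l.
Let SR s := \sum_(p <- l) p.1 * (p.2 ^+ 2 * respR 1 (p.2 * s)).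
Let SI s := \sum_(p <- l) p.1 * (p.2 ^+ 2 * respI 1 (p.2 * s)).
Let BR s := \sum_(p <- l) p.1 * (p.2 ^+ 2 * (p.2 - 1) ^+ 2 * respR 1 (p.2 * s)).
Let BI s := \sum_(p <- l) p.1 * (p.2 ^+ 2 * (p.2 - 1) ^+ 2 * respI 1 (p.2 * s)).

Lemma resp2E s : respR 2 s = (1 - (2 * s) ^+ 2) / (1 + (2 * s) ^+ 2) ^+ 2 /\
  respI 2 s = 4 * s / (1 + (2 * s) ^+ 2) ^+ 2.
Proof.
rewrite !(respRS 1) !(respIS 1); have [E1 E2] := resp1 s; rewrite E1 E2; have d := resp_den_neq0 s.
by split; field; rewrite d.
Qed.

(** Real and imaginary parts of w(a t) - w(t) = 2 i t (a - 1) w(t)^2 - 4 t^2 (a - 1)^2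
    w(t)^2 w(a t), summed with the weights a^2. *)
Lemma spectral_expansion s :
  SR s = psum 2 l * respR 1 s +
    (- (2 * s * respI 2 s) * a3 - 4 * s ^+ 2 * (respR 2 s * BR s - respI 2 s * BI s)) /\
  SI s = psum 2 l * respI 1 s +
    (2 * s * respR 2 s * a3 - 4 * s ^+ 2 * (respR 2 s * BI s + respI 2 s * BR s)).
Proof.
have [R2 I2] := resp2E s; have [R1 I1] := resp1 s.
have d := resp_den_neq0 s.
rewrite /a3 /SR /SI /BR /BI /psum -sumrB !mulr_sumr !mulr_suml.
have cmb (f1 f2 f3 f4 : R * R -> R) : \sum_(p <- l) f1 p + (\sum_(p <- l) f2 p -
    4 * s ^+ 2 * (\sum_(p <- l) f3 p - \sum_(p <- l) f4 p)) =
    \sum_(p <- l) (f1 p + (f2 p - 4 * s ^+ 2 * (f3 p - f4 p))).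
  by rewrite big_split /= sumrB -mulr_sumr sumrB.
have cmb' (f1 f2 f3 f4 : R * R -> R) : \sum_(p <- l) f1 p + (\sum_(p <- l) f2 p -
    4 * s ^+ 2 * (\sum_(p <- l) f3 p + \sum_(p <- l) f4 p)) =
    \sum_(p <- l) (f1 p + (f2 p - 4 * s ^+ 2 * (f3 p + f4 p))).
  by rewrite big_split /= sumrB -mulr_sumr big_split.
rewrite cmb cmb'; split; apply: eq_bigr => p _;
  have [Rp Ip] := resp1 (p.2 * s); have dp := resp_den_neq0 (p.2 * s);
  rewrite Rp Ip ?R1 R2 I2 ?I1; field; by rewrite d dp.
Qed.

Let wpos : forall p, p \in l -> 0 <= p.1. Proof. by case: sl. Qed.

Let b0 : 0 <= b.
Proof.
rewrite /b pdevE big_seq sumr_ge0// => p pl.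
by rewrite mulr_ge0 ?wpos// mulr_ge0 ?sqr_ge0.
Qed.

Let Bbound (f : R * R -> R) K : (forall p, p \in l -> `|f p| <= K) ->
  `|\sum_(p <- l) p.1 * (p.2 ^+ 2 * (p.2 - 1) ^+ 2 * f p)| <= K * b.
Proof.
move=> fK; apply: (le_trans (ler_norm_sum _ _ _)).
rewrite /b pdevE mulr_sumr [leLHS]big_seq [leRHS]big_seq; apply: ler_sum => p pl.
have h : 0 <= p.1 * (p.2 ^+ 2 * (p.2 - 1) ^+ 2).
  by rewrite mulr_ge0 ?wpos// mulr_ge0 ?sqr_ge0.
by rewrite mulrA normrM (ger0_norm h) mulrC ler_wpM2r// fK.
Qed.

Let BR_b s : `|BR s| <= b.
Proof. by rewrite -[leRHS]mul1r; apply: Bbound => p _; exact: respR_le1. Qed.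
Let BI_b s : `|BI s| <= b.
Proof. by rewrite -[leRHS]mul1r; apply: Bbound => p _; exact: respI_le1. Qed.

Let BR_dist s : 0 <= s -> `|BR s - b| <= 2 * A * s * b.
Proof.
move=> s0; have -> : BR s - b = \sum_(p <- l) p.1 * (p.2 ^+ 2 * (p.2 - 1) ^+ 2 * (respR 1 (p.2 * s) - 1)).
  by rewrite /BR /b pdevE -sumrB; apply: eq_bigr => p _; ring.
apply: Bbound => p pl; have [_ /(_ p pl) pA _] := sl.
rewrite (resp1 _).1; set x := 2 * (p.2 * s); have d0 : 0 < 1 + x ^+ 2 := resp_den_gt0 _.
have -> : (1 + x ^+ 2)^-1 - 1 = - (x ^+ 2 / (1 + x ^+ 2)) by field; rewrite gt_eqF.
have xA : `|x| <= 2 * A * s.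
  by rewrite /x !normrM (@ger0_norm _ 2)// (ger0_norm s0) -mulrA ler_wpM2l// ler_wpM2r.
apply: le_trans xA; rewrite normrN normrM normfV (gtr0_norm d0) ler_pdivrMr// normrX.
rewrite -(real_normK (num_real x)); have := normr_ge0 x; set y := `|x| => y0.
rewrite -subr_ge0 (_ : _ - _ = y * ((1 - y / 2) ^+ 2 + 3 / 4 * y ^+ 2)); last by field.
by rewrite mulr_ge0// addr_ge0 ?sqr_ge0// mulr_ge0 ?sqr_ge0.
Qed.

Lemma resp2_bounds s : 0 <= s ->
  [/\ `|respR 2 s - 1| <= 12 * s ^+ 2, `|respI 2 s| <= 4 * s &
      `|4 * s ^+ 2 * respI 2 s - 16 * s ^+ 3| <= 128 * s ^+ 5].
Proof.
move=> s0; have [-> ->] := resp2E s; set D := 1 + (2 * s) ^+ 2.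
have d0 : 0 < D := resp_den_gt0 s; have d1 : 1 <= D by rewrite lerDl sqr_ge0.
have D2 : 0 < D ^+ 2 by rewrite exprn_gt0.
have D21 : 1 <= D ^+ 2 by rewrite expr_ge1// ltW.
have dn : D != 0 by rewrite gt_eqF.
have P (k n : nat) : 0 <= k%:R * s ^+ n := mulr_ge0 (ler0n R k) (exprn_ge0 n s0).
split.
- have -> : (1 - (2 * s) ^+ 2) / D ^+ 2 - 1 = - ((12 * s ^+ 2 + 16 * s ^+ 4) / D ^+ 2).
    by rewrite /D; field; rewrite -/D dn.
  rewrite normrN ger0_norm; last by exact: divr_ge0 (addr_ge0 (P 12%N 2%N) (P 16%N 4%N)) (ltW D2).
  rewrite ler_pdivrMr// -subr_ge0 /D.
  rewrite (_ : _ - _ = 80 * s ^+ 4 + 192 * s ^+ 6); last by ring.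
  exact: addr_ge0 (P 80%N 4%N) (P 192%N 6%N).
- rewrite ger0_norm; last by rewrite divr_ge0 ?mulr_ge0// ltW.
  by rewrite ler_pdivrMr// ler_peMr ?mulr_ge0.
- have -> : 4 * s ^+ 2 * (4 * s / D ^+ 2) - 16 * s ^+ 3 =
     - (16 * s ^+ 3 * (8 * s ^+ 2 + 16 * s ^+ 4) / D ^+ 2).
    by rewrite /D; field; rewrite -/D dn.
  rewrite normrN ger0_norm; last first.
    exact: divr_ge0 (mulr_ge0 (P 16%N 3%N) (addr_ge0 (P 8%N 2%N) (P 16%N 4%N))) (ltW D2).
  rewrite ler_pdivrMr// -subr_ge0 /D.
  rewrite (_ : _ - _ = 768 * s ^+ 7 + 2048 * s ^+ 9); last by ring.
  exact: addr_ge0 (P 768%N 7%N) (P 2048%N 9%N).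
Qed.

Variable nu : R.
Let g : seq (R * R) := [:: (nu, 1)].
Let dl := `|psum 2 l - nu|.
Let m := `|a3| + b.

Let gI s : - resumI 1 g s = - (2 * s) * (nu * respR 1 s) /\
  resumR 1 g s - psum 1 g = - (2 * s) * (nu * respI 1 s).
Proof.
have [-> ->] := resum_second_order g s.
have E (f : R -> R) : \sum_(p <- g) p.1 * (p.2 ^+ 2 * f (p.2 * s)) = nu * f s.
  transitivity (nu * (1 ^+ 2 * f (1 * s))); first exact: big_seq1.
  by rewrite expr1n !mul1r.
by rewrite (E (respR 1)) (E (respI 1)).
Qed.

(** Of the remainder, w(t)^2 contributes the term 16 a_3 s^3, as its imaginary part is 4
    s to first order. *)
Lemma modulus_defect_derive_bound s t : 0 <= s -> s <= t -> t <= 1 ->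
  `|(- resumI 1 l s - - resumI 1 g s) - (8 * b + 16 * a3) * s ^+ 3| <=
  2 * t * dl + (128 + 16 * A) * t ^+ 4 * m.
Proof.
move=> s0 st t1; have [E1 _] := resum_second_order l s; have [E2 _] := gI s.
have [E3 _] := spectral_expansion s; have [hR hI hI3] := resp2_bounds s0.
have t0 := le_trans s0 st; have A0 := spectrum_ge0 sl; have s1 := le_trans st t1.
rewrite E1 E2 -/(SR s) E3.
have -> : - (2 * s) * (psum 2 l * respR 1 s + (- (2 * s * respI 2 s) * a3 -
     4 * s ^+ 2 * (respR 2 s * BR s - respI 2 s * BI s))) - - (2 * s) * (nu * respR 1 s) -
     (8 * b + 16 * a3) * s ^+ 3 =
   - (2 * s * ((psum 2 l - nu) * respR 1 s)) + (4 * s ^+ 2 * respI 2 s - 16 * s ^+ 3) * a3 +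
   8 * s ^+ 3 * ((respR 2 s - 1) * BR s + (BR s - b) - respI 2 s * BI s) by ring.
have s4 : s ^+ 4 <= t ^+ 4 by apply: lerXn2r; rewrite ?nnegrE.
have s5 : s ^+ 5 <= t ^+ 4.
  by rewrite exprSr; apply: le_trans s4; rewrite ler_piMr ?exprn_ge0.
have B1 : `|- (2 * s * ((psum 2 l - nu) * respR 1 s))| <= 2 * t * dl.
  rewrite normrN normrM (@ger0_norm _ (2 * s)) ?mulr_ge0// (normrM (psum 2 l - nu)) -/dl.
  apply: ler_pM; [by rewrite mulr_ge0|by rewrite mulr_ge0 ?normr_ge0|by rewrite ler_wpM2l|].
  by apply: ler_piMr; [exact: normr_ge0|exact: respR_le1].
have B2 : `|(4 * s ^+ 2 * respI 2 s - 16 * s ^+ 3) * a3| <= 128 * t ^+ 4 * `|a3|.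
  by rewrite normrM ler_wpM2r// (le_trans hI3)// ler_wpM2l.
have B3 : `|(respR 2 s - 1) * BR s + (BR s - b) - respI 2 s * BI s| <= (16 + 2 * A) * s * b.
  apply: (@le_trans _ _ (12 * s ^+ 2 * b + 2 * A * s * b + 4 * s * b)).
    apply: (le_trans (ler_normB _ _)); apply: lerD.
      apply: (le_trans (ler_normD _ _)); apply: lerD; last exact: BR_dist.
      by rewrite normrM; apply: ler_pM.
    by rewrite normrM; apply: ler_pM.
  have s2 : s ^+ 2 <= s by rewrite expr2 ler_piMr.
  have : s ^+ 2 * b <= s * b by exact: ler_wpM2r.
  lra.
have B4 : `|8 * s ^+ 3 * ((respR 2 s - 1) * BR s + (BR s - b) - respI 2 s * BI s)| <=
   8 * (16 + 2 * A) * t ^+ 4 * b.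
  rewrite normrM (@ger0_norm _ (8 * s ^+ 3)) ?mulr_ge0 ?exprn_ge0//.
  apply: (@le_trans _ _ (8 * s ^+ 3 * ((16 + 2 * A) * s * b))).
    by rewrite ler_wpM2l// mulr_ge0// exprn_ge0.
  rewrite (_ : _ * _ = 8 * (16 + 2 * A) * s ^+ 4 * b); last by ring.
  by apply: ler_wpM2r => //; apply: ler_wpM2l => //; rewrite mulr_ge0// addr_ge0// mulr_ge0.
apply: (le_trans (ler_normD _ _)); apply: (le_trans (lerD (ler_normD _ _) (lexx _))).
apply: (le_trans (lerD (lerD B1 B2) B4)).
have : 0 <= A * (t ^+ 4 * `|a3|) by rewrite !mulr_ge0// exprn_ge0.
rewrite /m; lra.
Qed.

Lemma argument_defect_derive_bound s t : 0 <= s -> s <= t -> t <= 1 ->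
  `|((resumR 1 l s - psum 1 l) - (resumR 1 g s - psum 1 g)) + 4 * a3 * s ^+ 2| <=
  2 * t * dl + 48 * t ^+ 3 * m.
Proof.
move=> s0 st t1; have [_ E1] := resum_second_order l s; have [_ E2] := gI s.
have [_ E3] := spectral_expansion s; have [hR hI hI3] := resp2_bounds s0.
have t0 := le_trans s0 st; have s1 := le_trans st t1.
rewrite E1 E2 -/(SI s) E3.
have -> : - (2 * s) * (psum 2 l * respI 1 s + (2 * s * respR 2 s * a3 -
     4 * s ^+ 2 * (respR 2 s * BI s + respI 2 s * BR s))) - - (2 * s) * (nu * respI 1 s) +
     4 * a3 * s ^+ 2 =
   - (2 * s * ((psum 2 l - nu) * respI 1 s)) + - (4 * s ^+ 2 * (respR 2 s - 1) * a3) +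
   8 * s ^+ 3 * (respR 2 s * BI s + respI 2 s * BR s) by ring.
have s3 : s ^+ 3 <= t ^+ 3 by apply: lerXn2r; rewrite ?nnegrE.
have s4 : s ^+ 4 <= t ^+ 3.
  by rewrite exprSr; apply: le_trans s3; rewrite ler_piMr ?exprn_ge0.
have B1 : `|- (2 * s * ((psum 2 l - nu) * respI 1 s))| <= 2 * t * dl.
  rewrite normrN normrM (@ger0_norm _ (2 * s)) ?mulr_ge0// (normrM (psum 2 l - nu)) -/dl.
  apply: ler_pM; [by rewrite mulr_ge0|by rewrite mulr_ge0 ?normr_ge0|by rewrite ler_wpM2l|].
  by apply: ler_piMr; [exact: normr_ge0|exact: respI_le1].
have B2 : `|- (4 * s ^+ 2 * (respR 2 s - 1) * a3)| <= 48 * t ^+ 3 * `|a3|.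
  rewrite normrN normrM ler_wpM2r// normrM (@ger0_norm _ (4 * s ^+ 2)) ?mulr_ge0 ?sqr_ge0//.
  apply: (@le_trans _ _ (4 * s ^+ 2 * (12 * s ^+ 2))).
    by rewrite ler_wpM2l// mulr_ge0// sqr_ge0.
  by rewrite (_ : _ * _ = 48 * s ^+ 4) ?ler_wpM2l//; ring.
have B3 : `|respR 2 s * BI s + respI 2 s * BR s| <= 2 * b.
  apply: (le_trans (ler_normD _ _)).
  rewrite (normrM (respR 2 s)) (normrM (respI 2 s)) (_ : 2 * b = 1 * b + 1 * b); last by ring.
  apply: lerD; apply: ler_pM => //; [exact: respR_le1|exact: respI_le1].
have B4 : `|8 * s ^+ 3 * (respR 2 s * BI s + respI 2 s * BR s)| <= 16 * t ^+ 3 * b.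
  rewrite normrM (@ger0_norm _ (8 * s ^+ 3)) ?mulr_ge0 ?exprn_ge0//.
  apply: (@le_trans _ _ (8 * t ^+ 3 * (2 * b))); last by rewrite le_eqVlt; apply/orP; left; apply/eqP; ring.
  by apply: ler_pM => //; rewrite ?mulr_ge0 ?exprn_ge0 ?ler_wpM2l.
apply: (le_trans (ler_normD _ _)); apply: (le_trans (lerD (ler_normD _ _) (lexx _))).
apply: (le_trans (lerD (lerD B1 B2) B4)).
have : 0 <= t ^+ 3 * b by rewrite mulr_ge0// exprn_ge0.
rewrite /m; lra.
Qed.

(** Integrating the two defects gives Delta theta = -(4/3) t^3 a_3 and Delta rho = (2 b
    + 4 a_3) t^4 up to a factor t smaller; the condition on t lets the left-hand side
    absorb these remainders. *)
Lemma log_char_lower t : 0 <= t -> t <= 1 -> 7 * (128 + 16 * A) * t <= 1 ->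
  t ^+ 4 * m <= 6 * `|logarg l t - logarg g t| + `|logmod l t - logmod g t| + 14 * dl.
Proof.
move=> t0 t1 tK; have A0 := spectrum_ge0 sl.
pose K := 128 + 16 * A.
have dM (s : R) : is_derive s 1 (fun s : R => logmod l s - logmod g s - (2 * b + 4 * a3) * s ^+ 4)
    ((- resumI 1 l s - - resumI 1 g s) - (8 * b + 16 * a3) * s ^+ 3).
  have d1 := is_deriveB (logmod_derive l s) (logmod_derive g s).
  have d2 : is_derive s 1 (fun s : R => (2 * b + 4 * a3) * s ^+ 4) ((8 * b + 16 * a3) * s ^+ 3).
    by apply: is_derive_eq; rewrite /GRing.scale /=; ring.
  exact: is_deriveB d1 d2.
have dA (s : R) : is_derive s 1 (fun s : R => logarg l s - logarg g s + 4 / 3 * a3 * s ^+ 3)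
    (((resumR 1 l s - psum 1 l) - (resumR 1 g s - psum 1 g)) + 4 * a3 * s ^+ 2).
  have d1 := is_deriveB (logarg_derive l s) (logarg_derive g s).
  have d2 : is_derive s 1 (fun s : R => 4 / 3 * a3 * s ^+ 3) (4 * a3 * s ^+ 2).
    by apply: is_derive_eq; rewrite /GRing.scale /=; field.
  exact: is_deriveD d1 d2.
have hM : `|logmod l t - logmod g t - (2 * b + 4 * a3) * t ^+ 4| <= (2 * t * dl + K * t ^+ 4 * m) * t.
  have := @MVT_abs R _ _ 0 t (2 * t * dl + K * t ^+ 4 * m) t0 (fun s _ => dM s).
  rewrite !logmod0 expr0n mulr0 !subr0; apply.
    by apply: continuous_subspaceT; exact: is_derive_continuous dM.
  by move=> s; rewrite in_itv /= => /andP[s0 st]; apply: modulus_defect_derive_bound => //; exact: ltW.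
have hA : `|logarg l t - logarg g t + 4 / 3 * a3 * t ^+ 3| <= (2 * t * dl + 48 * t ^+ 3 * m) * t.
  have := @MVT_abs R _ _ 0 t (2 * t * dl + 48 * t ^+ 3 * m) t0 (fun s _ => dA s).
  rewrite !logarg0 expr0n mulr0 addr0 !subr0; apply.
    by apply: continuous_subspaceT; exact: is_derive_continuous dA.
  by move=> s; rewrite in_itv /= => /andP[s0 st]; apply: argument_defect_derive_bound => //; exact: ltW.
set EA := logarg l t - logarg g t in hA *; set EM := logmod l t - logmod g t in hM *.
have dl0 : 0 <= dl by exact: normr_ge0. have m0 : 0 <= m by rewrite addr_ge0.
have t4 : 0 <= t ^+ 4 by rewrite exprn_ge0.
have t20 : t * t * dl <= dl.
  by rewrite ler_piMl// mulr_ile1.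
have t30 : t * (t * t * dl) <= dl by apply: le_trans t20; rewrite ler_piMl// mulr_ge0// mulr_ge0.
have h1 : 4 / 3 * t ^+ 3 * `|a3| <= `|EA| + (2 * t * dl + 48 * t ^+ 3 * m) * t.
  have -> : 4 / 3 * t ^+ 3 * `|a3| = `|4 / 3 * a3 * t ^+ 3|.
    rewrite (_ : 4 / 3 * a3 * t ^+ 3 = 4 / 3 * t ^+ 3 * a3); last by ring.
    by rewrite normrM ger0_norm// mulr_ge0 ?exprn_ge0// divr_ge0.
  have -> : 4 / 3 * a3 * t ^+ 3 = (EA + 4 / 3 * a3 * t ^+ 3) - EA by ring.
  by rewrite (le_trans (ler_normB _ _))// addrC lerD2l.
have h2 : 2 * t ^+ 4 * b <= `|EM| + 4 * t ^+ 4 * `|a3| + (2 * t * dl + K * t ^+ 4 * m) * t.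
  have -> : 2 * t ^+ 4 * b = EM - 4 * t ^+ 4 * a3 - (EM - (2 * b + 4 * a3) * t ^+ 4) by ring.
  apply: le_trans (ler_norm _) _; apply: (le_trans (ler_normB _ _)); apply: lerD => //.
  apply: (le_trans (ler_normB _ _)); rewrite lerD2l normrM ger0_norm// mulr_ge0//.
have h3 : 8 * t ^+ 4 * `|a3| <= 6 * t * (`|EA| + (2 * t * dl + 48 * t ^+ 3 * m) * t).
  have -> : 8 * t ^+ 4 * `|a3| = 6 * t * (4 / 3 * t ^+ 3 * `|a3|) by field.
  by rewrite ler_wpM2l// mulr_ge0.
have h4 : 6 * t * `|EA| <= 6 * `|EA| by rewrite ler_wpM2r// ler_piMr.
have tm : 0 <= t ^+ 4 * m by rewrite mulr_ge0.
have h5 : t * (t ^+ 4 * m) * (7 * K) <= t ^+ 4 * m.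
  by rewrite (_ : _ * (7 * K) = 7 * K * t * (t ^+ 4 * m)); [rewrite ler_piMl|ring].
have h6 : 0 <= A * (t * (t ^+ 4 * m)) by rewrite mulr_ge0// mulr_ge0.
have tb : 0 <= t ^+ 4 * b by rewrite mulr_ge0.
have ta : 0 <= t ^+ 4 * `|a3| by rewrite mulr_ge0.
have e1 : 6 * t * ((2 * t * dl + 48 * t ^+ 3 * m) * t) = 12 * (t * (t * t * dl)) + 288 * (t * (t ^+ 4 * m)) by ring.
have e2 : (2 * t * dl + K * t ^+ 4 * m) * t = 2 * (t * t * dl) + 128 * (t * (t ^+ 4 * m)) + 16 * (A * (t * (t ^+ 4 * m))).
  by rewrite /K; ring.
have e3 : t * (t ^+ 4 * m) * (7 * K) = 896 * (t * (t ^+ 4 * m)) + 112 * (A * (t * (t ^+ 4 * m))).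
  by rewrite /K; ring.
have e4 : t ^+ 4 * m = t ^+ 4 * `|a3| + t ^+ 4 * b by rewrite /m; ring.
rewrite mulrDr e1 in h3; rewrite e2 in h2; rewrite e3 in h5.
have tt : 0 <= t * (t ^+ 4 * m) by rewrite mulr_ge0.
move: h2 h3 h4 h5 h6 t20 t30 tb ta tt; rewrite e4.
lra.
Qed.
End log_char_lower_bound.

(** * Mean-square limits *)

(** In a sector near 1 the logarithm is Lipschitz: the moduli differ by at most the
    distance E, and the sine of the angle difference is the cross product divided by the
    moduli. *)
Lemma polar_dist (R : realType) (r1 r2 a1 a2 E : R) :
  - 2^-1 <= r1 -> r1 <= 0 -> - 2^-1 <= r2 -> r2 <= 0 -> `|a1| <= 2^-1 -> `|a2| <= 2^-1 ->
  E = `|expR r1 * cos a1 - expR r2 * cos a2| + `|expR r1 * sin a1 - expR r2 * sin a2| ->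
  `|r1 - r2| <= 2 * E /\ `|a1 - a2| <= 8 * E.
Proof.
move=> r1l r1u r2l r2u a1u a2u EE.
have half (r : R) : - 2^-1 <= r -> 2^-1 <= expR r.
  by move=> h; apply: le_trans (expR_ge1Dx r); rewrite -lerBlDl; apply: le_trans h; lra.
have h1 := half _ r1l; have h2 := half _ r2l.
have e1 : expR r1 <= 1 by rewrite expR_le1. have e2 : expR r2 <= 1 by rewrite expR_le1.
have E0 : 0 <= E by rewrite EE addr_ge0.
have p1 := expR_gt0 r1; have p2 := expR_gt0 r2.
have [dC dCE] : exists z, z = expR r1 * cos a1 - expR r2 * cos a2 by eexists.
have [dS dSE] : exists z, z = expR r1 * sin a1 - expR r2 * sin a2 by eexists.
rewrite -dCE -dSE in EE.
have D1 : `|expR r1 - expR r2| <= E.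
  have s : 0 < expR r1 + expR r2 by rewrite addr_gt0.
  rewrite -(ler_pM2r s) -[X in _ * X <= _](gtr0_norm s) -normrM.
  have -> : (expR r1 - expR r2) * (expR r1 + expR r2) =
      dC * (expR r1 * cos a1 + expR r2 * cos a2) + dS * (expR r1 * sin a1 + expR r2 * sin a2).
    have c1 := cos2Dsin2 a1; have c2 := cos2Dsin2 a2.
    transitivity (expR r1 ^+ 2 * (cos a1 ^+ 2 + sin a1 ^+ 2) - expR r2 ^+ 2 * (cos a2 ^+ 2 + sin a2 ^+ 2)).
      by rewrite c1 c2; ring.
    by rewrite dCE dSE; ring.
  have bd (x y : R) : `|x| <= 1 -> `|y| <= 1 -> `|expR r1 * x + expR r2 * y| <= expR r1 + expR r2.
    move=> hx hy; apply: (le_trans (ler_normD _ _)); rewrite !normrM (gtr0_norm p1) (gtr0_norm p2).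
    by apply: lerD; rewrite ler_piMr// ltW.
  rewrite (le_trans (ler_normD _ _))// EE mulrDl !normrM.
  by apply: lerD; apply: ler_wpM2l => //; apply: bd; rewrite ?cos_max ?sin_max.
have lin (x y : R) : 2^-1 <= expR y -> x - y <= 2 * `|expR x - expR y|.
  move=> hy; have hx := expR_ge1Dx (x - y).
  have [xy|xy] := leP (x - y) 0; first by apply: (le_trans xy); rewrite mulr_ge0.
  have e : expR x = expR y * expR (x - y) by rewrite -expRD; congr expR; ring.
  have : expR y * (x - y) <= expR x - expR y by rewrite e; have := expR_gt0 y; nra.
  have := ler_norm (expR x - expR y); nra.
split.
  rewrite ler_norml lerNl; apply/andP; split.
    rewrite opprB; apply: (le_trans (lin _ _ h1)); rewrite distrC; lra.
  by apply: (le_trans (lin _ _ h2)); lra.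
have dist : `|a1 - a2| <= 1 by rewrite (le_trans (ler_normB _ _))//; lra.
have sinL (x : R) : `|sin x| <= `|x|.
  have := @MVT_dist R sin cos 0 x 1 (fun x => is_derive_sin x) (fun y _ => cos_max y).
  by rewrite sin0 !subr0 mul1r.
have sinlow (x : R) : `|x| <= 1 -> `|x| <= 2 * `|sin x|.
  move=> x1.
  have d (y : R) : is_derive y 1 (fun y : R => y - sin y) (1 - cos y).
    exact: is_deriveB (is_derive_id y 1) (is_derive_sin y).
  have h := @MVT_dist R _ _ 0 x 2^-1 d.
  have : `|x - sin x| <= 2^-1 * `|x|.
    rewrite -[x in X in X <= _]subr0; have := h _; rewrite sin0 !subr0; apply=> y; rewrite subr0 => yx.
    have -> : 1 - cos y = 2 * sin (y / 2) ^+ 2.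
      have -> : cos y = cos (y / 2 *+ 2) by congr cos; rewrite -(mulr_natr _ 2); field.
      by rewrite cos_mulr2n -(mulr_natr _ 2) cos2sin2; ring.
    have s0 : 0 <= 2 * sin (y / 2) ^+ 2 := mulr_ge0 (ler0n R 2) (sqr_ge0 _).
    rewrite (ger0_norm s0) -(real_normK (num_real (sin (y / 2)))).
    have sh := sinL (y / 2).
    have hy : `|y / 2| = `|y| / 2 by rewrite normrM (@ger0_norm _ 2^-1).
    have := normr_ge0 (sin (y / 2)); have := le_trans yx x1; have := normr_ge0 y; rewrite hy in sh; nra.
  have := ler_normD (x - sin x) (sin x); rewrite subrK; lra.
apply: (le_trans (sinlow _ dist)).
have : `|sin (a1 - a2)| * (expR r1 * expR r2) <= E.
  rewrite -[X in _ * X <= _](@ger0_norm _ (expR r1 * expR r2)) ?mulr_ge0 ?expR_ge0// -normrM.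
  have -> : sin (a1 - a2) * (expR r1 * expR r2) = dS * (expR r2 * cos a2) - dC * (expR r2 * sin a2).
    by rewrite sinB dSE dCE; ring.
  rewrite (le_trans (ler_normB _ _))// EE addrC !normrM (gtr0_norm p2).
  have c1 (x : R) : `|x| <= 1 -> expR r2 * `|x| <= 1.
    by move=> hx; rewrite mulr_ile1// ltW.
  by apply: lerD; apply: ler_piMr => //; apply: c1; rewrite ?cos_max ?sin_max.
have : 4^-1 <= expR r1 * expR r2 by nra.
have := normr_ge0 (sin (a1 - a2)); nra.
Qed.

Section mean_square_limit.
Context (R : realType) d (T : measurableType d) (P : probability T R).
Variables (F : T -> R) (Y : nat -> T -> R).
Hypotheses (sF : sqint P F) (sY : forall n, sqint P (Y n)).
Hypothesis FY : \int[P]_w ((F w - Y n w) ^+ 2) @[n --> \oo] --> 0.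

Let sD n : sqint P (fun w => F w - Y n w).
Proof. by have := sqintD sF (sqintZ (-1) (sY n)); under eq_fun do rewrite mulN1r. Qed.

Let PT : P setT = 1%E. Proof. exact: probability_setT. Qed.
Let Pfin : (P setT < +oo)%E. Proof. by rewrite PT ltry. Qed.

Let small (u : nat -> R) (K : R) : 0 <= K ->
  (forall e n, 0 < e -> `|u n| <= K * e + (1 + e^-1) * \int[P]_w ((F w - Y n w) ^+ 2)) ->
  u n @[n --> \oo] --> 0.
Proof.
move=> K0 hu; apply/cvgr0Pnorm_le => e e0.
have e1 : 0 < e / (2 * (1 + K)) by rewrite divr_gt0// mulr_gt0// ltr_pwDl.
set e' := e / _ in e1; have c0 : 0 < 1 + e'^-1 by rewrite ltr_pwDl// invr_ge0 ltW.
have e2 : 0 < e / (2 * (1 + e'^-1)) by rewrite divr_gt0// mulr_gt0.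
have /cvgr0Pnorm_le/(_ _ e2) := FY; apply: filterS => n /(le_trans (ler_norm _)) hn.
apply: (le_trans (hu e' n e1)).
have h1 : K * e' <= e / 2.
  rewrite /e' mulrA ler_pdivrMr ?mulr_gt0 ?ltr_pwDl//.
  have -> : e / 2 * (2 * (1 + K)) = e + K * e by field.
  by rewrite lerDr ltW.
have h2 : (1 + e'^-1) * \int[P]_w ((F w - Y n w) ^+ 2) <= e / 2.
  rewrite mulrC -ler_pdivlMr//; apply: (le_trans hn).
  by rewrite invfM mulrA.
by rewrite (splitr e) lerD.
Qed.

Lemma mean_square_lip_cvg h L : 0 <= L -> lip L h ->
  (forall Z, measurable_fun setT Z -> P.-integrable setT (EFin \o Z) ->
    P.-integrable setT (EFin \o (fun w => h (Z w)))) ->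
  \int[P]_w h (Y n w) @[n --> \oo] --> \int[P]_w h (F w).
Proof.
move=> L0 lh ih; apply/subr_cvg0.
apply: (small (K := L ^+ 2) _ _ (u := fun n => \int[P]_w h (Y n w) - \int[P]_w h (F w))) => [|e n e0]; first exact: sqr_ge0.
have i1 := ih _ sF.1 (sqint_integrable sF).
have i2 := ih _ (sY n).1 (sqint_integrable (sY n)).
have iD := (sD n).2.
rewrite -(RintegralB measurableT i2 i1).
apply: (le_trans (le_normr_Rintegral measurableT (integrable_subR i2 i1))).
have j1 : P.-integrable setT (EFin \o (fun _ : T => L ^+ 2 * e)) by exact: integrable_cstR.
have j2 := integrable_scaleR (1 + e^-1) iD.
have -> : L ^+ 2 * e = \int[P]_(_ in setT) (L ^+ 2 * e) by rewrite Rintegral_cst// [X in fine X](PT : P _ = _) mulr1.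
rewrite -(RintegralZl (1 + e^-1) measurableT iD) -(RintegralD measurableT j1 j2).
apply: le_Rintegral => //; [exact: integrable_norm (integrable_subR i2 i1)|exact: integrable_addR j1 j2|].
move=> w _; apply: (le_trans (lh _ _)); rewrite distrC; set D := F w - Y n w.
have [z0 z1] : 0 <= e^-1 /\ e * e^-1 = 1 by rewrite invr_ge0 ltW// mulfV// gt_eqF.
have h1 := mulr_ge0 z0 (sqr_ge0 (e * L - `|D|)).
have h2 : 0 <= D ^+ 2 by exact: sqr_ge0.
have h3 : 0 <= L ^+ 2 * e by rewrite mulr_ge0 ?sqr_ge0// ltW.
have h4 : 0 <= e^-1 * D ^+ 2 by rewrite mulr_ge0.
have k1 : e^-1 * (e * L - `|D|) ^+ 2 = e * e^-1 * (e * L ^+ 2 - 2 * L * `|D|) + e^-1 * `|D| ^+ 2 by ring.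
rewrite k1 z1 mul1r real_normK ?num_real// in h1.
rewrite mulrDl mul1r; lra.
Qed.

(** Y^2 - F^2 = D^2 - 2 F D with D = F - Y, and 2 |F D| <= e F^2 + D^2 / e. *)
Lemma mean_square_second_moment :
  \int[P]_w (Y n w ^+ 2) @[n --> \oo] --> \int[P]_w (F w ^+ 2).
Proof.
have F0 : 0 <= \int[P]_w (F w ^+ 2) by apply: Rintegral_ge0 => // w _; exact: sqr_ge0.
apply/subr_cvg0.
apply: (small (K := \int[P]_w (F w ^+ 2)) _ _ (u := fun n => \int[P]_w (Y n w ^+ 2) - \int[P]_w (F w ^+ 2))) => // e n e0.
have iD := (sD n).2; have iF := sF.2; have iY := (sY n).2.
rewrite -(RintegralB measurableT iY iF).
apply: (le_trans (le_normr_Rintegral measurableT (integrable_subR iY iF))).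
have j1 := integrable_scaleR e iF; have j2 := integrable_scaleR (1 + e^-1) iD.
rewrite [X in X + _]mulrC -(RintegralZl e measurableT iF) -(RintegralZl (1 + e^-1) measurableT iD).
rewrite -(RintegralD measurableT j1 j2).
apply: le_Rintegral => //; [exact: integrable_norm (integrable_subR iY iF)|exact: integrable_addR j1 j2|].
move=> w _; set x := F w; set D := F w - Y n w.
have -> : Y n w ^+ 2 - x ^+ 2 = D ^+ 2 - 2 * x * D by rewrite /D /x; ring.
have [z0 z1] : 0 <= e^-1 /\ e * e^-1 = 1 by rewrite invr_ge0 ltW// mulfV// gt_eqF.
have h1 := mulr_ge0 z0 (sqr_ge0 (e * x - D)).
have h2 := mulr_ge0 z0 (sqr_ge0 (e * x + D)).
have h3 := sqr_ge0 D.
have k1 : e^-1 * (e * x - D) ^+ 2 = e * e^-1 * (e * x ^+ 2 - 2 * x * D) + e^-1 * D ^+ 2 by ring.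
have k2 : e^-1 * (e * x + D) ^+ 2 = e * e^-1 * (e * x ^+ 2 + 2 * x * D) + e^-1 * D ^+ 2 by ring.
rewrite k1 z1 mul1r in h1; rewrite k2 z1 mul1r in h2.
rewrite mulrDl mul1r ler_norml; apply/andP; split; lra.
Qed.
End mean_square_limit.
Section chaos_approximation.
Context (R : realType) d (T : measurableType d) (P : probability T R).
Context (H : completeNormedModType R) (dot : {dot H for idfun}) (X : H -> {RV P >-> R}).
Hypotheses (isoX : isonormal dot X) (ip : is_inner_product dot).

Lemma elem_I2_stein (s : seq (R * H)) : unit_vectors s ->
  exists (Y : T -> R) (l : seq (R * R)),
    [/\ measurable_fun setT Y, gamma_stein P Y l,
        forall p, p \in l -> 0 <= p.1 /\ p.2 ^+ 2 <= psum 2 l &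
        \forall w \ae P, elem_I2 X s w = Y w].
Proof.
move=> us; have [m [G [alpha [gG ae]]]] := elem_I2_diag isoX ip us.
exists (fun w => \sum_i alpha i * (G i w ^+ 2 - 1)), [seq (1, alpha i) | i <- enum 'I_m].
split => //.
- case: gG => mG _ _; apply: measurable_sum => i; apply: measurable_funM => //.
  by apply: measurable_funB => //; exact: measurable_funX.
- exact: gaussian_quadratic_stein.
- move=> p /mapP[i _ ->] /=; split => //; rewrite /psum big_map big_enum /= (bigD1 i)//= mul1r.
  by rewrite lerDl sumr_ge0// => j _; rewrite mul1r sqr_ge0.
Qed.

(** Dropping finitely many terms makes the second power sums, which tend to nu,
    uniformly bounded; a bound on every scale follows. *)
Lemma chaos_approximation (nu : R) (F : {RV P >-> R}) : 0 < nu -> wiener_chaos2 dot X F ->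
  'E_P[(fun w => (F w ^+ 2)%R)]%E = (2 * nu)%:E ->
  sqint P F /\ exists (Y : nat -> T -> R) (l : nat -> seq (R * R)),
    [/\ forall n, sqint P (Y n), forall n, gamma_stein P (Y n) (l n),
        forall n, spectrum_bounded (nu + 1) (l n),
        \int[P]_w ((F w - Y n w) ^+ 2) @[n --> \oo] --> 0 &
        psum 2 (l n) @[n --> \oo] --> nu].
Proof.
move=> nu0 [f _ [s [us _ cv]]]; rewrite unlock => EF2.
have mF : measurable_fun setT F by exact: measurable_funPT.
have sqI (g : T -> R) : measurable_fun setT g -> (\int[P]_w (g w ^+ 2)%:E < +oo)%E -> sqint P g.
  move=> mg gi; split => //; apply/integrableP; split.
    by apply/measurable_EFinP; exact: measurable_funX.
  rewrite (_ : (\int[P]_w _)%E = (\int[P]_w (g w ^+ 2)%:E)%E)//.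
  by apply: eq_integral => w _ /=; rewrite ger0_norm ?sqr_ge0.
have sF : sqint P F by apply: sqI => //; rewrite EF2 ltry.
split => //.
have [Y hY] : {Y : nat -> T -> R & forall n, exists l : seq (R * R),
    [/\ measurable_fun setT (Y n), gamma_stein P (Y n) l,
        forall p, p \in l -> 0 <= p.1 /\ p.2 ^+ 2 <= psum 2 l &
        \forall w \ae P, elem_I2 X (s n) w = Y n w]}.
  apply: (@choice _ _ (fun n Y => exists l : seq (R * R),
    [/\ measurable_fun setT Y, gamma_stein P Y l,
        forall p, p \in l -> 0 <= p.1 /\ p.2 ^+ 2 <= psum 2 l &
        \forall w \ae P, elem_I2 X (s n) w = Y w])) => n.
  exact: elem_I2_stein.
have [l hl] := @choice _ _ (fun n (l : seq (R * R)) => [/\ measurable_fun setT (Y n), gamma_stein P (Y n) l,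
        forall p, p \in l -> 0 <= p.1 /\ p.2 ^+ 2 <= psum 2 l &
        \forall w \ae P, elem_I2 X (s n) w = Y n w]) hY.
have eY n : 'E_P[(fun w => (F w - elem_I2 X (s n) w) ^+ 2)%R]%E = (\int[P]_w ((F w - Y n w) ^+ 2)%:E)%E.
  rewrite unlock; have [mY _ _ ae] := hl n.
  have me : measurable_fun setT (elem_I2 X (s n)).
    apply: measurable_sum => p; apply: measurable_funM => //; apply: measurable_funB => //.
    by apply: measurable_funX; exact: measurable_funPT.
  apply: ae_eq_integral => //.
  - by apply/measurable_EFinP; apply: measurable_funX; exact: measurable_funB.
  - by apply/measurable_EFinP; apply: measurable_funX; exact: measurable_funB.
  - by apply: filterS ae => w /= -> _.
move: cv; under eq_fun do rewrite eY.
move=> /fine_cvgP[[N1 _ fin] cv].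
have sY n : (N1 <= n)%N -> sqint P (Y n).
  move=> Nn; have [mY _ _ _] := hl n.
  have sD : sqint P (fun w => F w - Y n w).
    apply: sqI; first exact: measurable_funB.
    by rewrite ltey_eq; apply/orP; left; exact: fin.
  have := sqintD sF (sqintZ (-1) sD); congr sqint; apply/funext => w; ring.
have sh (u : nat -> R) (a : R) N : u n @[n --> \oo] --> a -> u (n + N)%N @[n --> \oo] --> a.
  move=> ua; apply: (@cvg_comp _ _ _ (addn^~ N) u _ _ _ _ ua); exact: cvg_addnr.
have cv1 := sh _ _ N1 cv.
have p2 : psum 2 (l (n + N1)%N) @[n --> \oo] --> nu.
  have c := mean_square_second_moment sF (fun n => sY (n + N1)%N (leq_addl n N1)) cv1.
  have E : \int[P]_w (F w ^+ 2) = 2 * nu by rewrite /Rintegral EF2.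
  rewrite E in c.
  have -> : nu = 2^-1 * (2 * nu) by field.
  have -> : (fun n => psum 2 (l (n + N1)%N)) = (fun n => 2^-1 * \int[P]_w (Y (n + N1)%N w ^+ 2)).
    apply/funext => n; have sYn := sY (n + N1)%N (leq_addl n N1); have [_ st _ _] := hl (n + N1)%N.
    have PT : P setT = 1%E by exact: probability_setT.
    by rewrite (stein_second_moment PT sYn.1 (sqint_integrable sYn) st sYn.2); field.
  by apply: cvgMr; exact: c.
have /cvgrPdist_le/(_ _ ltr01)[N2 _ hN2] := p2.
exists (fun n => Y (n + N2 + N1)%N), (fun n => l (n + N2 + N1)%N); split.
- by move=> n; apply: sY; exact: leq_addl.
- by move=> n; have [] := hl (n + N2 + N1)%N.
- move=> n; have [_ _ w _] := hl (n + N2 + N1)%N.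
  have p2n : psum 2 (l (n + N2 + N1)%N) <= nu + 1.
    have := hN2 (n + N2)%N (leq_addl n N2); rewrite distrC => h.
    by rewrite -lerBlDl (le_trans (ler_norm _)).
  split => //; first by move=> p /w[].
  move=> p /w[_ h]; have nu1 : 0 <= nu + 1 by rewrite addr_ge0// ltW.
  rewrite -ler_sqr ?nnegrE// real_normK ?num_real//.
  by apply: (le_trans h); apply: (le_trans p2n); rewrite expr2 ler_peMl// lerDr ltW.
- exact: (sh _ _ N2 cv1).
- exact: (sh _ _ N2 p2).
Qed.
End chaos_approximation.

(** * The two bounds *)

Section test_functions.
Context (R : realType).

Lemma H2_lip (h : R -> R) : H2 h -> lip 1 h.
Proof.
move=> [dh _ h1 _] x y.
have d (z : R) : is_derive z 1 h (h^`()%classic z).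
  by rewrite derive1E; apply: derivableP; exact: dh.
by rewrite distrC [X in _ * X]distrC; exact: (MVT_dist d (fun z _ => h1 z)).
Qed.

Lemma H2_intro (h dh ddh : R -> R) : (forall x : R, is_derive x 1 h (dh x)) ->
  (forall x : R, is_derive x 1 dh (ddh x)) ->
  (forall x, `|dh x| <= 1) -> (forall x, `|ddh x| <= 1) -> H2 h.
Proof.
move=> d1 d2 b1 b2.
have E : h^`()%classic = dh.
  by apply/funext => x; rewrite derive1E; have d := d1 x; rewrite derive_val.
split.
- by move=> x; have [] := d1 x.
- by rewrite E; exact: is_derive_continuous d2.
- by rewrite E.
- rewrite E => -[x y] _ /=; rewrite distrC [X in _ * X]distrC.
  exact: (MVT_dist d2 (fun z _ => b2 z)).
Qed.

(** Dividing by t normalises the first derivative; the second one is then bounded by t. *)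
Lemma H2_wave (t : R) : 0 < t -> t <= 1 ->
  H2 (fun x => t^-1 * cos (t * x)) /\ H2 (fun x => t^-1 * sin (t * x)).
Proof.
move=> t0 t1; have tn : t != 0 by rewrite gt_eqF.
have b (u v : R) : `|u| <= 1 -> `|v| <= 1 -> `|u * v| <= 1.
  by move=> hu hv; rewrite normrM mulr_ile1.
have ta : `|t| <= 1 by rewrite gtr0_norm.
have tna : `|- t| <= 1 by rewrite normrN.
split.
  apply: (@H2_intro _ (fun x => - sin (t * x)) (fun x => - t * cos (t * x))).
  - by move=> x; apply: is_derive_eq; rewrite /GRing.scale /=; field.
  - by move=> x; apply: is_derive_eq; rewrite /GRing.scale /=; ring.
  - by move=> x; rewrite normrN sin_max.
  - by move=> x; apply: b => //; exact: cos_max.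
apply: (@H2_intro _ (fun x => cos (t * x)) (fun x => - t * sin (t * x))).
- by move=> x; apply: is_derive_eq; rewrite /GRing.scale /=; field.
- by move=> x; apply: is_derive_eq; rewrite /GRing.scale /=; ring.
- by move=> x; rewrite cos_max.
- by move=> x; apply: b => //; exact: sin_max.
Qed.

Lemma le_cvg (u v : nat -> R) (a b : R) : u n @[n --> \oo] --> a -> v n @[n --> \oo] --> b ->
  (forall n, u n <= v n) -> a <= b.
Proof.
move=> ua vb uv; rewrite -(cvg_lim _ ua)// -(cvg_lim _ vb)//.
by apply: ler_lim; [apply/cvg_ex; exists a|apply/cvg_ex; exists b|exact: nearW].
Qed.

(** The third derivative of log phi is - 8 i p_3, and i^3 = - i. *)
Lemma cumulant34 (m : {measure set R -> \bar R}) (p3 p4 : R) :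
  Cderive1n 3 (fun t => Cln (char_fun m t)) 0 = Complex 0 (- 8 * p3) ->
  Cderive1n 4 (fun t => Cln (char_fun m t)) 0 = Complex (48 * p4) 0 ->
  cumulant 3 m = Complex (8 * p3) 0 /\ cumulant 4 m = Complex (48 * p4) 0.
Proof.
move=> E3 E4; rewrite /cumulant E3 E4.
have i0 : Complex 0 1 != 0 :> R[i] by rewrite eq_complex /= oner_eq0 andbF.
have K (k : nat) (z w : R[i]) : z = Complex 0 1 ^+ k * w -> (Complex 0 1 ^+ k)^-1 * z = w.
  by move=> ->; rewrite mulKf// expf_neq0.
by split; apply: K; apply/eqP; rewrite !exprS expr0 eq_complex /=;
  apply/andP; split; apply/eqP; ring.
Qed.
End test_functions.

Section second_chaos.
Context (R : realType) (nu : R) (nu0 : 0 < nu).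
Context d (T : measurableType d) (P : probability T R) (F : {RV P >-> R}).
Variables (Y : nat -> T -> R) (l : nat -> seq (R * R)).
Hypotheses (sF : sqint P F) (sY : forall n, sqint P (Y n)).
Hypotheses (st : forall n, gamma_stein P (Y n) (l n)).
Hypotheses (sl : forall n, spectrum_bounded (nu + 1) (l n)).
Hypothesis FY : \int[P]_w ((F w - Y n w) ^+ 2) @[n --> \oo] --> 0.
Hypothesis p2 : psum 2 (l n) @[n --> \oo] --> nu.

Let PG : {measure set (measurableTypeR R) -> \bar R} := gamma_prob (nu / 2).
Let YG (x : R) := 2 * x - nu.
Let g : seq (R * R) := [:: (nu, 1)].
Let PT : P setT = 1%E. Proof. exact: probability_setT. Qed.
Let nu2 : 0 < nu / 2. Proof. by rewrite divr_gt0. Qed.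
Let PGT : PG setT = 1%E. Proof. exact: gamma_probT. Qed.
Let nuE : 2 * (nu / 2) = nu. Proof. by field. Qed.
Let stG : gamma_stein PG YG g /\ PG.-integrable setT (EFin \o YG).
Proof. by have := centered_gamma_stein nu2; rewrite nuE. Qed.
Let mYG : measurable_fun setT YG.
Proof. by case: stG => _ /integrableP[/measurable_EFinP]. Qed.
Let iF := sqint_integrable sF.
Let iY n := sqint_integrable (sY n).

Lemma law_chaos h : measurable_fun setT h -> P.-integrable setT (EFin \o (fun w => h (F w))) ->
  \int[distribution P F]_x h x = \int[P]_w h (F w).
Proof.
move=> mh ih; rewrite /Rintegral; congr fine.
have mh' : measurable_fun setT (EFin \o h) by exact/measurable_EFinP.
have := @integral_pushforward _ _ T _ R F sF.1 P setT (EFin \o h) mh' ih measurableT.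
by rewrite preimage_setT => <-; exact: eq_measure_integral.
Qed.

Lemma law_gamma h : measurable_fun setT h -> PG.-integrable setT (EFin \o (fun w => h (YG w))) ->
  \int[centered_gamma nu]_x h x = \int[PG]_w h (YG w).
Proof.
move=> mh ih; rewrite /Rintegral; congr fine.
have mh' : measurable_fun setT (EFin \o h) by exact/measurable_EFinP.
have := @integral_pushforward _ _ (measurableTypeR R) _ R YG mYG PG setT (EFin \o h) mh' ih measurableT.
by rewrite preimage_setT => <-; exact: eq_measure_integral.
Qed.

Let lcos t : lip `|t| (fun x : R => cos (t * x)).
Proof.
move=> x y; rewrite distrC (distrC x y).
have dc (z : R) : is_derive z 1 (fun z : R => cos (t * z)) (- t * sin (t * z)).
  by apply: is_derive_eq; rewrite /GRing.scale /=; ring.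
apply: (MVT_dist dc) => z _; rewrite normrM normrN ler_piMr//; exact: sin_max.
Qed.
Let lsin t : lip `|t| (fun x : R => sin (t * x)).
Proof.
move=> x y; rewrite distrC (distrC x y).
have dc (z : R) : is_derive z 1 (fun z : R => sin (t * z)) (t * cos (t * z)).
  by apply: is_derive_eq; rewrite /GRing.scale /=; ring.
apply: (MVT_dist dc) => z _; rewrite normrM ler_piMr//; exact: cos_max.
Qed.

Let C t := \int[P]_w cos (t * F w).
Let S t := \int[P]_w sin (t * F w).
Let CG t := \int[PG]_w cos (t * YG w).
Let SG t := \int[PG]_w sin (t * YG w).

Let hC t : expR (logmod (l n) t) * cos (logarg (l n) t) @[n --> \oo] --> C t.
Proof.
have -> : (fun n => expR (logmod (l n) t) * cos (logarg (l n) t)) = (fun n => \int[P]_w cos (t * Y n w)).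
  by apply/funext => n; rewrite (stein_char_fun PT (sY n).1 (iY n) (st n) t).1.
apply: (mean_square_lip_cvg sF sY FY (normr_ge0 t) (@lcos t)) => Z mZ iZ.
exact: (bcont_comp_integrable PT mZ (bcont_cos t)).
Qed.
Let hS t : expR (logmod (l n) t) * sin (logarg (l n) t) @[n --> \oo] --> S t.
Proof.
have -> : (fun n => expR (logmod (l n) t) * sin (logarg (l n) t)) = (fun n => \int[P]_w sin (t * Y n w)).
  by apply/funext => n; rewrite (stein_char_fun PT (sY n).1 (iY n) (st n) t).2.
apply: (mean_square_lip_cvg sF sY FY (normr_ge0 t) (@lsin t)) => Z mZ iZ.
exact: (bcont_comp_integrable PT mZ (bcont_sin t)).
Qed.
Let CGE t : CG t = expR (logmod g t) * cos (logarg g t).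
Proof. exact: (stein_char_fun PGT mYG stG.2 stG.1 t).1. Qed.
Let SGE t : SG t = expR (logmod g t) * sin (logarg g t).
Proof. exact: (stein_char_fun PGT mYG stG.2 stG.1 t).2. Qed.

Let charF t : char_fun (distribution P F) t = Complex (C t) (S t).
Proof.
have bc := bcont_cos t; have bs := bcont_sin t.
rewrite /char_fun (law_chaos (bcont_measurable bc) (bcont_comp_integrable PT sF.1 bc)).
by rewrite (law_chaos (bcont_measurable bs) (bcont_comp_integrable PT sF.1 bs)).
Qed.
Let charG t : char_fun (centered_gamma nu) t = Complex (CG t) (SG t).
Proof.
have bc := bcont_cos t; have bs := bcont_sin t.
rewrite /char_fun (law_gamma (bcont_measurable bc) (bcont_comp_integrable PGT mYG bc)).
by rewrite (law_gamma (bcont_measurable bs) (bcont_comp_integrable PGT mYG bs)).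
Qed.

Let pg r : psum r g = nu.
Proof.
transitivity (nu * 1 ^+ r); last by rewrite expr1n mulr1.
exact: big_seq1.
Qed.

Let sg : spectrum_bounded (nu + 1) g.
Proof.
split; [move=> p; rewrite inE => /eqP ->|move=> p; rewrite inE => /eqP ->|].
- exact: ltW.
- by rewrite normr1 lerDr ltW.
- by rewrite pg lerDl.
Qed.

(** The Gamma law is the constant sequence with the single scale 1 and weight nu. *)
Lemma Mdist_power_sums : exists p3 p4 : R,
  [/\ psum 3 (l n) @[n --> \oo] --> p3, psum 4 (l n) @[n --> \oo] --> p4 &
   Mdist (distribution P F) (centered_gamma nu) =
     Num.max (48 * `|p4 - nu|) (8 * `|p3 - nu|)].
Proof.
have [p3 [p4 [c3 c4 E3 E4]]] := limit_cumulants sl hC hS.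
have hCG t : expR (logmod ((fun _ : nat => g) n) t) * cos (logarg ((fun _ : nat => g) n) t) @[n --> \oo] --> CG t.
  by rewrite CGE; exact: cvg_cst.
have hSG t : expR (logmod ((fun _ : nat => g) n) t) * sin (logarg ((fun _ : nat => g) n) t) @[n --> \oo] --> SG t.
  by rewrite SGE; exact: cvg_cst.
have [q3 [q4 [d3 d4 G3 G4]]] := @limit_cumulants _ (fun _ : nat => g) _ _ _ (fun _ => sg) hCG hSG.
have q3E : q3 = nu by rewrite pg in d3; exact: (cvg_unique _ d3 (cvg_cst _)).
have q4E : q4 = nu by rewrite pg in d4; exact: (cvg_unique _ d4 (cvg_cst _)).
exists p3, p4; split => //.
have fF : (fun t => Cln (Complex (C t) (S t))) = (fun t => Cln (char_fun (distribution P F) t)).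
  by apply/funext => t; rewrite charF.
have fG : (fun t => Cln (Complex (CG t) (SG t))) = (fun t => Cln (char_fun (centered_gamma nu) t)).
  by apply/funext => t; rewrite charG.
rewrite fF in E3 E4; rewrite fG in G3 G4.
have [k3 k4] := cumulant34 E3 E4; have [j3 j4] := cumulant34 G3 G4.
rewrite /Mdist /cumulant_dist k3 k4 j3 j4 q3E q4E.
have nE (c x : R) : 0 <= c -> Normc.normc (Complex (c * x) 0 - Complex (c * nu) 0) = c * `|x - nu|.
  by move=> c0; rewrite /Normc.normc /= subr0 expr0n addr0 sqrtr_sqr -mulrBr normrM ger0_norm.
by rewrite !nE ?ler0n.
Qed.

(** The bound 2 |a_3| + 4 (a_4 - 2 a_3) is at most 10 |a_3| + 4 |a_4|, and the cumulants
    carry factors 8 and 48. *)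
Lemma d2_upper : (d2 (distribution P F) (centered_gamma nu) <=
  (2 * Mdist (distribution P F) (centered_gamma nu))%:E)%E.
Proof.
have [p3 [p4 [c3 c4 ->]]] := Mdist_power_sums.
apply: ge_ereal_sup => _ [h hH <-]; rewrite lee_fin.
have lh := H2_lip hH; have mh : measurable_fun setT h.
  by apply: continuous_measurable_fun; exact: lip_continuous ler01 lh.
have ih Z : measurable_fun setT Z -> P.-integrable setT (EFin \o Z) ->
    P.-integrable setT (EFin \o (fun w => h (Z w))).
  by move=> mZ iZ; exact: (lip_comp_integrable PT mZ iZ lh).
rewrite (law_chaos mh (ih _ sF.1 iF)).
rewrite (law_gamma mh (lip_comp_integrable PGT mYG stG.2 lh)).
have c := mean_square_lip_cvg sF sY FY ler01 lh ih.
have u : `|\int[P]_w h (Y n w) - \int[PG]_w h (YG w)| @[n --> \oo] -->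
    `|\int[P]_w h (F w) - \int[PG]_w h (YG w)|.
  by apply: cvg_norm; apply: cvgB => //; exact: cvg_cst.
have v : `|psum 2 (l n) - nu| + 2 * `|psum 3 (l n) - psum 2 (l n)| + 4 * pdev (l n) @[n --> \oo] -->
   `|nu - nu| + 2 * `|p3 - nu| + 4 * (p4 - 2 * p3 + nu).
  apply: cvgD; first apply: cvgD.
  - by apply: cvg_norm; apply: cvgB => //; exact: cvg_cst.
  - by apply: cvgMr; apply: cvg_norm; exact: cvgB.
  - apply: cvgMr; apply: cvgD => //; apply: cvgB => //; exact: cvgMr.
apply: (@le_trans _ _ (`|nu - nu| + 2 * `|p3 - nu| + 4 * (p4 - 2 * p3 + nu))).
  apply: (le_cvg u v) => n; have [w _ _] := sl n.
  exact: (gamma_stein_upper_bound PT (sY n).1 (iY n) PGT mYG stG.2 w nu0 (st n) stG.1 hH).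
rewrite subrr normr0 add0r.
have := le_max (48 * `|p4 - nu|) (48 * `|p4 - nu|) (8 * `|p3 - nu|).
have := le_max (8 * `|p3 - nu|) (48 * `|p4 - nu|) (8 * `|p3 - nu|).
rewrite !lexx orbT => m1 m2; set M := Num.max _ _ in m1 m2 *.
have e4 := ler_norm (p4 - nu); have e3 := ler_norm (- (p3 - nu)); rewrite normrN in e3.
have := normr_ge0 (p4 - nu); move: m1 m2 e4 e3.
set x := `|p4 - nu|; set y := `|p3 - nu| => m1 m2 e4 e3 x0.
lra.
Qed.

(** The constant combines |Delta rho| <= 2 E and |Delta theta| <= 8 E with 48 |a_4| + 8
    |a_3| <= 104 (|a_3| + b). *)
Lemma d2_lower (t : R) : 0 < t -> t <= 1 -> 7 * (128 + 16 * (nu + 1)) * t <= 1 ->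
  ((t ^+ 4 / (100 * 104) * Mdist (distribution P F) (centered_gamma nu))%:E <=
    d2 (distribution P F) (centered_gamma nu))%E.
Proof.
move=> t0 t1 tK; have [p3 [p4 [c3 c4 ->]]] := Mdist_power_sums.
have [hc hs] := H2_wave t0 t1.
have up (h : R -> R) : H2 h -> (`|\int[distribution P F]_x h x - \int[centered_gamma nu]_x h x|%:E <=
    d2 (distribution P F) (centered_gamma nu))%E.
  by move=> hh; apply: ereal_sup_ubound; exists h.
have := up _ hc; have := up _ hs.
have bc := bcont_cos t; have bs := bcont_sin t.
have icF := bcont_comp_integrable PT sF.1 bc; have isF := bcont_comp_integrable PT sF.1 bs.
have icG := bcont_comp_integrable PGT mYG bc; have isG := bcont_comp_integrable PGT mYG bs.
have bc' := bcontZ t^-1 bc; have bs' := bcontZ t^-1 bs.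
rewrite (law_chaos (bcont_measurable bc') (bcont_comp_integrable PT sF.1 bc')).
rewrite (law_chaos (bcont_measurable bs') (bcont_comp_integrable PT sF.1 bs')).
rewrite (law_gamma (bcont_measurable bc') (bcont_comp_integrable PGT mYG bc')).
rewrite (law_gamma (bcont_measurable bs') (bcont_comp_integrable PGT mYG bs')).
rewrite (RintegralZl _ measurableT icF) (RintegralZl _ measurableT isF).
rewrite (RintegralZl _ measurableT icG) (RintegralZl _ measurableT isG).
rewrite -/(C t) -/(S t) -/(CG t) -/(SG t) -!mulrBr !normrM.
have ti : 1 <= `|t^-1| by rewrite normfV gtr0_norm// invr_ge1 ?unitfE ?gt_eqF.
set D := d2 _ _ => hSD hCD.
have {}hSD : (`|S t - SG t|%:E <= D)%E.
  by apply: le_trans hSD; rewrite lee_fin ler_peMl.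
have {}hCD : (`|C t - CG t|%:E <= D)%E.
  by apply: le_trans hCD; rewrite lee_fin ler_peMl.
pose E := `|C t - CG t| + `|S t - SG t|.
have tA : t ^+ 2 * (nu + 1) <= 4^-1.
  have n1 : 0 < nu + 1 by rewrite addr_gt0.
  have : t ^+ 2 * (nu + 1) <= t * (nu + 1).
    by apply: ler_wpM2r; [exact: ltW|rewrite expr2 ler_piMl// ltW].
  have : 0 < t * (nu + 1) by rewrite mulr_gt0.
  have := tK; have -> : 7 * (128 + 16 * (nu + 1)) * t = 896 * t + 112 * (t * (nu + 1)) by ring.
  lra.
have small k : spectrum_bounded (nu + 1) k ->
  [/\ - 2^-1 <= logmod k t, logmod k t <= 0 & `|logarg k t| <= 2^-1].
  move=> sk; split; last 2 first.
  - exact: logmod_le0 sk.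
  - apply: (le_trans (logarg_abs t sk)); rewrite -mulrA; lra.
  - apply: le_trans (logmod_ge t sk); rewrite lerN2; lra.
have key n : t ^+ 4 * (`|psum 3 (l n) - psum 2 (l n)| + pdev (l n)) <=
   50 * (`|expR (logmod (l n) t) * cos (logarg (l n) t) - CG t| +
         `|expR (logmod (l n) t) * sin (logarg (l n) t) - SG t|) + 14 * `|psum 2 (l n) - nu|.
  apply: (le_trans (log_char_lower (sl n) nu (ltW t0) t1 tK)).
  have [r1 r2 a1] := small _ (sl n); have [r3 r4 a2] := small _ sg.
  have [h1 h2] := polar_dist r1 r2 r3 r4 a1 a2 erefl.
  rewrite CGE SGE -/g; lra.
have lim : t ^+ 4 * (`|p3 - nu| + (p4 - 2 * p3 + nu)) <= 50 * E + 14 * `|nu - nu|.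
  have U : t ^+ 4 * (`|psum 3 (l n) - psum 2 (l n)| + pdev (l n)) @[n --> \oo] -->
      t ^+ 4 * (`|p3 - nu| + (p4 - 2 * p3 + nu)).
    apply: cvgMr; apply: cvgD; first by apply: cvg_norm; exact: cvgB.
    by apply: cvgD => //; apply: cvgB => //; apply: cvgMr; exact: c3.
  have V : 50 * (`|expR (logmod (l n) t) * cos (logarg (l n) t) - CG t| +
         `|expR (logmod (l n) t) * sin (logarg (l n) t) - SG t|) + 14 * `|psum 2 (l n) - nu|
      @[n --> \oo] --> 50 * E + 14 * `|nu - nu|.
    apply: cvgD; apply: cvgMr; last by apply: cvg_norm; apply: cvgB => //; exact: cvg_cst.
    by apply: cvgD; apply: cvg_norm; apply: cvgB; [exact: hC|exact: cvg_cst|exact: hS|exact: cvg_cst].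
  exact: (le_cvg U V key).
rewrite subrr normr0 mulr0 addr0 in lim.
have b0 : 0 <= p4 - 2 * p3 + nu.
  have U : pdev (l n) @[n --> \oo] --> p4 - 2 * p3 + nu.
    by apply: cvgD => //; apply: cvgB => //; apply: cvgMr; exact: c3.
  apply: (le_cvg (cvg_cst (0 : R)) U) => n; rewrite pdevE big_seq sumr_ge0// => p pl.
  by have [w _ _] := sl n; rewrite mulr_ge0 ?w// mulr_ge0 ?sqr_ge0.
have M104 : Num.max (48 * `|p4 - nu|) (8 * `|p3 - nu|) <= 104 * (`|p3 - nu| + (p4 - 2 * p3 + nu)).
  have n3 := normr_ge0 (p3 - nu).
  have : `|p4 - nu| <= (p4 - 2 * p3 + nu) + 2 * `|p3 - nu|.
    have -> : p4 - nu = (p4 - 2 * p3 + nu) + 2 * (p3 - nu) by ring.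
    by rewrite (le_trans (ler_normD _ _))// (ger0_norm b0) normrM (@ger0_norm _ 2).
  by move=> h4; rewrite ge_max; apply/andP; split; lra.
set m := `|p3 - nu| + (p4 - 2 * p3 + nu) in lim M104; set M := Num.max _ _ in M104 *.
have t4 : 0 < t ^+ 4 by rewrite exprn_gt0.
have fin : t ^+ 4 / (100 * 104) * M <= E / 2.
  have h : t ^+ 4 * M <= 104 * (t ^+ 4 * m).
    by rewrite [leRHS]mulrCA; apply: ler_wpM2l => //; exact: ltW.
  have -> : t ^+ 4 / (100 * 104) * M = (t ^+ 4 * M) / (100 * 104) by rewrite mulrAC.
  have -> : E / 2 = (104 * (50 * E)) / (100 * 104) by field.
  apply: ler_wpM2r; first by rewrite invr_ge0 mulr_ge0.
  by apply: (le_trans h); apply: ler_wpM2l.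
have [cs|sc] := leP (`|C t - CG t|) (`|S t - SG t|).
  by apply: le_trans hSD; rewrite lee_fin; apply: (le_trans fin); rewrite /E; lra.
by apply: le_trans hCD; rewrite lee_fin; apply: (le_trans fin); rewrite /E; lra.
Qed.
End second_chaos.

Theorem theorem1p3 (R : realType) (nu : R) (nu_gt0 : 0 < nu) :
  exists C1 C2 : R,
    [/\ 0 < C1, C1 < C2 &
      forall (d : measure_display) (T : measurableType d) (P : probability T R)
        (H : completeNormedModType R) (dot : {dot H for idfun})
        (X : H -> {RV P >-> R}) (F : {RV P >-> R}),
        is_inner_product dot -> separable H -> isonormal dot X ->
        wiener_chaos2 dot X F ->
        'E_P[(fun w => (F w ^+ 2)%R)]%E = (2 * nu)%:E ->
        (((C1 * Mdist (distribution P F) (centered_gamma nu))%:E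
            <= d2 (distribution P F) (centered_gamma nu))%E /\
         (d2 (distribution P F) (centered_gamma nu)
            <= (C2 * Mdist (distribution P F) (centered_gamma nu))%:E)%E)].
Proof.
pose K : R := 7 * (128 + 16 * (nu + 1)).
have K1 : 1 <= K by rewrite /K; lra.
have K0 : 0 < K by exact: lt_le_trans K1.
pose t := K^-1; have t0 : 0 < t by rewrite invr_gt0.
have t1 : t <= 1 by rewrite invf_le1.
have t4 : 0 < t ^+ 4 by rewrite exprn_gt0.
have t41 : t ^+ 4 <= 1 by rewrite exprn_ile1// ltW.
exists (t ^+ 4 / (100 * 104)), 2; split.
- by rewrite divr_gt0// mulr_gt0.
- rewrite ltr_pdivrMr ?mulr_gt0//; apply: (le_lt_trans t41); lra.
move=> d T P H dot X F ip _ iso ch EF2.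
have [sF [Y [l [sY st sl FY p2]]]] := chaos_approximation iso ip nu_gt0 ch EF2.
split; last exact: (d2_upper nu_gt0 sF sY st sl FY p2).
apply: (d2_lower nu_gt0 sF sY st sl FY p2 t0 t1).
by rewrite -/K /t mulfV// gt_eqF.
Qed.
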